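(* Let $T>0$ and let $u$ and $v$ be solutions of the Benjamin equation $$u_t+\mathcal H\partial_x^2u+\partial_x^3u+uu_x=0,\qquad (x,t)\in\mathbb R\times[0,T],$$ such that $$u,v\in C([0,T];H^s(\mathbb R))\cap C^1((0,T);H^{s-3}(\mathbb R)),\qquad s>7/2 .$$ Suppose there exists an open set $I\subset\mathbb R$ with $0\in I$ such that $$u(x,0)=v(x,0),\qquad x\in I,$$ and that for each positive integer $N$ there is a constant $c_N$ such that $$\int_{|x|\le R}|\partial_tu(x,0)-\partial_tv(x,0)|^2\,dx\le c_NR^N\qquad\text{as }R\downarrow0$$ (i.e. for all sufficiently small $R>0$). Then $$u(x,t)=v(x,t),\qquad (x,t)\in\mathbb R\times[0,T].$$
   Context: Solutions are real-valued. The Hilbert transform is $\mathcal Hf=(-i\,\mathrm{sgn}(\xi)\hat f(\xi))^\vee$, where $\hat f(\xi)=\int_{\mathbb R}e^{-i\xi x}f(x)\,dx$, and $H^s(\mathbb R)$ is the $L^2$-based Sobolev space. The derivative $\partial_tu(\cdot,0)$ is the time derivative at $t=0$ (one-sided, an element of $H^{s-3}(\mathbb R)$), so that the equation holds at $t=0$: $\partial_tu(\cdot,0)=-(\mathcal H\partial_x^2u+\partial_x^3u+uu_x)(\cdot,0)$. *)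

(* Defs.v *)
From HB Require Import structures.
From mathcomp Require Import all_boot all_order all_algebra.
From mathcomp Require Import all_classical all_reals all_analysis.
From mathcomp Require Import complex.

Set Implicit Arguments.
Unset Strict Implicit.
Unset Printing Implicit Defensive.

Import Order.TTheory GRing.Theory Num.Theory.
Import numFieldNormedType.Exports.
Local Open Scope classical_set_scope.
Local Open Scope ring_scope.
Local Open Scope complex_scope.

Section fourier.
Context {R : realType}.
Local Notation mu := (@lebesgue_measure R).

Definition expi (y : R) : R[i] := cos y +i* sin y.

Definition cintegral (D : set R) (f : R -> R[i]) : R[i] :=
  (\int[mu]_(x in D) complex.Re (f x)) +i* (\int[mu]_(x in D) complex.Im (f x)).

Definition L2 (f : R -> R[i]) : Prop :=
  (fun x => complex.Re (f x)) \in Lfun mu 2%:E /\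
  (fun x => complex.Im (f x)) \in Lfun mu 2%:E.

Definition L2norm (f : R -> R[i]) : \bar R :=
  Lnorm mu 2%:E (fun x => (Normc.normc (f x))%:E).

(* g is the limit in L^2, as n tends to infinity, of the functions
   y |-> \int_{-n}^n K y x f x dx. For f in L^2 this is the usual meaning of
   the Fourier integrals below when f is not assumed integrable. *)
Definition L2_transform (K : R -> R -> R[i]) (f g : R -> R[i]) : Prop :=
  [/\ L2 f, L2 g &
    L2norm (fun y => g y - cintegral `[- n%:R, n%:R] (fun x => K y x * f x))
      @[n --> \oo] --> 0%E].

Definition is_fourier : (R -> R[i]) -> (R -> R[i]) -> Prop :=
  L2_transform (fun xi x => expi (- (xi * x))).

Definition is_inv_fourier : (R -> R[i]) -> (R -> R[i]) -> Prop :=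
  L2_transform (fun x xi => ((2 * pi)^-1)%:C * expi (xi * x)).

(* Transforms on L^2; they are determined up to a null set, and a
   representative is chosen. *)
Definition fourier (f : R -> R[i]) : R -> R[i] :=
  xget (fun=> 0) [set F | is_fourier f F].

Definition inv_fourier (F : R -> R[i]) : R -> R[i] :=
  xget (fun=> 0) [set f | is_inv_fourier F f].

(* For f real valued, the inverse transform is real valued almost everywhere,
   so that taking the real part only serves to land in R. *)
Definition hilbert (f : R -> R) (x : R) : R :=
  complex.Re (inv_fourier
    (fun xi => (0 -i* Num.sg xi) * fourier (fun y => (f y)%:C) xi) x).

Definition sobolev_norm (s : R) (f : R -> R) : \bar R :=
  L2norm (fun xi => ((1 + xi ^+ 2) `^ (s / 2))%:C
                    * fourier (fun x => (f x)%:C) xi).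

(* H^s(R) for s >= 0. The first conjunct says that f is in L^2 and that
   fourier f is its transform, not the default value of xget. *)
Definition sobolev (s : R) (f : R -> R) : Prop :=
  is_fourier (fun x => (f x)%:C) (fourier (fun x => (f x)%:C)) /\
  (sobolev_norm s f < +oo)%E.

End fourier.

Section benjamin.
Context {R : realType}.
Local Notation mu := (@lebesgue_measure R).

(* Functions of space and time are written u t x, i.e. as curves t |-> u t. *)

Definition sobolev_continuous (s : R) (J : set R) (u : R -> R -> R) : Prop :=
  (forall t, J t -> sobolev s (u t)) /\
  (forall t, J t ->
    sobolev_norm s (fun x => u r x - u t x) @[r --> within J (nbhs t)] --> 0%E).

(* w is the derivative in H^s at t of the curve u on J; it is one-sided when t
   is an endpoint of the interval J. *)
Definition sobolev_derivative (s : R) (J : set R) (u : R -> R -> R) (t : R)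
    (w : R -> R) : Prop :=
  sobolev s w /\
  sobolev_norm s (fun x => (u r x - u t x) / (r - t) - w x)
    @[r --> within J t^'] --> 0%E.

(* u is a real-valued solution on [0, T] of
     u_t + H u_xx + u_xxx + u u_x = 0
   in C([0, T]; H^s) /\ C^1((0, T); H^(s - 3)), with time derivative ut.
   The definition is meant for s > 7/2. Then H^s is contained in C^3 and u t
   denotes the continuous representative of its class, so the space derivatives
   are the classical ones; ut t is an element of H^(s - 3), which is contained
   in L^2, and the equation is an equality in that space. *)
Definition benjamin_solution (s T : R) (u ut : R -> R -> R) : Prop :=
  [/\ forall t : R, t \in `[0, T] -> continuous (u t),
      sobolev_continuous s `[0, T] u,
      forall t : R, t \in `[0, T] ->
        sobolev_derivative (s - 3) `[0, T] u t (ut t),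
      sobolev_continuous (s - 3) `]0, T[ ut &
      forall t : R, t \in `[0, T] -> {ae mu, forall x,
        ut t x + hilbert (u t)^`(2)%classic x + (u t)^`(3)%classic x
          + u t x * (u t)^`()%classic x = 0}].

End benjamin.

(* Main.v *)
(** Put w = u(0) - v(0). On the interval I all local terms of the equation for w
  vanish, so the hypothesis on the time derivatives says that H w'' vanishes to
  infinite order at 0. As f = w'' vanishes for |y| < d, the function
  pi H f(x) = \int f(y) / (x - y) dy is analytic near 0 and its Taylor coefficients
  are the moments of f(y) / y against y^-k; these moments all vanish, and testing
  f(y) / y against powers of a polynomial in 1 / y that peaks at a given point
  gives f = 0, hence w = 0. Then u = v for all times by the energy estimate
  d/dt \int (u - v)^2 <= 3 M \int (u - v)^2, with M a bound for u_x and v_x, and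
  Gronwall's lemma.

  Everything is done with the Hartley transform, whose kernel cas = cos + sin is
  real and symmetric: on real functions it carries the same information as the
  Fourier transform, differentiation becomes F |-> - y F(- y) and the Hilbert
  transform F |-> sg(y) F(- y). *)

Require Import Defs.
From mathcomp Require Import all_boot all_order all_algebra.
From mathcomp Require Import all_classical all_reals all_analysis measurable_realfun.
From mathcomp Require Import complex ring lra.
Import Order.TTheory GRing.Theory Num.Theory.
Import numFieldNormedType.Exports.
Local Open Scope classical_set_scope.
Local Open Scope ring_scope.

(** * Integrable and square integrable functions *)

Section integration.
Set Implicit Arguments.
Unset Strict Implicit.
Context {R : realType}.
Local Notation mu := (@lebesgue_measure R).
Local Notation meas f := (measurable_fun setT (f : R -> R)).
Implicit Types (f g h : R -> R) (A : set R).

(** No Plancherel theorem is proved. What is available is one-sided: Bessel's inequality for [cint]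
    and the multiplication formula [hart_mul]. Bounding a function in L^2 by its transform therefore
    goes through a continuous representative, the inversion formula and Bessel's inequality for the
    transform; equality is established only where the transform of a derivative has to be
    identified, by duality with truncations. Inversion needs an integrable transform F, and a finite
    H^s norm makes x^k F integrable for s > k + 1/2. For k = 3 this is s > 7/2, which gives three
    classical derivatives; equivalently s - 3 > 1/2, which lets the convergence of difference
    quotients in H^(s-3) imply convergence in L^2. The kernels arise by inserting e^(-e|x|): the
    cosine part gives the Poisson kernel, hence inversion, and the sine part gives its conjugate,
    which tends to 1/(x - y) and links the multiplier -i sgn to the integral formula. The constant 3
    M comes from - 2 u_x w^2 + v_x w^2, left with w = u - v after v w w_x has been integrated by
    parts. *)

Definition intble f := mu.-integrable setT (EFin \o f).

Definition sqint f := meas f /\ intble (fun x => f x ^+ 2).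

Lemma ae_imp (P Q : R -> Prop) : {ae mu, forall x, P x} ->
  (forall x, P x -> Q x) -> {ae mu, forall x, Q x}.
Proof. move=> aP PQ; have := @filterS _ (almost_everywhere mu) _ P Q PQ; apply; exact: aP. Qed.

Lemma ae_imp2 (P1 P2 Q : R -> Prop) : {ae mu, forall x, P1 x} ->
  {ae mu, forall x, P2 x} -> (forall x, P1 x -> P2 x -> Q x) ->
  {ae mu, forall x, Q x}.
Proof. move=> a1 a2 PQ; have := @filterS2 _ (almost_everywhere mu) _ P1 P2 Q PQ; apply; [exact: a1|exact: a2]. Qed.

Lemma intble_meas f : intble f -> meas f.
Proof. by move=> /measurable_int/measurable_EFinP. Qed.

Lemma intble_le f g : meas f -> (forall x, `|f x| <= g x) ->
  intble g -> intble f.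
Proof.
move=> mf fg; apply: le_integrable => //; first exact/measurable_EFinP.
by move=> x _ /=; rewrite lee_fin (le_trans (fg x))// ler_norm.
Qed.

Lemma intbleD f g : intble f -> intble g -> intble (fun x => f x + g x).
Proof. by move=> F G; have := @integrableD _ _ _ mu _ measurableT _ _ F G. Qed.

Lemma intbleB f g : intble f -> intble g -> intble (fun x => f x - g x).
Proof. by move=> F G; have := @integrableB _ _ _ mu _ measurableT _ _ F G. Qed.

Lemma intbleZ (c : R) f : intble f -> intble (fun x => c * f x).
Proof. by move=> F; have := @integrableZl _ _ _ mu _ measurableT c _ F. Qed.

Lemma intbleN f : intble f -> intble (fun x => - f x).
Proof. by move=> F; have := @integrableN _ _ _ mu _ _ F. Qed.

Lemma intble_norm f : intble f -> intble (fun x => `|f x|).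
Proof. exact: integrable_norm. Qed.

Lemma intble0 : intble (fun=> 0).
Proof. exact: integrable0. Qed.

Lemma eq_intble f g : f =1 g -> intble f -> intble g.
Proof. by move=> /funext ->. Qed.

Lemma intbleMb M f h : meas h -> (forall x, `|h x| <= M) ->
  intble f -> intble (fun x => h x * f x).
Proof.
move=> mh hM If; apply: (@intble_le _ (fun x => M * `|f x|)).
- by apply: measurable_funM => //; exact: intble_meas.
- by move=> x; rewrite normrM ler_wpM2r.
- exact/intbleZ/intble_norm.
Qed.

Lemma intble_patch A f : measurable A -> intble f -> intble (f \_ A).
Proof.
move=> mA If; apply: (@intble_le _ (fun x => `|f x|)).
- apply/(measurable_restrictT f mA); apply: measurable_funS (intble_meas If) => //.
- by move=> x; rewrite patchE; case: ifP => // _; rewrite normr0.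
- exact: intble_norm.
Qed.

Lemma intD f g : intble f -> intble g ->
  \int[mu]_x (f x + g x) = \int[mu]_x f x + \int[mu]_x g x.
Proof. by move=> F G; rewrite RintegralD. Qed.

Lemma intB f g : intble f -> intble g ->
  \int[mu]_x (f x - g x) = \int[mu]_x f x - \int[mu]_x g x.
Proof. by move=> F G; rewrite RintegralB. Qed.

Lemma intZ (c : R) f : intble f ->
  \int[mu]_x (c * f x) = c * \int[mu]_x f x.
Proof. by move=> F; rewrite RintegralZl. Qed.

Lemma intN f : intble f -> \int[mu]_x (- f x) = - \int[mu]_x f x.
Proof.
move=> F; rewrite -mulN1r -intZ//.
by apply: eq_Rintegral => x _; rewrite mulN1r.
Qed.

Lemma eq_int f g : f =1 g -> \int[mu]_x f x = \int[mu]_x g x.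
Proof. by move=> /funext ->. Qed.

Lemma int_le f g : intble f -> intble g -> (forall x, f x <= g x) ->
  \int[mu]_x f x <= \int[mu]_x g x.
Proof. by move=> F G fg; apply: le_Rintegral. Qed.

Lemma int_ge0 f : (forall x, 0 <= f x) -> 0 <= \int[mu]_x f x.
Proof. by move=> f0; apply: Rintegral_ge0 => x _. Qed.

Lemma int_norm f : intble f -> `|\int[mu]_x f x| <= \int[mu]_x `|f x|.
Proof. by move=> F; apply: le_normr_Rintegral. Qed.

Lemma int_norm_le f g : meas f -> intble g ->
  (forall x, `|f x| <= g x) -> `|\int[mu]_x f x| <= \int[mu]_x g x.
Proof.
move=> mf G fg; have F := intble_le mf fg G.
by rewrite (le_trans (int_norm F))// int_le// intble_norm.
Qed.

Lemma integral_int f : intble f -> (\int[mu]_x (f x)%:E)%E = (\int[mu]_x f x)%:E.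
Proof. by move=> F; rewrite fineK//; exact: integrable_fin_num. Qed.

Lemma ge0_intble f (c : R) : meas f -> (forall x, 0 <= f x) ->
  (\int[mu]_x (f x)%:E <= c%:E)%E -> intble f.
Proof.
move=> mf f0 fc; apply/integrableP; split; first exact/measurable_EFinP.
under eq_integral do rewrite /= ger0_norm//.
by rewrite (le_lt_trans fc)// ltry.
Qed.

Lemma ae_intble f g : meas g -> {ae mu, forall x, f x = g x} ->
  intble f -> intble g.
Proof.
move=> mg fg /integrableP[mf fi]; apply/integrableP; split.
  exact/measurable_EFinP.
rewrite (_ : (\int[mu]_x _ = \int[mu]_x `|(EFin \o f) x|)%E)//.
apply: ae_eq_integral => //.
- by apply: measurableT_comp => //; exact/measurable_EFinP.
- exact: measurableT_comp.
- by apply: (ae_imp fg) => x /= -> _.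
Qed.

Lemma ae_int f g : meas f -> meas g ->
  {ae mu, forall x, f x = g x} -> \int[mu]_x f x = \int[mu]_x g x.
Proof.
move=> mf mg fg; congr fine; apply: ae_eq_integral => //.
- exact/measurable_EFinP.
- exact/measurable_EFinP.
- by apply: (ae_imp fg) => x /= -> _.
Qed.

Lemma int_eq0_ae f : intble f -> (forall x, 0 <= f x) -> \int[mu]_x f x = 0 ->
  {ae mu, forall x, f x = 0}.
Proof.
move=> F f0 if0.
have : (\int[mu]_x `|(f x)%:E| = 0)%E.
  under eq_integral do rewrite /= ger0_norm//.
  by rewrite integral_int// if0.
have mf : @measurable_fun _ _ (measurableTypeR R) _ setT (EFin \o f).
  by apply/measurable_EFinP; exact: (intble_meas F).
move/(ae_eq_integral_abs _ measurableT mf) => h.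
by apply: (ae_imp h) => x /(_ I) [].
Qed.

Lemma dominated_cvg_int (f_ : nat -> R -> R) f g :
  (forall n, meas (f_ n)) ->
  (forall x, f_ ^~ x @ \oo --> f x) ->
  (forall n x, `|f_ n x| <= g x) -> intble g ->
  intble f /\ (\int[mu]_x f_ n x) @[n --> \oo] --> \int[mu]_x f x.
Proof.
move=> mf ff fg G.
have mff : meas f.
  by apply: (@measurable_fun_cvg _ _ _ _ f_) => // x _; exact: ff.
have [] := @dominated_convergence _ _ _ mu _ measurableT
  (fun n x => (f_ n x)%:E) (EFin \o f) (EFin \o g).
- by move=> n; apply/measurable_EFinP; exact: mf.
- exact/measurable_EFinP.
- by apply: aeW => x _; apply: cvg_EFin (ff x); exact: nearW.
- exact: G.
- by apply: aeW => x n _; rewrite lee_fin.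
- move=> If _ h; split => //.
  by apply: fine_cvg; rewrite -integral_int.
Qed.

Lemma fatou_int (f_ : nat -> R -> R) f (C : R) :
  (forall n, intble (f_ n)) -> (forall n x, 0 <= f_ n x) ->
  (forall x, f_ ^~ x @ \oo --> f x) ->
  (forall n, \int[mu]_x f_ n x <= C) ->
  intble f /\ \int[mu]_x f x <= C.
Proof.
move=> If f0 ff fC.
have mff : meas f.
  apply: (@measurable_fun_cvg _ _ _ _ f_) => [n|x _]; last exact: ff.
  exact: intble_meas.
have ff0 x : 0 <= f x.
  by rewrite -(cvg_lim _ (ff x))//; apply: limr_ge;
    [apply/cvg_ex; eexists; exact: ff|exact: nearW].
have h : (\int[mu]_x (f x)%:E <= C%:E)%E.
  have := @fatou _ _ _ mu _ measurableT (fun n x => (f_ n x)%:E).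
  have -> : (\int[mu]_x (f x)%:E = \int[mu]_x limn_einf ((fun n x => (f_ n x)%:E)^~ x))%E.
    apply: eq_integral => x _.
    have h : ((f_ n x)%:E @[n --> \oo] --> (f x)%:E)%E.
      by apply: cvg_EFin (ff x); exact: nearW.
    by rewrite is_cvg_limn_einfE; [exact/esym/cvg_lim|apply/cvg_ex; eexists; exact: h].
  move=> /(_ _ _)/le_trans; apply.
  - by move=> n; apply/measurable_EFinP; exact: (intble_meas (If n)).
  - by move=> n x _; rewrite lee_fin.
  - rewrite limn_einf_lim; apply: lime_le; first exact: is_cvg_einfs.
    apply: nearW => n; apply: (@le_trans _ _ (\int[mu]_x (f_ n x)%:E)%E).
      by apply: ereal_inf_lbound; exists n => /=.
    by rewrite integral_int// lee_fin.
have If' := ge0_intble mff ff0 h.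
by split => //; rewrite -lee_fin -integral_int.
Qed.

Lemma ge0_integral_opp (g : R -> \bar R) : measurable_fun setT g ->
  (forall x, 0 <= g x)%E -> (\int[mu]_x g (- x)%R = \int[mu]_x g x)%E.
Proof.
have mN : measurable_fun setT (-%R : measurableTypeR R -> measurableTypeR R).
  exact: oppr_measurable.
move=> mg g0.
have := @ge0_integral_pushforward _ _ (measurableTypeR R) (measurableTypeR R) R
  _ mN mu setT g measurableT mg (fun x _ => g0 x).
rewrite preimage_setT => <-; apply: eq_measure_integral => A mA _.
exact: lebesgue_measureN.
Qed.

Lemma int_opp f : meas f -> \int[mu]_x f (- x) = \int[mu]_x f x.
Proof.
move=> mf; rewrite /Rintegral; congr fine.
have mfE : measurable_fun setT (EFin \o f) by apply/measurable_EFinP.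
rewrite integralE [RHS]integralE; congr (_ - _)%E.
- rewrite -(ge0_integral_opp (measurable_funepos mfE)) => [|x].
    by apply: eq_integral => x _; rewrite !funeposE.
  exact: funepos_ge0.
- rewrite -(ge0_integral_opp (measurable_funeneg mfE)) => [|x].
    by apply: eq_integral => x _; rewrite !funenegE.
  exact: funeneg_ge0.
Qed.

Lemma meas_opp f : meas f -> meas (fun x => f (- x)).
Proof. by move=> mf; apply: measurableT_comp => //; exact: oppr_measurable. Qed.

Lemma intble_opp f : intble f -> intble (fun x => f (- x)).
Proof.
move=> If; have mf := intble_meas If.
apply/integrableP; split.
  by apply/measurable_EFinP; exact: (meas_opp mf).
have mg : measurable_fun setT (fun x : R => `|(f x)%:E|%E).
  by apply: measurableT_comp => //; exact/measurable_EFinP.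
have -> : (\int[mu]_x `|(EFin \o (fun x : R => f (- x)%R)) x| =
  \int[mu]_x `|(f x)%:E|)%E by rewrite -(ge0_integral_opp mg).
by case/integrableP: If.
Qed.

(** Reflection exchanges the positive and the negative part. When their common integral is infinite,
    so is the difference, and [fine] sends it to 0. *)
Lemma int_odd f : meas f -> (forall x, f (- x) = - f x) -> \int[mu]_x f x = 0.
Proof.
move=> mf fN.
have [If|nIf] := pselect (intble f).
  have := int_opp mf; rewrite (eq_int fN).
  by rewrite intN// => h; lra.
have mfE : measurable_fun setT (EFin \o f) by apply/measurable_EFinP.
rewrite /Rintegral integralE -(ge0_integral_opp (measurable_funepos mfE)).
  rewrite (_ : (\int[mu]_x (EFin \o f)^\+ (- x)%R =
    \int[mu]_x (EFin \o f)^\- x)%E); last first.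
    by apply: eq_integral => x _; rewrite funeposE funenegE /= fN.
  set a := (\int[mu]_x _)%E.
  by case: a => [r||] //=; rewrite subrr.
by move=> x; exact: funepos_ge0.
Qed.

End integration.

(** * Square integrable functions: Cauchy-Schwarz and Fubini for bounded kernels *)

Section square_integrable.
Set Implicit Arguments.
Unset Strict Implicit.
Context {R : realType}.
Local Notation mu := (@lebesgue_measure R).
Local Notation meas f := (measurable_fun setT (f : R -> R)).
Implicit Types (f g h : R -> R) (A : set R).

Lemma ae_sqint f g : meas g -> {ae mu, forall x, f x = g x} ->
  sqint f -> sqint g.
Proof.
move=> mg fg [mf If]; split => //; apply: ae_intble If.
  exact: measurable_funX.
by apply: (ae_imp fg) => x ->.
Qed.

Lemma sqint_mul f g : sqint f -> sqint g -> intble (fun x => f x * g x).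
Proof.
move=> [mf If] [mg Ig].
apply: (@intble_le _ _ (fun x => f x ^+ 2 + g x ^+ 2)).
- exact: measurable_funM.
- move=> x; rewrite normrM -[f x ^+ 2]real_normK ?num_real//.
  rewrite -[g x ^+ 2]real_normK ?num_real//.
  have := normr_ge0 (f x); have := normr_ge0 (g x).
  by move: (`|f x|) (`|g x|) => a b; nra.
- exact: intbleD.
Qed.

Lemma sqintD f g : sqint f -> sqint g -> sqint (fun x => f x + g x).
Proof.
move=> F G; split; first by apply: measurable_funD; [case: F|case: G].
apply: (@eq_intble _ (fun x => (f x ^+ 2 + g x ^+ 2) + 2 * (f x * g x))).
  by move=> x; ring.
by apply: intbleD; [apply: intbleD; [case: F|case: G]|exact/intbleZ/sqint_mul].
Qed.

Lemma sqintZ (c : R) f : sqint f -> sqint (fun x => c * f x).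
Proof.
move=> [mf If]; split; first exact: measurable_funM.
apply: (@eq_intble _ (fun x => c ^+ 2 * f x ^+ 2)).
  by move=> x; rewrite exprMn.
exact: intbleZ.
Qed.

Lemma sqintN f : sqint f -> sqint (fun x => - f x).
Proof.
move=> F; have := sqintZ (-1) F; congr sqint.
by apply/funext => x; rewrite mulN1r.
Qed.

Lemma sqintB f g : sqint f -> sqint g -> sqint (fun x => f x - g x).
Proof. by move=> F G; apply: sqintD => //; exact: sqintN. Qed.

Lemma sqint_patch A f : measurable A -> sqint f -> sqint (f \_ A).
Proof.
move=> mA [mf If]; split.
  apply/(measurable_restrictT f mA); exact: measurable_funS mf.
apply: (@eq_intble _ ((fun x => f x ^+ 2) \_ A)); last exact: intble_patch.
by move=> x; rewrite !patchE; case: ifP => // _; rewrite expr0n.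
Qed.

Lemma sqint_opp f : sqint f -> sqint (fun x => f (- x)).
Proof.
move=> [mf If]; split; first exact: meas_opp.
exact: (intble_opp If).
Qed.

Lemma sqintMb M f h : meas h -> (forall x, `|h x| <= M) ->
  sqint f -> sqint (fun x => h x * f x).
Proof.
move=> mh hM [mf If]; split; first exact: measurable_funM.
apply: (@eq_intble _ (fun x => h x ^+ 2 * f x ^+ 2)).
  by move=> x; rewrite exprMn.
apply: (@intbleMb _ (M ^+ 2)) => //; first exact: measurable_funX.
move=> x; rewrite normrX ler_pXn2r// ?nnegrE//.
by rewrite (le_trans _ (hM x)).
Qed.

Lemma bounded_sqint M f : intble f -> (forall x, `|f x| <= M) -> sqint f.
Proof.
move=> If fM; have mf := intble_meas If; split => //.
by apply: (intbleMb mf fM).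
Qed.

Lemma sqint_itv_intble A f : sqint f -> measurable A -> (mu A < +oo)%E ->
  intble (f \_ A).
Proof.
move=> [mf If] mA Afin.
have I1 : intble (\1_A : R -> R).
  apply/integrableP; split; first exact/measurable_EFinP.
  under eq_integral do rewrite /= ger0_norm//.
  by rewrite integral_indic// setIT.
apply: (@intble_le _ _ (fun x => \1_A x + f x ^+ 2)).
- apply/(measurable_restrictT f mA); exact: measurable_funS mf.
- move=> x; rewrite patchE indicE; case: ifP => _ /=.
    rewrite -[f x ^+ 2]real_normK ?num_real//.
    by have := normr_ge0 (f x); move: (`|f x|) => a; nra.
  by rewrite normr0 add0r sqr_ge0.
- exact: intbleD.
Qed.

Lemma int_sqr_ge0 f : 0 <= \int[mu]_x f x ^+ 2.
Proof. by apply: int_ge0 => x; exact: sqr_ge0. Qed.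

Lemma int_sqrD_le f g : sqint f -> sqint g ->
  \int[mu]_x (f x + g x) ^+ 2 <=
  2 * (\int[mu]_x f x ^+ 2) + 2 * (\int[mu]_x g x ^+ 2).
Proof.
move=> F G; have [_ If] := F; have [_ Ig] := G.
rewrite -!intZ// -intD//; try exact: intbleZ.
apply: int_le => //; first by case: (sqintD F G).
  by apply: intbleD; exact: intbleZ.
by move=> x; have := sqr_ge0 (f x - g x); nra.
Qed.

(** The quadratic form \int (s f + t g)^2 is nonnegative, and its value at (b, - c) is b (a b -
    c^2). *)
Lemma cauchy_schwarz f g : sqint f -> sqint g ->
  (\int[mu]_x (f x * g x)) ^+ 2 <=
  (\int[mu]_x f x ^+ 2) * (\int[mu]_x g x ^+ 2).
Proof.
move=> F G; have [_ If] := F; have [_ Ig] := G; have fg := sqint_mul F G.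
set a := \int[mu]_x f x ^+ 2; set b := \int[mu]_x g x ^+ 2.
set c := \int[mu]_x (f x * g x).
have q (s t : R) : 0 <= s ^+ 2 * a + 2 * s * t * c + t ^+ 2 * b.
  have -> : s ^+ 2 * a + 2 * s * t * c + t ^+ 2 * b =
      \int[mu]_x (s * f x + t * g x) ^+ 2.
    rewrite /a /b /c -!intZ// -!intD//; try exact: intbleZ.
      by apply: eq_int => x; ring.
    by apply: intbleD; exact: intbleZ.
  exact: int_sqr_ge0.
have a0 : 0 <= a by exact: int_sqr_ge0.
have b0 : 0 <= b by exact: int_sqr_ge0.
have [b_0|b_n0] := eqVneq b 0.
  rewrite b_0 mulr0; have [->|c0] := eqVneq c 0; first by rewrite expr0n.
  (* With b = 0 the form is affine in t, and this choice of t makes it equal to -1. *)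
  have := q 1 (- (a + 1) / (2 * c)); rewrite b_0.
  have -> : 2 * 1 * (- (a + 1) / (2 * c)) * c = - (a + 1) by field.
  by lra.
have b_gt0 : 0 < b by rewrite lt_neqAle eq_sym b_n0.
have := q b (- c).
have -> : b ^+ 2 * a + 2 * b * - c * c + (- c) ^+ 2 * b = b * (a * b - c ^+ 2).
  by ring.
by rewrite pmulr_rge0// subr_ge0.
Qed.

Lemma int_sqr_eq0 f : sqint f -> \int[mu]_x f x ^+ 2 = 0 ->
  {ae mu, forall x, f x = 0}.
Proof.
move=> [mf If] /(int_eq0_ae If) h.
apply: (ae_imp (h _)); first by move=> x; exact: sqr_ge0.
by move=> x /eqP; rewrite sqrf_eq0 => /eqP.
Qed.

(** Cauchy-Schwarz bounds the error by the L^2 distance times the norm of g; dividing by [b + 1]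
    rather than [b] covers g = 0. *)
Lemma cvg_int_mul (T : Type) (F : set_system T) {FF : Filter F}
    (f_ : T -> R -> R) f g :
  (\forall i \near F, sqint (f_ i)) -> sqint f -> sqint g ->
  (\int[mu]_x (f_ i x - f x) ^+ 2) @[i --> F] --> 0 ->
  (\int[mu]_x (f_ i x * g x)) @[i --> F] --> \int[mu]_x (f x * g x).
Proof.
move=> Lf_ Lf Lg h; apply/cvgrPdist_lt => e e0.
set b := \int[mu]_x g x ^+ 2.
have b0 : 0 <= b by exact: int_sqr_ge0.
move/cvgrPdist_lt: h => /(_ (e ^+ 2 / (b + 1))).
have be : 0 < e ^+ 2 / (b + 1) by rewrite divr_gt0 ?exprn_gt0//; lra.
move=> /(_ be); apply: filterS2 Lf_ => i Li.
rewrite sub0r normrN ger0_norm ?int_sqr_ge0// => hi.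
rewrite -intB; [|exact: sqint_mul..].
rewrite -normrN -intN; last by apply: intbleB; exact: sqint_mul.
rewrite -(@ltr_pXn2r _ 2)// ?nnegrE ?ltW// real_normK ?num_real//.
rewrite (_ : \int[mu]_x _ = \int[mu]_x ((f_ i x - f x) * g x)); last first.
  by apply: eq_int => x; ring.
apply: (le_lt_trans (cauchy_schwarz (sqintB Li Lf) Lg)); rewrite -/b.
move: hi; rewrite ltr_pdivlMr; last by lra.
have := int_sqr_ge0 (fun x => f_ i x - f x).
by nra.
Qed.

Lemma fubini_kernel (k : R -> R -> R) (M : R) f g :
  measurable_fun setT (fun z : R * R => k z.1 z.2) ->
  (forall x y, `|k x y| <= M) -> intble f -> intble g ->
  \int[mu]_x (f x * \int[mu]_y (k x y * g y)) =
  \int[mu]_y (g y * \int[mu]_x (k x y * f x)).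
Proof.
move=> mk kM If Ig; have mf := intble_meas If; have mg := intble_meas Ig.
have mkx x : meas (k x) by exact: (measurableT_comp mk (measurable_pair1 x)).
have mky y : meas (k^~ y) by exact: (measurableT_comp mk (measurable_pair2 y)).
have mF : measurable_fun setT (fun z : R * R => f z.1 * (k z.1 z.2 * g z.2)).
  apply: measurable_funM; first by apply: measurableT_comp => //; exact: measurable_fst.
  by apply: measurable_funM => //; apply: measurableT_comp => //; exact: measurable_snd.
have IF : (mu \x mu)%E.-integrable setT
    (EFin \o (fun z : R * R => f z.1 * (k z.1 z.2 * g z.2))).
  apply/integrable12ltyP; first exact/measurable_EFinP.
  apply: (@le_lt_trans _ _ (\int[mu]_x (`|f x| * \int[mu]_y (M * `|g y|))%:E)%E).
    apply: ge0_le_integral => //.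
    - by move=> x _; apply: integral_ge0.
    - apply: (@measurable_fun_fubini_tonelli_F _ _ _ _ _ mu
        (fun z : R * R => `|(f z.1 * (k z.1 z.2 * g z.2))%:E|%E)) => //.
      by apply: measurableT_comp => //; exact/measurable_EFinP.
    - by apply/measurable_EFinP; apply: measurable_funM => //; apply: measurableT_comp.
    - move=> x _; rewrite -intZ; last exact/intbleZ/intble_norm.
      rewrite -integral_int; last exact/intbleZ/intbleZ/intble_norm.
      apply: ge0_le_integral => //.
      + apply/measurable_EFinP; apply: measurableT_comp => //.
        have m1 : meas (fun y => f x * (k x y * g y)).
          by apply: measurable_funM => //; exact: measurable_funM.
        exact: m1.
      + by apply/measurable_EFinP; apply: measurable_funM => //;
          apply: measurable_funM => //; apply: measurableT_comp.
      + move=> y _; rewrite /= lee_fin !normrM ler_wpM2l// ler_wpM2r//.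
  rewrite integral_int ?ltry//.
  under eq_fun do rewrite mulrC.
  exact/intbleZ/intble_norm.
have := Fubini IF => /(congr1 fine).
have e1 x : (\int[mu]_y (f x * (k x y * g y))%:E =
    (f x * \int[mu]_y (k x y * g y))%:E)%E.
  have I1 : intble (fun y => k x y * g y).
    by apply: (@intbleMb _ M) .
  by rewrite integral_int ?intZ//; exact: intbleZ.
have e2 y : (\int[mu]_x (f x * (k x y * g y))%:E =
    (g y * \int[mu]_x (k x y * f x))%:E)%E.
  have I1 : intble (fun x => k x y * f x).
    by apply: (@intbleMb _ M) .
  rewrite -intZ// -integral_int; last exact: intbleZ.
  by apply: eq_integral => x _; congr EFin; ring.
rewrite /=; under eq_integral do rewrite e1.
by under [in RHS]eq_integral do rewrite e2.
Qed.

End square_integrable.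

(** * The Poisson kernel *)

Section half_line.
Set Implicit Arguments.
Unset Strict Implicit.
Context {R : realType}.
Local Notation mu := (@lebesgue_measure R).
Local Notation meas f := (measurable_fun setT (f : R -> R)).
Implicit Types (f g h F : R -> R) (A : set R).

Lemma continuous_meas f : continuous f -> meas f.
Proof. by move=> cf; exact: continuous_measurable_fun. Qed.

(** Nonnegativity turns the improper integral into a Lebesgue integral. The derivative is asked for
    x > 0 only, because the integrands below are functions of |x| and their primitives are formulas
    valid on the half-line. *)
Lemma int_even_ge0 f F (l : R) : continuous f -> (forall x, 0 <= f x) ->
  (forall x, f (- x) = f x) ->
  (forall x : R, 0 < x -> is_derive x 1 F (f x)) -> {for 0, continuous F} ->
  F x @[x --> +oo%R] --> l -> intble f /\ \int[mu]_x f x = 2 * (l - F 0).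
Proof.
move=> cf f0 fN dF F0 Fl.
have e : (\int[mu]_x (f x)%:E = (2 * (l - F 0))%:E)%E.
  rewrite ge0_symfun_integralT//; last by move=> x; rewrite /= fN.
  rewrite EFinM; congr (_ * _)%E.
  rewrite (_ : [set x : R | 0 <= x] = `[0, +oo[%classic); last first.
    by apply/seteqP; split => x /=; rewrite in_itv /= andbT.
  rewrite (@ge0_continuous_FTC2y _ f F 0 l) ?EFinB//.
  - exact: continuous_subspaceT.
  - by move=> x x0; have [] := dF x x0.
  - exact: cvg_at_right_filter.
  - by move=> x; rewrite in_itv /= andbT => x0; rewrite derive1E; have [_ ->] := dF x x0.
have If : intble f.
  by apply: (@ge0_intble _ _ (2 * (l - F 0))) => //; [exact: continuous_meas|rewrite e].
by split => //; rewrite /Rintegral e.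
Qed.

Lemma lebesgue_measure_shift (c : R) A : measurable A ->
  pushforward mu (fun x : measurableTypeR R => x + c : measurableTypeR R) A = mu A.
Proof.
have mc : measurable_fun setT (fun x : measurableTypeR R => x + c : measurableTypeR R).
  exact: measurable_funD.
move=> mA; apply/esym/lebesgue_measure_unique => //= _ [[a b]] _ <-.
rewrite /pushforward (_ : _ @^-1` _ = `]a - c, b - c]%classic).
  by rewrite !lebesgue_measure_itv/= !lte_fin ltrD2r !EFinB; case: ifP => // _; congr EFin; ring.
by apply/seteqP; split => x /=; rewrite !in_itv /= ltrBlDr lerBrDr.
Qed.

Lemma intble_shift (c : R) f : (forall x, 0 <= f x) -> intble f ->
  intble (fun x => f (x + c)) /\ \int[mu]_x f (x + c) = \int[mu]_x f x.
Proof.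
move=> f0 If.
have mc : measurable_fun setT (fun x : measurableTypeR R => x + c : measurableTypeR R).
  exact: measurable_funD.
have mfE : measurable_fun setT (EFin \o f).
  by apply/measurable_EFinP; exact: intble_meas If.
have e : (\int[mu]_x (f (x + c))%:E = \int[mu]_x (f x)%:E)%E.
  have := @ge0_integral_pushforward _ _ (measurableTypeR R) (measurableTypeR R) R
    _ mc mu setT (EFin \o f) measurableT mfE.
  rewrite preimage_setT => <- => [|x _]; last by rewrite lee_fin.
  by apply: eq_measure_integral => A mA _; exact: lebesgue_measure_shift.
split; last by rewrite /Rintegral e.
apply: (@ge0_intble _ _ (\int[mu]_x f x)) => //.
  by apply: measurableT_comp; [exact: intble_meas|exact: measurable_funD].
by rewrite e integral_int.
Qed.

(* Not normalized: its integral is pi. *)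
Definition poisson (e a : R) := e / (e ^+ 2 + a ^+ 2).

Lemma poisson_den (e a : R) : 0 < e -> 0 < e ^+ 2 + a ^+ 2.
Proof. by move=> e0; rewrite ltr_wpDr ?sqr_ge0// exprn_gt0. Qed.

Lemma poissonN (e a : R) : poisson e (- a) = poisson e a.
Proof. by rewrite /poisson sqrrN. Qed.

Lemma poisson_ge0 (e a : R) : 0 < e -> 0 <= poisson e a.
Proof. by move=> e0; rewrite divr_ge0// ltW// poisson_den. Qed.

Lemma continuous_poisson (e : R) : 0 < e -> continuous (poisson e).
Proof.
move=> e0 x; apply: cvgM; first exact: cvg_cst.
apply: cvgV; first by rewrite gt_eqF// poisson_den.
by apply: cvgD; [exact: cvg_cst|exact: exprn_continuous].
Qed.

Lemma int_poisson (e x : R) : 0 < e -> intble (fun y => poisson e (x - y)) /\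
  \int[mu]_y poisson e (x - y) = pi.
Proof.
move=> e0.
have [I0 i0] : intble (poisson e) /\ \int[mu]_y poisson e y = 2 * (pi / 2 - atan (0 / e)).
  apply: (@int_even_ge0 _ (fun y => atan (y / e))).
  - exact: continuous_poisson.
  - by move=> y; exact: poisson_ge0.
  - by move=> y; exact: poissonN.
  - move=> y y0.
    apply: is_derive_eq; rewrite /poisson /GRing.scale /=.
    by field; rewrite !gt_eqF//= addrC poisson_den.
  - apply: continuous_comp; last exact: continuous_atan.
    exact: mulrr_continuous.
  - have h : (y / e) @[y --> +oo%R] --> +oo%R.
      by apply: gt0_cvgMly => //; rewrite invr_gt0.
    exact: cvg_comp h (@cvgy_atan R).
have [+ +] := intble_shift (- x) (fun y => poisson_ge0 y e0) I0.
rewrite i0 mul0r atan0 subr0 => I1 i1; split.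
  by apply: eq_intble I1 => y; rewrite -poissonN opprB.
transitivity (\int[mu]_y poisson e (y + - x)).
  by apply: eq_int => y; rewrite -poissonN opprB.
by rewrite i1; field.
Qed.

Lemma is_derive_continuous F (x d : R) : is_derive x 1 F d ->
  {for x, continuous F}.
Proof. by move=> [dF _]; apply: differentiable_continuous; exact/derivable1_diffP. Qed.

Lemma cvgy_expRM (e M : R) f : 0 < e -> (forall x, `|f x| <= M) ->
  (expR (- (e * x)) * f x) @[x --> +oo%R] --> 0.
Proof.
move=> e0 fM; have h : (e * x) @[x --> +oo%R] --> +oo%R by exact: gt0_cvgMry.
have h2 : (expR (- (e * x)) * M) @[x --> +oo%R] --> 0.
  rewrite -[X in _ --> X](mul0r M); apply: cvgM; last exact: cvg_cst.
  exact: cvg_comp h (@cvgr_expR R).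
apply: norm_cvg0; apply: squeeze_cvgr h2; last exact: (@cvg_cst _ (0 : R)).
by near=> x; rewrite normr_ge0 /= normrM ger0_norm ?expR_ge0// ler_wpM2l// expR_ge0.
Unshelve. all: by end_near. Qed.

(** [int_even_ge0] handles nonnegative even integrands only. So 1 + cos(a x) and 1 + sin(a |x|) are
    integrated against the exponential, and the integral of the exponential alone is subtracted;
    sg(x) sin(a x) equals sin(a |x|). *)
Lemma int_exp (e a : R) : 0 < e ->
  [/\ intble (fun x => expR (- (e * `|x|))),
      \int[mu]_x (expR (- (e * `|x|)) * cos (a * x)) = 2 * poisson e a &
      \int[mu]_x (expR (- (e * `|x|)) * (Num.sg x * sin (a * x))) =
      2 * (a / (e ^+ 2 + a ^+ 2))].
Proof.
move=> e0; have d0 := poisson_den a e0.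
have ce : continuous (fun x : R => expR (- (e * `|x|))).
  move=> x; apply: continuous_comp; last exact: continuous_expR.
  by apply: cvgN; apply: cvgM; [exact: cvg_cst|exact: norm_continuous].
have cax : continuous (fun x : R => a * x) by exact: mulrl_continuous.
have cE1 : expR (- (e * 0)) = 1 :> R by rewrite mulr0 oppr0 expR0.
have Hl (f : R -> R) M : (forall x, `|f x| <= M) ->
    (- (e^-1 * expR (- (e * x))) + expR (- (e * x)) * f x) @[x --> +oo%R] --> 0.
  move=> fM; rewrite -[X in _ --> X]addr0 -[X in _ --> X + _]oppr0.
  apply: cvgD; last exact: (cvgy_expRM e0 fM).
  apply: cvgN; rewrite -[X in _ --> X](mulr0 e^-1); apply: cvgM; first exact: cvg_cst.
  under eq_fun do rewrite -[expR _]mulr1.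
  by apply: (@cvgy_expRM e 1 (fun=> 1)) => // x; rewrite normr1.
have [I0 i0] : intble (fun x => expR (- (e * `|x|))) /\
    \int[mu]_x (expR (- (e * `|x|))) =
    2 * (0 - (- (e^-1 * expR (- (e * 0))) + expR (- (e * 0)) * 0)).
  apply: (@int_even_ge0 _ (fun x => - (e^-1 * expR (- (e * x))) +
    expR (- (e * x)) * 0)) => //.
  - by move=> x; rewrite normrN.
  - move=> x x0; rewrite gtr0_norm//; apply: is_derive_eq.
    by rewrite /GRing.scale /=; field; rewrite gt_eqF.
  - exact: is_derive_continuous.
  - by apply: (@Hl (fun=> 0) 0) => x; rewrite normr0.
have bnd (x y : R) : `|x| <= 1 -> `|y| <= 1 ->
    `|(a * x - e * y) / (e ^+ 2 + a ^+ 2)| <= (`|a| + e) / (e ^+ 2 + a ^+ 2).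
  move=> x1 y1; rewrite normrM [`|_^-1|]gtr0_norm ?invr_gt0// ler_wpM2r ?invr_ge0 ?(ltW d0)//.
  rewrite (le_trans (ler_normB _ _))// !normrM (gtr0_norm e0).
  by rewrite lerD// ?ler_piMr// ltW.
have [Ic ic] : intble (fun x => expR (- (e * `|x|)) * (1 + cos (a * x))) /\
    \int[mu]_x (expR (- (e * `|x|)) * (1 + cos (a * x))) =
    2 * (0 - (- (e^-1 * expR (- (e * 0))) + expR (- (e * 0)) *
       ((a * sin (a * 0) - e * cos (a * 0)) / (e ^+ 2 + a ^+ 2)))).
  apply: (@int_even_ge0 _ (fun x => - (e^-1 * expR (- (e * x))) +
     expR (- (e * x)) * ((a * sin (a * x) - e * cos (a * x)) / (e ^+ 2 + a ^+ 2)))) => //.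
  - move=> x; apply: cvgM; first exact: ce.
    apply: cvgD; first exact: cvg_cst.
    by apply: continuous_comp; [exact: cax|exact: continuous_cos].
  - by move=> x; rewrite normrN mulrN cosN.
  - move=> x x0; rewrite gtr0_norm//; apply: is_derive_eq.
    by rewrite /GRing.scale /=; field; rewrite !gt_eqF.
  - exact: is_derive_continuous.
  - by apply: Hl => x; apply: bnd; [exact: sin_max|exact: cos_max].
have [Is is_] : intble (fun x => expR (- (e * `|x|)) * (1 + sin (a * `|x|))) /\
    \int[mu]_x (expR (- (e * `|x|)) * (1 + sin (a * `|x|))) =
    2 * (0 - (- (e^-1 * expR (- (e * 0))) + expR (- (e * 0)) *
       ((a * - cos (a * 0) - e * sin (a * 0)) / (e ^+ 2 + a ^+ 2)))).
  apply: (@int_even_ge0 _ (fun x => - (e^-1 * expR (- (e * x))) +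
     expR (- (e * x)) * ((a * - cos (a * x) - e * sin (a * x)) / (e ^+ 2 + a ^+ 2)))) => //.
  - move=> x; apply: cvgM; first exact: ce.
    apply: cvgD; first exact: cvg_cst.
    apply: continuous_comp; last exact: continuous_sin.
    by apply: cvgM; [exact: cvg_cst|exact: norm_continuous].
  - by move=> x; rewrite normrN.
  - move=> x x0; rewrite gtr0_norm//; apply: is_derive_eq.
    by rewrite /GRing.scale /=; field; rewrite !gt_eqF.
  - exact: is_derive_continuous.
  - by apply: Hl => x; apply: bnd; [rewrite normrN; exact: cos_max|exact: sin_max].
split => //.
- transitivity (\int[mu]_x (expR (- (e * `|x|)) * (1 + cos (a * x)) - expR (- (e * `|x|)))).
    by apply: eq_int => x; ring.
  rewrite intB// ic i0 /poisson cE1 mulr0 cos0 sin0; field.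
  by rewrite !gt_eqF.
- transitivity (\int[mu]_x (expR (- (e * `|x|)) * (1 + sin (a * `|x|)) - expR (- (e * `|x|)))).
    apply: eq_int => x; have [x0|x0|->] := ltrgt0P x.
    + by rewrite gtr0_sg//; ring.
    + by rewrite ltr0_sg// (mulrN a) sinN; ring.
    + by rewrite sgr0 (mulr0 a) sin0; ring.
  rewrite intB// is_ i0 cE1 mulr0 cos0 sin0; field.
  by rewrite !gt_eqF.
Qed.

End half_line.

(** * The Hartley transform *)

Section hartley.
Set Implicit Arguments.
Unset Strict Implicit.
Context {R : realType}.
Local Notation mu := (@lebesgue_measure R).
Local Notation meas f := (measurable_fun setT (f : R -> R)).
Implicit Types (f g h F K : R -> R) (A : set R).

Definition cas (x : R) := cos x + sin x.

Definition cint K (x : R) := \int[mu]_y (cas (x * y) * K y).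

Lemma cas_max x : `|cas x| <= 2.
Proof.
by rewrite (le_trans (ler_normD _ _))// (_ : 2 = 1 + 1 :> R)// lerD// ?cos_max// sin_max.
Qed.

Lemma continuous_cas : continuous cas.
Proof. by move=> x; apply: cvgD; [exact: continuous_cos|exact: continuous_sin]. Qed.

Lemma meas_cas (c : R) : meas (fun y => cas (c * y)).
Proof.
apply: continuous_meas => y; apply: continuous_comp; last exact: continuous_cas.
exact: mulrl_continuous.
Qed.

Lemma meas_casM : measurable_fun setT (fun z : R * R => cas (z.1 * z.2)).
Proof.
apply: measurableT_comp; first exact: continuous_meas continuous_cas.
by apply: measurable_funM; [exact: measurable_fst|exact: measurable_snd].
Qed.

Lemma intble_cas (c : R) K : intble K -> intble (fun y => cas (c * y) * K y).
Proof. by move=> IK; apply: (@intbleMb _ 2) => // [|y]; [exact: meas_cas|exact: cas_max]. Qed.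

Lemma cintD K F (x : R) : intble K -> intble F ->
  cint (fun y => K y + F y) x = cint K x + cint F x.
Proof.
move=> IK IF; rewrite -intD; [|exact: intble_cas..].
by apply: eq_int => y; ring.
Qed.

Lemma cintZ (c : R) K (x : R) : intble K ->
  cint (fun y => c * K y) x = c * cint K x.
Proof.
move=> IK; rewrite -intZ; last exact: intble_cas.
by apply: eq_int => y; ring.
Qed.

Lemma cintN K (x : R) : intble K -> cint (fun y => - K y) x = - cint K x.
Proof.
move=> IK; rewrite -mulN1r -cintZ//.
by apply: eq_int => y; rewrite mulN1r.
Qed.

Lemma cintB K F (x : R) : intble K -> intble F ->
  cint (fun y => K y - F y) x = cint K x - cint F x.
Proof. by move=> IK IF; rewrite cintD ?cintN//; exact: intbleN. Qed.

Lemma cint_max K (x : R) : intble K -> `|cint K x| <= 2 * \int[mu]_y `|K y|.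
Proof.
move=> IK; rewrite -intZ; last exact: intble_norm.
apply: int_norm_le.
- by apply: intble_meas; exact: intble_cas.
- exact/intbleZ/intble_norm.
- by move=> y; rewrite normrM ler_wpM2r// cas_max.
Qed.

Lemma continuous_cint K : intble K -> continuous (cint K).
Proof.
move=> IK x.
have xI : x \in `]x - 1, x + 1[%classic by rewrite inE /= in_itv /=; lra.
have := @continuity_under_integral R _ _ mu (fun x y => cas (x * y) * K y) setT measurableT
  (x - 1) (x + 1) _ _ (fun y => 2 * `|K y|) _ _ x xI.
apply.
- by move=> z _; exact: intble_cas.
- apply: aeW => y _ z _; apply: cvgM; last exact: cvg_cst.
  apply: (@continuous_comp _ _ _ (fun w : R => w * y) cas).
    exact: mulrr_continuous.
  exact: continuous_cas.
- exact/intbleZ/intble_norm.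
- by move=> z _; apply: aeW => y _; rewrite normrM ler_wpM2r// cas_max.
Qed.

Lemma meas_cint K : intble K -> meas (cint K).
Proof. by move=> IK; exact: continuous_meas (continuous_cint IK). Qed.

(** The kernel cas(x y) is bounded and symmetric, so by Fubini [cint] is self-adjoint. *)
Lemma cint_swap f g : intble f -> intble g ->
  \int[mu]_x (f x * cint g x) = \int[mu]_x (g x * cint f x).
Proof.
move=> If Ig.
rewrite /cint (@fubini_kernel _ (fun x y => cas (x * y)) 2 f g meas_casM _ If Ig).
  by apply: eq_int => x; congr (_ * _); apply: eq_int => y; rewrite (mulrC y).
by move=> x y; exact: cas_max.
Qed.

Lemma is_derive_cas (x : R) : is_derive x 1 cas (cas (- x)).
Proof.
apply: is_derive_eq; rewrite /cas cosN sinN /GRing.scale /=.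
by ring.
Qed.

(** Since cas'(x) = cas(- x), differentiating under the integral produces the kernel cas(- x y); the
    reflection y -> - y restores cas(x y) and moves the sign into K. *)
Lemma is_derive_cint K (x : R) : intble K -> intble (fun y => y * K y) ->
  is_derive x 1 (cint K) (cint (fun y => - (y * K (- y))) x).
Proof.
move=> IK IyK; have mK := intble_meas IK.
have xI : `]x - 1, x + 1[%classic x by rewrite /= in_itv /=; lra.
have dcas (y z : R) : is_derive z 1 (fun x => cas (x * y) * K y) (cas (- (z * y)) * (y * K y)).
  have h := is_derive_cas (z * y).
  apply: is_derive_eq; rewrite /GRing.scale /=; ring.
have p1 (z y : R) : partial1of2 (fun x y => cas (x * y) * K y) z y =
    cas (- (z * y)) * (y * K y).
  by rewrite partial1of2E; have [_ ->] := dcas y z.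
have i1 (z : R) : `]x - 1, x + 1[%classic z -> intble (fun y => cas (z * y) * K y).
  by move=> _; exact: intble_cas.
have d1 (z y : R) : `]x - 1, x + 1[%classic z -> setT y ->
    derivable (fun x : R => cas (x * y) * K y) z 1.
  by move=> _ _; have [] := dcas y z.
have G0 (y : R) : 0 <= 2 * `|y * K y| by rewrite mulr_ge0.
have IG : intble (fun y => 2 * `|y * K y|) by exact/intbleZ/intble_norm.
have GG (z y : R) : `]x - 1, x + 1[%classic z -> setT y ->
    `|partial1of2 (fun x y => cas (x * y) * K y) z y| <= 2 * `|y * K y|.
  by move=> _ _; rewrite p1 normrM ler_wpM2r// cas_max.
split; first exact: (derivable_under_integral measurableT xI i1 d1 G0 IG GG).
have := differentiation_under_integral measurableT xI i1 d1 G0 IG GG.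
rewrite derive1E => ->.
have mF : meas (fun y => cas (x * y) * - (y * K (- y))).
  apply: measurable_funM; first exact: meas_cas.
  by apply: measurableT_comp => //; apply: measurable_funM => //; exact: meas_opp.
rewrite /cint -(int_opp mF); apply: eq_int => y; rewrite p1.
by rewrite (mulrN x y) (opprK y); ring.
Qed.

End hartley.

(** * Regularised kernels and Bessel's inequality *)

Section bessel.
Set Implicit Arguments.
Unset Strict Implicit.
Context {R : realType}.
Local Notation mu := (@lebesgue_measure R).
Local Notation meas f := (measurable_fun setT (f : R -> R)).
Implicit Types (f g h F K : R -> R) (A : set R).

(** Used with the Poisson kernel, whose integral over x is pi for every y. *)
Lemma tonelli_kernel (k : R -> R -> R) (M c : R) f :
  measurable_fun setT (fun z : R * R => k z.1 z.2) ->
  (forall x y, 0 <= k x y <= M) ->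
  (forall y, intble (k^~ y)) -> (forall y, \int[mu]_x k x y = c) ->
  intble f -> (forall x, 0 <= f x) ->
  intble (fun x => \int[mu]_y (k x y * f y)) /\
  \int[mu]_x \int[mu]_y (k x y * f y) = c * \int[mu]_x f x.
Proof.
move=> mk kM Ik ik If f0; have mf := intble_meas If.
have mkx x : meas (k x) by exact: (measurableT_comp mk (measurable_pair1 x)).
have mky y : meas (k^~ y) by exact: (measurableT_comp mk (measurable_pair2 y)).
pose G (z : R * R) : \bar R := (k z.1 z.2 * f z.2)%:E.
have mG : measurable_fun setT G.
  apply/measurable_EFinP; apply: measurable_funM => //.
  by apply: measurableT_comp => //; exact: measurable_snd.
have G0 z : (0 <= G z)%E.
  by rewrite lee_fin mulr_ge0//; have /andP[] := kM z.1 z.2.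
have Ix x : intble (fun y => k x y * f y).
  apply: (@intbleMb _ M) => // y.
  by have /andP[k0 k1] := kM x y; rewrite ger0_norm.
have e : (\int[mu]_x (\int[mu]_y (k x y * f y))%:E = (c * \int[mu]_x f x)%:E)%E.
  have e1 x : ((\int[mu]_y (k x y * f y))%:E = \int[mu]_y G (x, y))%E.
    by rewrite -integral_int.
  under eq_integral do rewrite e1.
  rewrite (@fubini_tonelli _ _ _ _ R mu mu G mG G0).
  rewrite -intZ// -integral_int; last exact: intbleZ.
  apply: eq_integral => y _; rewrite /G/= -(ik y) mulrC -intZ//.
  rewrite -integral_int; last exact: intbleZ.
  by apply: eq_integral => x _; rewrite mulrC.
have mI : meas (fun x => \int[mu]_y (k x y * f y)).
  have h := @measurable_fun_fubini_tonelli_F _ _ _ _ _ mu G mG G0.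
  apply/measurable_EFinP; apply: eq_measurable_fun h => x _.
  by rewrite /fubini_F/= /G/= integral_int.
split; last by rewrite /Rintegral e.
apply: (@ge0_intble _ _ (c * \int[mu]_x f x)) => //; last by rewrite e.
move=> x; apply: int_ge0 => y; rewrite mulr_ge0//.
by have /andP[] := kM x y.
Qed.

Lemma measurable_poisson (e : R) : 0 < e ->
  measurable_fun setT (fun z : R * R => poisson e (z.1 - z.2)).
Proof.
move=> e0; apply: measurableT_comp; first exact: continuous_meas (continuous_poisson e0).
by apply: measurable_funB; [exact: measurable_fst|exact: measurable_snd].
Qed.

Lemma poisson_le (e a : R) : 0 < e -> poisson e a <= e^-1.
Proof.
move=> e0; rewrite /poisson ler_pdivrMr ?poisson_den// mulrDr.
have -> : e^-1 * e ^+ 2 = e by field; rewrite gt_eqF.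
by rewrite lerDl mulr_ge0 ?sqr_ge0// invr_ge0 ltW.
Qed.

Lemma continuous_expNnorm (e : R) : continuous (fun x : R => expR (- (e * `|x|))).
Proof.
move=> x; apply: continuous_comp; last exact: continuous_expR.
by apply: cvgN; apply: cvgM; [exact: cvg_cst|exact: norm_continuous].
Qed.

Lemma meas_expNnorm (e : R) : meas (fun x => expR (- (e * `|x|))).
Proof. exact: continuous_meas (@continuous_expNnorm e). Qed.

Lemma intble_exp (e M : R) h : 0 < e -> meas h -> (forall x, `|h x| <= M) ->
  intble (fun x => expR (- (e * `|x|)) * h x).
Proof.
move=> e0 mh hM; have [I0 _ _] := int_exp 0 e0.
by apply: eq_intble (intbleMb mh hM I0) => x; rewrite mulrC.
Qed.

Lemma meas_cos (c : R) : meas (fun y => cos (c * y)).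
Proof.
apply: continuous_meas => y; apply: continuous_comp; last exact: continuous_cos.
exact: mulrl_continuous.
Qed.

Lemma meas_sin (c : R) : meas (fun y => sin (c * y)).
Proof.
apply: continuous_meas => y; apply: continuous_comp; last exact: continuous_sin.
exact: mulrl_continuous.
Qed.

Lemma meas_sgr : meas Num.sg.
Proof.
rewrite (_ : Num.sg = fun x : R => \1_(`]0, +oo[%classic) x - \1_(`]-oo, 0[%classic) x).
  by apply: measurable_funB; exact: measurable_indic.
apply/funext => x; rewrite !indicE !mem_setE !in_itv /= andbT.
have [x0|x0|->] := ltrgt0P x.
- by rewrite gtr0_sg// subr0.
- by rewrite ltr0_sg// sub0r.
- by rewrite sgr0 subr0.
Qed.

Lemma sgr_max (x : R) : `|Num.sg x| <= 1.
Proof. by rewrite normr_sg lern1 leq_b1. Qed.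

(** The product cas(x z) cas(y z) is cos((x - y) z) + sin((x + y) z), and the sine term is odd in
    z. *)
Lemma cint_exp_cas (e x y : R) : 0 < e ->
  cint (fun z => expR (- (e * `|z|)) * cas (y * z)) x = 2 * poisson e (x - y).
Proof.
move=> e0; have [_ <- _] := int_exp (x - y) e0.
have I1 := intble_exp e0 (meas_cos (x - y)) (fun z => cos_max _).
have I2 := intble_exp e0 (meas_sin (x + y)) (fun z => sin_max _).
rewrite -[RHS]addr0 -(@int_odd _ _ (intble_meas I2)); last first.
  by move=> z; rewrite normrN mulrN sinN mulrN.
rewrite -intD//; apply: eq_int => z.
by rewrite /cas [(x - y) * z]mulrBl [(x + y) * z]mulrDl cosB sinD; ring.
Qed.

(** The product cas(x z) cas(- y z) is cos((x + y) z) + sin((x - y) z). The factor sg(z) makes the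
    cosine term odd, and the sine term leaves the conjugate Poisson kernel, which tends to 2 / (x -
    y) as e -> 0. *)
Lemma cint_exp_sgn (e x y : R) : 0 < e ->
  cint (fun z => expR (- (e * `|z|)) * (Num.sg z * cas (- (y * z)))) x =
  2 * ((x - y) / (e ^+ 2 + (x - y) ^+ 2)).
Proof.
move=> e0; have [_ _ <-] := int_exp (x - y) e0.
have ms h : meas h -> meas (fun z => Num.sg z * h z).
  by move=> mh; apply: measurable_funM => //; exact: meas_sgr.
have bs (h : R -> R) : (forall z, `|h z| <= 1) -> forall z, `|Num.sg z * h z| <= 1.
  by move=> hM z; rewrite normrM mulr_ile1// sgr_max.
have I1 := intble_exp e0 (ms _ (meas_sin (x - y))) (bs _ (fun z => sin_max _)).
have I2 := intble_exp e0 (ms _ (meas_cos (x + y))) (bs _ (fun z => cos_max _)).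
rewrite -[RHS]addr0 -(@int_odd _ _ (intble_meas I2)); last first.
  by move=> z; rewrite normrN mulrN cosN sgrN mulNr mulrN.
rewrite -intD//; apply: eq_int => z.
by rewrite /cas [(x - y) * z]mulrBl [(x + y) * z]mulrDl cosN sinN sinB cosD; ring.
Qed.

Lemma expNnorm_le1 (e x : R) : 0 < e -> `|expR (- (e * `|x|))| <= 1.
Proof.
by move=> e0; rewrite ger0_norm ?expR_ge0// -expR0 ler_expR oppr_le0 mulr_ge0// ltW.
Qed.

(* With a factor e^(-e|x|) inserted, \int (cint K)^2 becomes
   2 \int\int poisson e (x - y) K(x) K(y), and 2 K(x) K(y) <= K(x)^2 + K(y)^2. *)
Lemma cint_bessel K : intble K -> sqint K ->
  sqint (cint K) /\ \int[mu]_x cint K x ^+ 2 <= 2 * pi * \int[mu]_x K x ^+ 2.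
Proof.
move=> IK LK; have [mK IK2] := LK; set N := \int[mu]_x K x ^+ 2.
have cK := meas_cint IK.
set M := 2 * \int[mu]_y `|K y|.
have KM x : `|cint K x| <= M by exact: cint_max.
pose g (e : R) x := expR (- (e * `|x|)) * (cint K x) ^+ 2.
have Ig (e : R) : 0 < e -> intble (g e).
  move=> e0; apply: (@intble_exp _ (M ^+ 2)) => //; first exact: measurable_funX.
  by move=> x; rewrite normrX lerXn2r// nnegrE (le_trans _ (KM x)).
have ig (e : R) : 0 < e -> \int[mu]_x g e x <= 2 * pi * N.
  move=> e0.
  have IE : intble (fun x => expR (- (e * `|x|)) * cint K x).
    exact: intble_exp KM.
  have IEc (x : R) : intble (fun z => expR (- (e * `|z|)) * cas (x * z)).
    by apply: (@intble_exp _ 2) => // [|z]; [exact: meas_cas|exact: cas_max].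
  have eqc (x : R) : cint (fun x => expR (- (e * `|x|)) * cint K x) x =
      \int[mu]_y (2 * poisson e (x - y) * K y).
    transitivity (\int[mu]_z ((expR (- (e * `|z|)) * cas (x * z)) * cint K z)).
      by apply: eq_int => z; ring.
    rewrite cint_swap//; apply: eq_int => y.
    by rewrite cint_exp_cas// -poissonN opprB mulrC.
  have -> : \int[mu]_x g e x =
      \int[mu]_x (K x * cint (fun x => expR (- (e * `|x|)) * cint K x) x).
    transitivity (\int[mu]_x ((expR (- (e * `|x|)) * cint K x) * cint K x)).
      by apply: eq_int => x; rewrite /g; ring.
    by rewrite cint_swap.
  have mP (x : R) : meas (fun y => poisson e (x - y)).
    exact: (measurableT_comp (measurable_poisson e0) (measurable_pair1 x)).
  have PM (x y : R) : 0 <= poisson e (x - y) <= e^-1.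
    by rewrite poisson_ge0// poisson_le.
  have PC (y : R) : (fun x => poisson e (x - y)) = (fun x => poisson e (y - x)).
    by apply/funext => x; rewrite -poissonN opprB.
  have [IP iP] : intble (fun x => \int[mu]_y (poisson e (x - y) * K y ^+ 2)) /\
      \int[mu]_x (\int[mu]_y (poisson e (x - y) * K y ^+ 2)) = pi * N.
    apply: (@tonelli_kernel (fun x y => poisson e (x - y)) e^-1 pi) => //.
    - exact: measurable_poisson.
    - by move=> y; rewrite PC; case: (int_poisson y e0).
    - by move=> y; rewrite PC; case: (int_poisson y e0).
    - by move=> x; exact: sqr_ge0.
  have -> : 2 * pi * N = \int[mu]_x (pi * K x ^+ 2 +
      \int[mu]_y (poisson e (x - y) * K y ^+ 2)).
    by rewrite intD ?intZ// ?iP; [rewrite -/N; ring|exact: intbleZ].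
  apply: int_le.
  - apply: (@eq_intble _ (fun x =>
      cint (fun x => expR (- (e * `|x|)) * cint K x) x * K x)).
      by move=> x; rewrite mulrC.
    exact: (intbleMb (meas_cint IE) (fun x => cint_max x IE) IK).
  - by apply: intbleD => //; exact: intbleZ.
  - move=> x; rewrite eqc.
    have [IPx <-] := int_poisson x e0.
    have PMx (y : R) : `|poisson e (x - y)| <= e^-1.
      by have /andP[a b] := PM x y; rewrite ger0_norm.
    have I1 : intble (fun y => 2 * poisson e (x - y) * K y).
      apply: (@eq_intble _ (fun y => 2 * (poisson e (x - y) * K y))).
        by move=> y; rewrite mulrA.
      by apply: intbleZ; exact: intbleMb PMx IK.
    have I2 : intble (fun y => poisson e (x - y) * K y ^+ 2).
      exact: intbleMb PMx IK2.
    rewrite -intZ// [_ * K x ^+ 2]mulrC -intZ// -intD//; last exact: intbleZ.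
    apply: int_le; [exact: intbleZ|by apply: intbleD => //; exact: intbleZ|].
    move=> y; have /andP[P0 _] := PM x y; rewrite -subr_ge0.
    rewrite (_ : _ - _ = poisson e (x - y) * (K x - K y) ^+ 2); last by ring.
    by rewrite mulr_ge0// sqr_ge0.
(* The bound on [g e] does not depend on e; Fatou's lemma along e = 1/(n+1) removes the
   exponential. *)
have [] := @fatou_int _ (fun n x => g n.+1%:R^-1 x) (fun x => cint K x ^+ 2) (2 * pi * N).
- by move=> n; apply: Ig.
- by move=> n x; rewrite mulr_ge0 ?expR_ge0// sqr_ge0.
- move=> x; rewrite -[X in _ --> X]mul1r; apply: cvgM; last exact: cvg_cst.
  rewrite -[X in _ --> X](_ : expR (- (0 * `|x|)) = 1); last first.
    by rewrite mul0r oppr0 expR0.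
  apply: continuous_cvg; first exact: continuous_expR.
  apply: cvgN; apply: cvgM; last exact: cvg_cst.
  exact: cvg_harmonic.
- by move=> n; apply: ig.
- by move=> I1 i1; split.
Qed.

End bessel.

(** * The transform on L^2 and its inversion *)

Section hartley_transform.
Set Implicit Arguments.
Unset Strict Implicit.
Context {R : realType}.
Local Notation mu := (@lebesgue_measure R).
Local Notation meas f := (measurable_fun setT (f : R -> R)).
Implicit Types (f g h F G K : R -> R) (A : set R).

Lemma cvg_to_eq (T : Type) (D : set_system T) (u : T -> R) (l l' : R) : l = l' ->
  u x @[x --> D] --> l -> u x @[x --> D] --> l'.
Proof. by move=> ->. Qed.

Lemma cvg0Z (T : Type) (D : set_system T) {FD : Filter D} (u : T -> R) (c : R) :
  u x @[x --> D] --> 0 -> (c * u x) @[x --> D] --> 0.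
Proof.
move=> h; apply: (@cvg_to_eq _ _ _ (c * 0)); first by rewrite mulr0.
by apply: cvgM => //; exact: cvg_cst.
Qed.

Lemma cvg0D (T : Type) (D : set_system T) {FD : Filter D} (u v : T -> R) :
  u x @[x --> D] --> 0 -> v x @[x --> D] --> 0 -> (u x + v x) @[x --> D] --> 0.
Proof.
move=> h k; apply: (@cvg_to_eq _ _ _ (0 + 0)); first by rewrite addr0.
exact: cvgD.
Qed.

Lemma squeeze_cvg0 (T : Type) (D : set_system T) {FD : Filter D} (u v : T -> R) :
  (\forall x \near D, 0 <= u x <= v x) ->
  v x @[x --> D] --> 0 -> u x @[x --> D] --> 0.
Proof. by move=> uv v0; apply: (squeeze_cvgr uv) => //; exact: (@cvg_cst _ (0 : R)). Qed.

Lemma lim_unique (u : nat -> R) (a b : R) :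
  u n @[n --> \oo] --> a -> u n @[n --> \oo] --> b -> a = b.
Proof. by move=> ua ub; rewrite -(cvg_lim _ ua)// -(cvg_lim _ ub). Qed.

Lemma le_of_eq (x y : R) : x = y -> x <= y.
Proof. by move=> ->. Qed.

Definition trunc (n : nat) f := f \_ `[- n%:R, n%:R]%classic.

(* If F is the Hartley transform of f, then the Fourier transform of f is
   (F x + F (- x)) / 2 - i (F x - F (- x)) / 2. *)
Definition is_hart f F := [/\ sqint f, sqint F &
  (\int[mu]_x (F x - cint (trunc n f) x) ^+ 2) @[n --> \oo] --> 0].

Lemma truncE n f x : trunc n f x = if `|x| <= n%:R then f x else 0.
Proof. by rewrite /trunc patchE mem_setE in_itv /= ler_norml. Qed.

Lemma trunc_cvg f x : trunc n f x @[n --> \oo] --> f x.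
Proof.
apply: (@cvg_near_cst _ _ _ _ _); near=> n; rewrite truncE ifT//.
by near: n; exact: nbhs_infty_ger.
Unshelve. all: by end_near. Qed.

Lemma sqint_trunc n f : sqint f -> sqint (trunc n f).
Proof. exact: sqint_patch. Qed.

Lemma intble_trunc n f : sqint f -> intble (trunc n f).
Proof.
move=> Lf; apply: sqint_itv_intble => //.
by rewrite /= lebesgue_measure_itv /=; case: ifP => _; rewrite ltry.
Qed.

Lemma trunc_cvg2 f : sqint f ->
  (\int[mu]_x (f x - trunc n f x) ^+ 2) @[n --> \oo] --> 0.
Proof.
move=> Lf; have [mf If] := Lf.
have [||||_] := @dominated_cvg_int _ (fun n x => (f x - trunc n f x) ^+ 2) (fun=> 0)
  (fun x => f x ^+ 2).
- by move=> n; case: (sqintB Lf (sqint_trunc n Lf)) => m _; exact: measurable_funX.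
- move=> x; apply: (@cvg_to_eq _ _ _ ((f x - f x) * (f x - f x))).
    by rewrite subrr mulr0.
  by apply: cvgM; apply: cvgB; (exact: cvg_cst || exact: trunc_cvg).
- move=> n x; rewrite truncE; case: ifP => _.
    by rewrite subrr expr0n normr0 sqr_ge0.
  by rewrite subr0 ger0_norm ?sqr_ge0.
- exact: If.
- by rewrite Rintegral_cst// mul0r.
Qed.

Lemma sqint_cint K : intble K -> sqint K -> sqint (cint K).
Proof. by move=> IK LK; case: (cint_bessel IK LK). Qed.

Lemma sqint_cint_trunc n f : sqint f -> sqint (cint (trunc n f)).
Proof. by move=> Lf; apply: sqint_cint; [exact: intble_trunc|exact: sqint_trunc]. Qed.

Lemma cvg_sqr_sym (u_ : nat -> R -> R) F :
  (\int[mu]_x (F x - u_ n x) ^+ 2) @[n --> \oo] --> 0 ->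
  (\int[mu]_x (u_ n x - F x) ^+ 2) @[n --> \oo] --> 0.
Proof.
apply: cvg_trans; apply: near_eq_cvg; near=> n.
by apply: eq_int => x; rewrite -sqrrN opprB.
Unshelve. all: by end_near. Qed.

Lemma sqr_lim_unique (u_ : nat -> R -> R) F G : (forall n, sqint (u_ n)) ->
  sqint F -> sqint G ->
  (\int[mu]_x (F x - u_ n x) ^+ 2) @[n --> \oo] --> 0 ->
  (\int[mu]_x (G x - u_ n x) ^+ 2) @[n --> \oo] --> 0 ->
  {ae mu, forall x, F x = G x}.
Proof.
move=> Lu LF LG uF uG.
suff /(int_sqr_eq0 (sqintB LF LG)) h : \int[mu]_x (F x - G x) ^+ 2 = 0.
  by apply: (ae_imp h) => x /eqP; rewrite subr_eq0 => /eqP.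
have h : (2 * (\int[mu]_x (F x - u_ n x) ^+ 2) + 2 * (\int[mu]_x (G x - u_ n x) ^+ 2))
    @[n --> \oo] --> 0.
  exact: (cvg0D (cvg0Z _ uF) (cvg0Z _ uG)).
apply/eqP; rewrite eq_le int_sqr_ge0 andbT.
rewrite -(cvg_lim _ h)//; apply: limr_ge; first by apply/cvg_ex; eexists; exact: h.
apply: nearW => n.
apply: le_trans (le_trans (int_sqrD_le (sqintB LF (Lu n)) (sqintN (sqintB LG (Lu n)))) _).
  apply/le_of_eq; apply: eq_int => x; congr (_ ^+ 2); ring.
by rewrite lerD2l ler_wpM2l//; apply/le_of_eq; apply: eq_int => x; rewrite sqrrN.
Qed.

(** For truncations of f this is [cint_swap]. Both sides pass to the limit: the left by the
    definition of the transform, the right because Bessel's inequality makes [cint K] square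
    integrable. *)
Lemma hart_mul f F K : is_hart f F -> intble K -> sqint K ->
  \int[mu]_x (F x * K x) = \int[mu]_x (f x * cint K x).
Proof.
move=> [Lf LF fF] IK LK.
have h1 : (\int[mu]_x (cint (trunc n f) x * K x)) @[n --> \oo] --> \int[mu]_x (F x * K x).
  apply: cvg_int_mul => //; last exact: cvg_sqr_sym.
  by apply: nearW => n; exact: sqint_cint_trunc.
have h2 : (\int[mu]_x (trunc n f x * cint K x)) @[n --> \oo] --> \int[mu]_x (f x * cint K x).
  apply: cvg_int_mul => //; [|exact: sqint_cint|exact/cvg_sqr_sym/trunc_cvg2].
  by apply: nearW => n; exact: sqint_trunc.
apply: (lim_unique h1).
apply: cvg_trans h2; apply: near_eq_cvg; near=> n.
rewrite -cint_swap//; last exact: intble_trunc.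
by apply: eq_int => x; rewrite mulrC.
Unshelve. all: by end_near. Qed.

Lemma is_hart_ae f g F G : meas g -> meas G -> {ae mu, forall x, f x = g x} ->
  {ae mu, forall x, F x = G x} -> is_hart f F -> is_hart g G.
Proof.
move=> mg mG fg FG [Lf LF h]; have Lg := ae_sqint mg fg Lf.
split; [exact: Lg|exact: (ae_sqint mG FG LF)|].
apply: cvg_trans h; apply: near_eq_cvg; near=> n.
have e x : cint (trunc n f) x = cint (trunc n g) x.
  apply: ae_int.
  - exact: intble_meas (intble_cas _ (intble_trunc n Lf)).
  - exact: intble_meas (intble_cas _ (intble_trunc n Lg)).
  - by apply: (ae_imp fg) => y e; rewrite !truncE e.
apply: ae_int.
- by case: (sqintB LF (sqint_cint_trunc n Lf)) => m _; exact: measurable_funX.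
- have LG : sqint G by exact: (ae_sqint mG FG LF).
  by case: (sqintB LG (sqint_cint_trunc n Lg)) => m _; exact: measurable_funX.
- by apply: (ae_imp FG) => x ->; rewrite e.
Unshelve. all: by end_near. Qed.

Lemma is_hart_lin (a b : R) f g F G : is_hart f F -> is_hart g G ->
  is_hart (fun x => a * f x + b * g x) (fun x => a * F x + b * G x).
Proof.
move=> [Lf LF hf] [Lg LG hg]; split; try by apply: sqintD; exact: sqintZ.
have h : (2 * (a ^+ 2 * (\int[mu]_x (F x - cint (trunc n f) x) ^+ 2)) +
    2 * (b ^+ 2 * (\int[mu]_x (G x - cint (trunc n g) x) ^+ 2))) @[n --> \oo] --> 0.
  exact: (cvg0D (cvg0Z _ (cvg0Z _ hf)) (cvg0Z _ (cvg0Z _ hg))).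
apply: squeeze_cvg0 h.
near=> n; rewrite int_sqr_ge0 /=.
have L1 := sqintB LF (sqint_cint_trunc n Lf).
have L2 := sqintB LG (sqint_cint_trunc n Lg).
have := int_sqrD_le (sqintZ a L1) (sqintZ b L2).
rewrite (_ : \int[mu]_x (a * _) ^+ 2 = a ^+ 2 * \int[mu]_x (F x - cint (trunc n f) x) ^+ 2); last first.
  by rewrite -intZ; [apply: eq_int => x; rewrite exprMn|case: L1].
rewrite (_ : \int[mu]_x (b * _) ^+ 2 = b ^+ 2 * \int[mu]_x (G x - cint (trunc n g) x) ^+ 2); last first.
  by rewrite -intZ; [apply: eq_int => x; rewrite exprMn|case: L2].
apply: le_trans; apply/le_of_eq; apply: eq_int => x; congr (_ ^+ 2).
rewrite (_ : cint _ x = a * cint (trunc n f) x + b * cint (trunc n g) x); first by ring.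
rewrite -!cintZ ?intble_trunc// -cintD; try by apply: intbleZ; exact: intble_trunc.
by apply: eq_int => y; congr (_ * _); rewrite !truncE; case: ifP => // _; rewrite !mulr0 addr0.
Unshelve. all: by end_near. Qed.

(** With p the Poisson kernel, |f| p <= f^2 + p^2, and p^2 <= e^-1 p because p is at most e^-1. *)
Lemma intble_mul_poisson f (e x : R) : sqint f -> 0 < e ->
  intble (fun y => f y * poisson e (x - y)).
Proof.
move=> [mf If2] e0; have [IP _] := int_poisson x e0.
apply: (@intble_le _ _ (fun y => e^-1 * poisson e (x - y) + f y ^+ 2 )).
- by apply: measurable_funM => //; exact: intble_meas.
- move=> y; rewrite normrM (ger0_norm (poisson_ge0 _ e0)).
  have p0 := poisson_ge0 (x - y) e0; have p1 := poisson_le (x - y) e0.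
  rewrite -[f y ^+ 2]real_normK ?num_real//.
  have : poisson e (x - y) ^+ 2 <= e^-1 * poisson e (x - y).
    by rewrite expr2 ler_wpM2r.
  by have := normr_ge0 (f y); move: (`|f y|) (poisson _ _) p0 p1 => a p; nra.
- by apply: intbleD => //; exact: intbleZ.
Qed.

Lemma pi_neq0 : pi != 0 :> R.
Proof. by rewrite gt_eqF// pi_gt0. Qed.

Lemma twopi_neq0 : 2 * pi != 0 :> R.
Proof. by rewrite mulf_neq0// pi_neq0. Qed.

(** Approximate identity at a point of continuity, for f merely in L^2. The zone |x - y| < d
    contributes at most eta / 2, the mass of the kernel being pi. Outside it the kernel is O(e)
    times [poisson 1], and [C] is the integral of the function dominating (|f x| + |f y|) times
    [poisson 1]. *)
Lemma poisson_cvg f x : sqint f -> {for x, continuous f} ->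
  (\int[mu]_y (f y * poisson n.+1%:R^-1 (x - y))) @[n --> \oo] --> pi * f x.
Proof.
move=> Lf cfx; have [mf If2] := Lf.
set C := (`|f x| + 1) * pi + \int[mu]_y f y ^+ 2.
have C0 : 0 < C.
  by rewrite ltr_wpDr ?int_sqr_ge0// mulr_gt0 ?pi_gt0// ltr_wpDl.
apply/cvgrPdist_le => eta eta0.
have e2 : 0 < eta / (2 * pi) by rewrite divr_gt0// mulr_gt0// pi_gt0.
move/cvgrPdist_le: (cfx) => /(_ _ e2) /nbhs_ballP[d /= d0 hd].
have D0 : 0 < 1 + d ^- 2 by rewrite ltr_wpDr ?invr_ge0 ?sqr_ge0.
near=> n.
set e := n.+1%:R^-1.
have e0 : 0 < e by rewrite invr_gt0.
have eC : e * ((1 + d ^- 2) * C) <= eta / 2.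
  rewrite /e mulrC -ler_pdivlMr ?invr_gt0// invrK -ler_pdivrMl ?divr_gt0//.
  apply: (@le_trans _ _ n%:R); last by rewrite ler_nat.
  by near: n; exact: nbhs_infty_ger.
have [IP iP] := int_poisson x e0.
have [IP1 iP1] := int_poisson x (ltr01 : 0 < 1 :> R).
have mP : meas (fun y => poisson e (x - y)) by exact: intble_meas.
have IfP := intble_mul_poisson x Lf e0.
rewrite -iP mulrC -intZ// -intB//; last exact: intbleZ.
apply: (@le_trans _ _ (\int[mu]_y (eta / (2 * pi) * poisson e (x - y) +
    e * (1 + d ^- 2) * ((`|f x| + 1) * poisson 1 (x - y) + f y ^+ 2)))).
  apply: int_norm_le.
  - by apply: measurable_funB => //; [exact: measurable_funM|exact: measurable_funM].
  - apply: intbleD; first exact: intbleZ.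
    by apply: intbleZ; apply: intbleD => //; exact: intbleZ.
  - move=> y; rewrite -mulrBl normrM (ger0_norm (poisson_ge0 _ e0)).
    have p0 := poisson_ge0 (x - y) e0.
    have q0 := poisson_ge0 (x - y) (ltr01 : 0 < 1 :> R).
    have q1 := poisson_le (x - y) (ltr01 : 0 < 1 :> R); rewrite invr1 in q1.
    have E0 : 0 <= e * (1 + d ^- 2) by rewrite mulr_ge0 ?(ltW D0) ?(ltW e0).
    have [yd|yd] := ltP `|x - y| d.
      apply: ler_wpDr; last by rewrite ler_wpM2r//; apply: hd; exact: yd.
      by rewrite mulr_ge0// addr_ge0 ?sqr_ge0// mulr_ge0// addr_ge0.
    apply: ler_wpDl; first by rewrite mulr_ge0// ltW.
    (* For |a| >= d one has 1 + a^2 <= (1 + d^-2) a^2, hence e / (e^2 + a^2) <= e (1 + d^-2) / (1 +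
       a^2). *)
    have P1 : poisson e (x - y) <= e * (1 + d ^- 2) * poisson 1 (x - y).
      rewrite /poisson -mulrA ler_wpM2l ?(ltW e0)//.
      rewrite mul1r expr1n ler_pdivlMr; last by rewrite -(expr1n _ 2) poisson_den.
      rewrite mulrC ler_pdivrMr ?poisson_den//.
      have : 1 <= d ^- 2 * (x - y) ^+ 2.
        rewrite mulrC ler_pdivlMr ?exprn_gt0// mul1r -[leRHS]real_normK ?num_real//.
        by rewrite lerXn2r// nnegrE ?(ltW d0).
      have : 0 <= d ^- 2 * e ^+ 2 by rewrite mulr_ge0 ?invr_ge0 ?sqr_ge0.
      by move: (d ^- 2) (sqr_ge0 e) => D; nra.
    apply: (@le_trans _ _ ((`|f x| + `|f y|) * (e * (1 + d ^- 2) * poisson 1 (x - y)))).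
      by apply: ler_pM => //; exact: ler_normB.
    rewrite mulrCA ler_wpM2l// -[f y ^+ 2]real_normK ?num_real//.
    have := normr_ge0 (f y); have := normr_ge0 (f x).
    by move: (`|f x|) (`|f y|) (poisson _ _) q0 q1 => a b p; nra.
have IS : intble (fun y => (`|f x| + 1) * poisson 1 (x - y) + f y ^+ 2).
  by apply: intbleD => //; exact: intbleZ.
rewrite intD; [|exact: intbleZ|exact: intbleZ].
rewrite (intZ _ IP) (intZ _ IS) intD//; last exact: intbleZ.
rewrite (intZ _ IP1) iP iP1 -/C.
rewrite invfM mulrA divfK ?pi_neq0// [leRHS]splitr lerD2l.
by rewrite -mulrA.
Unshelve. all: by end_near. Qed.

(** Pair F with e^(-e|y|) cas(x y). By [hart_mul] and [cint_exp_cas] this is twice the Poisson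
    integral of f at x, which tends to 2 pi f(x); by dominated convergence it also tends to
    [cint F x]. *)
Lemma hart_inversion f F : is_hart f F -> intble F -> continuous f ->
  forall x, f x = (2 * pi)^-1 * cint F x.
Proof.
move=> hf IF cf x; have [Lf LF _] := hf.
have h1 : (2 * \int[mu]_y (f y * poisson n.+1%:R^-1 (x - y))) @[n --> \oo] --> 2 * (pi * f x).
  by apply: cvgM; [exact: cvg_cst|exact: (poisson_cvg Lf (cf x))].
have [||||_ h2] := @dominated_cvg_int _ (fun n y => F y * (expR (- (n.+1%:R^-1 * `|y|)) * cas (x * y)))
  (fun y => cas (x * y) * F y) (fun y => 2 * `|F y|).
- move=> n; apply: measurable_funM; first exact: intble_meas.
  by apply: measurable_funM; [exact: meas_expNnorm|exact: meas_cas].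
- move=> y; rewrite [X in _ --> X]mulrC; apply: cvgM; first exact: cvg_cst.
  rewrite -[X in _ --> X]mul1r; apply: cvgM; last exact: cvg_cst.
  rewrite -[X in _ --> X](_ : expR (- (0 * `|y|)) = 1); last first.
    by rewrite mul0r oppr0 expR0.
  apply: continuous_cvg; first exact: continuous_expR.
  by apply: cvgN; apply: cvgM; [exact: cvg_harmonic|exact: cvg_cst].
- move=> n y; rewrite normrM mulrC ler_wpM2r// normrM -[leRHS]mul1r.
  by rewrite ler_pM// ?cas_max// expNnorm_le1.
- exact/intbleZ/intble_norm.
have -> : cint F x = 2 * (pi * f x).
  apply/(lim_unique h2); apply: cvg_trans h1; apply: near_eq_cvg; near=> n.
  have e0 : 0 < n.+1%:R^-1 :> R by [].
  have IE : intble (fun y => expR (- (n.+1%:R^-1 * `|y|)) * cas (x * y)).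
    by apply: (@intble_exp _ _ 2) => // [|z]; [exact: meas_cas|exact: cas_max].
  have LE : sqint (fun y => expR (- (n.+1%:R^-1 * `|y|)) * cas (x * y)).
    split; first exact: intble_meas.
    apply: (@intble_le _ _ (fun y => 4 * expR (- (n.+1%:R^-1 * `|y|)))).
    - by apply: measurable_funX; exact: intble_meas.
    - move=> y; rewrite ger0_norm ?sqr_ge0// exprMn mulrC.
      have E1 : expR (- (n.+1%:R^-1 * `|y|)) <= 1.
        by have := expNnorm_le1 y e0; rewrite ger0_norm ?expR_ge0.
      apply: ler_pM; rewrite ?sqr_ge0//; last by rewrite expr2 ler_piMr ?expR_ge0.
      rewrite -real_normK ?num_real// (_ : 4 = 2 ^+ 2); last by ring.
      by rewrite lerXn2r// ?nnegrE// cas_max.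
    - by apply: intbleZ; have [I0 _ _] := int_exp 0 e0.
  rewrite (hart_mul hf)// -intZ.
    by apply: eq_int => y; rewrite cint_exp_cas// -poissonN opprB; ring.
  exact: intble_mul_poisson.
by rewrite [2 * (_ * _)]mulrA mulKf// twopi_neq0.
Unshelve. all: by end_near. Qed.

End hartley_transform.

(** * Integration by parts on the line and the transform of a derivative *)

Section derivative.
Set Implicit Arguments.
Unset Strict Implicit.
Context {R : realType}.
Local Notation mu := (@lebesgue_measure R).
Local Notation meas f := (measurable_fun setT (f : R -> R)).
Implicit Types (f g h F G K : R -> R) (A : set R).

Lemma int_patch_derive f g (a : R) : 0 < a -> (forall x : R, is_derive x 1 f (g x)) ->
  continuous g -> \int[mu]_x (g \_ `[- a, a]%classic) x = f a - f (- a).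
Proof.
move=> a0 df cg; rewrite -Rintegral_mkcond /Rintegral.
rewrite (@continuous_FTC2 _ g f)//.
- by lra.
- exact: continuous_subspaceT.
- split.
  + by move=> x _; case: (df x).
  + by apply: cvg_at_right_filter; exact: (is_derive_continuous (df (- a))).
  + by apply: cvg_at_left_filter; exact: (is_derive_continuous (df a)).
- by move=> x _; rewrite derive1E; case: (df x).
Qed.

(** The difference f(a) - f(- a) tends to the integral L of g. If L were not 0, this difference
    would stay above |L| / 2 in absolute value for all large a, against the integrability of f. *)
Lemma int_derive_eq0 f g : (forall x : R, is_derive x 1 f (g x)) ->
  continuous g -> intble f -> intble g -> \int[mu]_x g x = 0.
Proof.
move=> df cg If Ig; apply/eqP/negPn/negP => L0.
set L := \int[mu]_x g x in L0 *; pose c := `|L| / 2.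
have c0 : 0 < c by rewrite divr_gt0// normr_gt0.
have [||||_] := @dominated_cvg_int _ (fun n x => `|g x - trunc n g x|) (fun=> 0)
  (fun x => `|g x|).
- move=> n; apply: measurableT_comp => //; apply: measurable_funB; first exact: intble_meas.
  by apply: intble_meas; exact: intble_patch.
- move=> x; apply: (@cvg_to_eq _ _ _ _ `|g x - g x|); first by rewrite subrr normr0.
  by apply: cvg_norm; apply: cvgB; [exact: cvg_cst|exact: trunc_cvg].
- move=> n x; rewrite normr_id truncE; case: ifP => _; last by rewrite subr0.
  by rewrite subrr normr0.
- exact: intble_norm.
rewrite Rintegral_cst// mul0r => /cvgrPdist_le /(_ _ c0)[N _ HN].
have {}HN : \int[mu]_x `|g x - trunc N g x| <= c.
  by have := HN N (leqnn N); rewrite sub0r normrN ger0_norm// int_ge0.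
have far (a : R) : N%:R <= a -> 0 < a -> c <= `|f a - f (- a)|.
  move=> Na a0; rewrite -(int_patch_derive a0 df cg).
  have Ip : intble (g \_ `[- a, a]%classic) by exact: intble_patch.
  set J := \int[mu]_x (g \_ `[- a, a]%classic) x.
  have LJ : `|L - J| <= c.
    apply: le_trans HN; rewrite -intB//; apply: int_norm_le.
    - by apply: measurable_funB; exact: intble_meas.
    - by apply: intble_norm; apply: intbleB => //; exact: intble_patch.
    - move=> x; rewrite truncE patchE mem_setE in_itv /= -ler_norml.
      have [xN|xN] := leP `|x| N%:R; first by rewrite ifT// (le_trans xN).
      by rewrite subr0; case: ifP => _; rewrite ?subrr ?normr0 ?subr0.
  have := ler_normD (L - J) J; rewrite subrK => LJ2.
  by rewrite -(lerD2l c) -{1}splitr (le_trans LJ2)// lerD2r.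
pose h x := f x - f (- x).
have Ih : intble h by apply: intbleB => //; exact: intble_opp.
(* The window of length k starting at N + 1 already gives |f(x) - f(- x)| a mass k c larger than its
   total integral. Starting at N + 1 rather than N keeps a positive. *)
pose k := (Num.bound ((\int[mu]_x `|h x|) / c)).
have := archi_boundP (divr_ge0 (int_ge0 (fun x => normr_ge0 (h x))) (ltW c0)).
rewrite -/k ltr_pdivrMr// ltNge => /negP; apply.
have -> : k%:R * c = \int[mu]_x ((fun=> c) \_ `[N.+1%:R, N.+1%:R + k%:R]%classic) x.
  rewrite -Rintegral_mkcond Rintegral_cst//= lebesgue_measure_itv /= lte_fin.
  case: ifPn => [_|]; first by rewrite /= addrAC subrr add0r mulrC.
  by rewrite -leNgt gerDl lern0 => /eqP ->; rewrite mul0r mulr0.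
apply: int_le.
- rewrite (_ : _ \_ _ = fun x => c * \1_(`[N.+1%:R, N.+1%:R + k%:R]%classic) x).
    exact/intbleZ/integrable_indic_itv.
  by apply/funext => x; rewrite patchE indicE; case: ifP => _; rewrite ?mulr1 ?mulr0.
- exact: intble_norm.
- move=> x; rewrite patchE mem_setE in_itv /=; case: ifPn => [/andP[Nx _]|_].
    by apply: far; [rewrite (le_trans _ Nx)// ler_nat|rewrite (lt_le_trans _ Nx)].
  exact: normr_ge0.
Qed.

(** Products of square integrable functions are integrable, so [int_derive_eq0] applies to f g and
    no boundary terms appear. *)
Lemma integration_by_parts_line f f1 g g1 :
  (forall x : R, is_derive x 1 f (f1 x)) -> (forall x : R, is_derive x 1 g (g1 x)) ->
  continuous f1 -> continuous g1 -> sqint f -> sqint f1 -> sqint g -> sqint g1 ->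
  \int[mu]_x (f x * g1 x) = - \int[mu]_x (f1 x * g x).
Proof.
move=> df dg cf1 cg1 Lf Lf1 Lg Lg1.
have cf : continuous f by move=> x; exact: is_derive_continuous (df x).
have cg : continuous g by move=> x; exact: is_derive_continuous (dg x).
have I1 : intble (fun x => f x * g1 x) by exact: sqint_mul.
have I2 : intble (fun x => f1 x * g x) by exact: sqint_mul.
apply/eqP; rewrite -subr_eq0 opprK -intD//; apply/eqP.
apply: (@int_derive_eq0 (fun x => f x * g x)).
- move=> x; have dfx := df x; have dgx := dg x.
  by apply: is_derive_eq; rewrite /GRing.scale /= [g x * _]mulrC.
- by move=> x; apply: cvgD; apply: cvgM; [exact: cf|exact: cg1|exact: cf1|exact: cg].
- exact: sqint_mul.
- exact: intbleD.
Qed.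

(** Bessel's inequality for K minus its truncation reduces this to the convergence of truncations in
    L^2. *)
Lemma cvg_cint_trunc K : intble K -> sqint K ->
  (\int[mu]_x (cint K x - cint (trunc n K) x) ^+ 2) @[n --> \oo] --> 0.
Proof.
move=> IK LK.
apply: (squeeze_cvg0 _ (cvg0Z (2 * pi) (trunc_cvg2 LK))).
near=> n; rewrite int_sqr_ge0 /=.
have It := intble_trunc n LK; have Lt := sqint_trunc n LK.
have [_ +] := cint_bessel (intbleB IK It) (sqintB LK Lt).
by apply: le_trans; apply: le_of_eq; apply: eq_int => x; rewrite cintB.
Unshelve. all: by end_near. Qed.

(* Equality in Bessel's inequality for G makes the transforms of the truncations
   of (2 pi)^-1 cint G converge to G. *)
Lemma is_hart_isometry G : intble G -> sqint G ->
  2 * pi * \int[mu]_x G x ^+ 2 <= \int[mu]_x cint G x ^+ 2 ->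
  is_hart (fun x => (2 * pi)^-1 * cint G x) G.
Proof.
move=> IG LG isoG; set g := fun x => _ * _.
have Lg : sqint g by exact/sqintZ/sqint_cint.
split => //.
have h : (2 * pi * \int[mu]_x (g x - trunc n g x) ^+ 2) @[n --> \oo] --> 0.
  exact: (cvg0Z (2 * pi) (trunc_cvg2 Lg)).
apply: squeeze_cvg0 h; near=> n; rewrite int_sqr_ge0 /=.
have Lt := sqint_trunc n Lg; have It := intble_trunc n Lg.
have Lc := sqint_cint_trunc n Lg.
have [_ bt] := cint_bessel It Lt.
have tt x : trunc n g x ^+ 2 = g x * trunc n g x.
  by rewrite truncE; case: ifP => _; [ring|rewrite mulr0 expr0n].
have -> : \int[mu]_x (g x - trunc n g x) ^+ 2 =
    \int[mu]_x g x ^+ 2 - \int[mu]_x trunc n g x ^+ 2.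
  rewrite -intB; [|by case: Lg|by case: Lt].
  by apply: eq_int => x; rewrite tt sqrrB tt; ring.
(* The cross term is exact: by [cint_swap] it is the integral of [trunc n g] against [cint G], and
   [cint G] is 2 pi g. *)
have -> : \int[mu]_x (G x - cint (trunc n g) x) ^+ 2 =
   \int[mu]_x G x ^+ 2 - 2 * (2 * pi * \int[mu]_x trunc n g x ^+ 2) +
   \int[mu]_x cint (trunc n g) x ^+ 2.
  have -> : 2 * pi * \int[mu]_x trunc n g x ^+ 2 = \int[mu]_x (G x * cint (trunc n g) x).
    rewrite cint_swap// -intZ; last by case: Lt.
    apply: eq_int => x; rewrite tt /g.
    by rewrite -!mulrA [cint G x * _]mulrC !mulrA divff ?twopi_neq0// mul1r mulrC.
  rewrite -intZ ?sqint_mul// -intB; [|by case: LG|by apply: intbleZ; exact: sqint_mul].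
  rewrite -intD; [|apply: intbleB; [by case: LG|by apply: intbleZ; exact: sqint_mul]|by case: Lc].
  by apply: eq_int => x; ring.
have : \int[mu]_x G x ^+ 2 <= 2 * pi * \int[mu]_x g x ^+ 2.
  rewrite /g -(ler_pM2l (_ : 0 < 2 * pi)) ?mulr_gt0 ?pi_gt0//.
  apply: (le_trans isoG).
  rewrite -(intZ _ (proj2 Lg)) -intZ; last exact: intbleZ (proj2 Lg).
  apply: le_of_eq; apply: eq_int => x; rewrite /g exprMn.
  by rewrite expr2 -[_ * _ * cint G x ^+ 2]mulrA !mulVKf ?twopi_neq0.
rewrite mulrBr => h2; rewrite -subr_ge0.
rewrite (_ : _ - _ = (2 * pi * \int[mu]_x g x ^+ 2 - \int[mu]_x G x ^+ 2) +
  (2 * pi * \int[mu]_x trunc n g x ^+ 2 - \int[mu]_x cint (trunc n g) x ^+ 2)).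
  by rewrite addr_ge0// subr_ge0.
by ring.
Unshelve. all: by end_near. Qed.

(** Differentiating the inversion formula gives f' as a multiple of [cint G]. That G is in turn the
    transform of f' follows from [is_hart_isometry], once equality in Bessel's inequality is known
    for G. *)
Lemma is_hart_derive f F (G := fun y : R => - (y * F (- y))) : is_hart f F ->
  continuous f -> intble F -> intble (fun y => y * F y) -> sqint (fun y => y * F y) ->
  (forall x : R, is_derive x 1 f ((2 * pi)^-1 * cint G x)) /\
  is_hart (fun x => (2 * pi)^-1 * cint G x) G.
Proof.
move=> hf cf IF IyF LyF; have [Lf LF _] := hf.
have GE y : G y = (fun y => y * F y) (- y) by rewrite /G mulNr.
have IG : intble G by apply: eq_intble (intble_opp IyF) => y; rewrite GE.
have LG : sqint G.
  rewrite (_ : G = fun y => (fun y => y * F y) (- y)); last exact/funext.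
  exact: (sqint_opp LyF).
set f' := fun x => _ * _.
have fE := hart_inversion hf IF cf.
have df (x : R) : is_derive x 1 f (f' x).
  rewrite (_ : f = fun x => (2 * pi)^-1 * cint F x); last exact/funext.
  have h := is_derive_cint x IF IyF.
  exact: is_derive_eq.
have cf' : continuous f'.
  by move=> x; apply: cvgM; [exact: cvg_cst|exact: continuous_cint].
have Lf' : sqint f' by exact/sqintZ/sqint_cint.
split; [exact: df|apply: is_hart_isometry; [exact: IG|exact: LG|]].
(* Duality: a reflection moves the factor y from F to K, [hart_mul] passes to f, and integration by
   parts puts the derivative on f. *)
have key K : intble K -> sqint K -> intble (fun y => y * K y) -> sqint (fun y => y * K y) ->
    \int[mu]_x (G x * K x) = \int[mu]_x (f' x * cint K x).
  move=> IK LK IyK LyK.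
  pose K1 (y : R) := y * K (- y).
  have K1E y : K1 y = - (fun y => y * K y) (- y) by rewrite /K1 mulNr opprK.
  have IK1 : intble K1.
    by apply: eq_intble (intbleN (intble_opp IyK)) => y; rewrite K1E.
  have LK1 : sqint K1.
    rewrite (_ : K1 = fun y => - (fun y => y * K y) (- y)); last exact/funext.
    exact: sqintN (sqint_opp LyK).
  have dK (x : R) : is_derive x 1 (cint K) (- cint K1 x).
    have h := is_derive_cint x IK IyK.
    by apply: is_derive_eq; rewrite -cintN.
  have mGK : meas (fun x => G x * K x).
    by apply: measurable_funM; exact: intble_meas.
  transitivity (\int[mu]_x (F x * K1 x)).
    rewrite -(int_opp mGK); apply: eq_int => x; rewrite /G /K1 opprK; ring.
  rewrite (hart_mul hf IK1 LK1).
  have cK1 : continuous (fun x => - cint K1 x).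
    by move=> x; apply: cvgN; exact: continuous_cint.
  have := integration_by_parts_line df dK cf' cK1 Lf Lf' (sqint_cint IK LK)
    (sqintN (sqint_cint IK1 LK1)).
  rewrite -intN; last by apply: sqint_mul => //; exact: sqint_cint.
  have I1 : intble (fun x => f x * cint K1 x) by apply: sqint_mul => //; exact: sqint_cint.
  move=> h; rewrite -[LHS]opprK -intN//.
  rewrite (_ : \int[mu]_x - (f x * cint K1 x) = \int[mu]_x (f x * - cint K1 x)).
    rewrite h intN ?opprK//; by apply: sqint_mul => //; exact: sqint_cint.
  by apply: eq_int => x; rewrite mulrN.
(* Equality in Bessel's inequality is [key] with K = G, but y G(y) may fail to be integrable. So
   [key] is applied to the truncations of G, and n tends to infinity. *)
have h1 : (\int[mu]_x (trunc n G x * G x)) @[n --> \oo] --> \int[mu]_x (G x * G x).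
  apply: cvg_int_mul => //; last exact/cvg_sqr_sym/trunc_cvg2.
  by apply: nearW => n; exact: sqint_trunc.
have h2 : (\int[mu]_x (cint (trunc n G) x * f' x)) @[n --> \oo] --> \int[mu]_x (cint G x * f' x).
  apply: cvg_int_mul => //; [|exact: sqint_cint|exact/cvg_sqr_sym/cvg_cint_trunc].
  by apply: nearW => n; exact: sqint_cint_trunc.
have e : \int[mu]_x (G x * G x) = \int[mu]_x (cint G x * f' x).
  apply: (lim_unique h1); apply: cvg_trans h2; apply: near_eq_cvg; near=> n.
  have mt (h : R -> R) : intble h -> intble (fun y => y * trunc n h y).
    move=> Ih; apply: (@intble_le _ _ (fun y => n%:R * `|h y|)).
    - by apply: measurable_funM => //; apply: intble_meas; exact: intble_patch.
    - move=> y; rewrite truncE normrM; case: ifP => yn; first by rewrite ler_wpM2r.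
      by rewrite normr0 mulr0 mulr_ge0.
    - exact/intbleZ/intble_norm.
  transitivity (\int[mu]_x (f' x * cint (trunc n G) x)).
    by apply: eq_int => x; rewrite mulrC.
  rewrite -key.
  - by apply: eq_int => x; rewrite mulrC.
  - exact: intble_trunc.
  - exact: sqint_trunc.
  - exact: mt.
  - split; first exact: intble_meas (mt _ IG).
    apply: (@intble_le _ _ (fun y => n%:R ^+ 2 * G y ^+ 2)).
    + by apply: measurable_funX; exact: intble_meas (mt _ IG).
    + move=> y; rewrite truncE ger0_norm ?sqr_ge0//; case: ifP => yn.
        rewrite exprMn ler_wpM2r ?sqr_ge0// -real_normK ?num_real//.
        by rewrite lerXn2r// nnegrE.
      by rewrite mulr0 expr0n mulr_ge0 ?sqr_ge0.
    + by apply: intbleZ; case: LG.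
apply: le_of_eq.
have -> : \int[mu]_x G x ^+ 2 = \int[mu]_x (G x * G x) by apply: eq_int => x; rewrite expr2.
rewrite e -intZ; last by apply: sqint_mul => //; exact: sqint_cint.
by apply: eq_int => x; rewrite mulrCA mulVKf ?twopi_neq0// expr2.
Unshelve. all: by end_near. Qed.

End derivative.

(** * Unique continuation for the Hilbert transform *)

Section moments.
Set Implicit Arguments.
Unset Strict Implicit.
Context {R : realType}.
Local Notation mu := (@lebesgue_measure R).
Local Notation meas f := (measurable_fun setT (f : R -> R)).
Implicit Types (f g h F G K : R -> R) (A : set R).

(** The continuous functions x / (x^2 + 1/(n+1)) converge pointwise to the inverse, also at 0, where
    both they and the default value of the inverse are 0. *)
Lemma meas_inv : meas (fun x => x^-1).
Proof.
have n0 (n : nat) : 0 < n.+1%:R^-1 :> R by [].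
pose u (n : nat) (x : R) : R := x / (x ^+ 2 + n.+1%:R^-1).
apply: (@measurable_fun_cvg _ _ _ _ u).
- move=> n; apply: continuous_meas => x; apply: cvgM; first exact: cvg_id.
  apply: cvgV; first by rewrite gt_eqF// ltr_wpDl ?sqr_ge0.
  by apply: cvgD; [exact: exprn_continuous|exact: cvg_cst].
- move=> x _; have [->|x0] := eqVneq x 0.
    by rewrite invr0 /u; under eq_fun do rewrite mul0r; exact: cvg_cst.
  apply: (@cvg_to_eq _ _ _ _ (x / (x ^+ 2 + 0))).
    by rewrite addr0; field.
  apply: cvgM; first exact: cvg_cst.
  apply: cvgV; first by rewrite addr0 sqrf_eq0.
  by apply: cvgD; [exact: cvg_cst|exact: cvg_harmonic].
Qed.

Lemma intble_moment f (d : R) k : 0 < d -> (forall x, `|x| < d -> f x = 0) ->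
  intble f -> intble (fun x => f x * x ^- k).
Proof.
move=> d0 fd If; apply: (@intble_le _ _ (fun x => d ^- k * `|f x|)).
- apply: measurable_funM; first exact: intble_meas.
  apply: (measurableT_comp (f := fun x : R => x^-1)); first exact: meas_inv.
  exact: exprn_measurable.
- move=> x; have [xd|dx] := ltP `|x| d; first by rewrite fd// mul0r normr0 mulr0.
  rewrite normrM mulrC ler_wpM2r// normfV normrX lef_pV2 ?posrE ?exprn_gt0//.
    by rewrite lerXn2r// nnegrE ltW.
  exact: lt_le_trans dx.
- exact/intbleZ/intble_norm.
Qed.

(* q = 1 - c (1/y - 1/y0)^2 is a polynomial in 1/y with values in [0, 1] on the
   support of f and maximal at y0: all moments of q^n f vanish, while
   q^n concentrates at y0. *)
Lemma moments_eq0_at f (d y0 : R) : 0 < d -> d <= `|y0| ->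
  (forall x, `|x| < d -> f x = 0) -> intble f ->
  (forall k, \int[mu]_x (f x * x ^- k) = 0) -> {for y0, continuous f} -> f y0 <= 0.
Proof.
move=> d0 dy0 fd If mom cf; rewrite leNgt; apply/negP => fy0.
have y0n0 : 0 < `|y0| by exact: lt_le_trans dy0.
have y0_neq0 : y0 != 0 by rewrite -normr_gt0.
(* For |y| >= d both reciprocals are at most 1/d in absolute value, so the subtracted term is at
   most (d^2 / 8) (2 / d)^2 = 1/2 and q stays positive there. *)
pose c := d ^+ 2 / 8; have c0 : 0 < c by rewrite divr_gt0// exprn_gt0.
pose q (y : R) := 1 - c * (y^-1 - y0^-1) ^+ 2.
have inv_le y : d <= `|y| -> `|y^-1| <= d^-1.
  by move=> dy; rewrite normfV lef_pV2// posrE (lt_le_trans d0).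
have q1 y : q y <= 1 by rewrite gerBl mulr_ge0 ?sqr_ge0// ltW.
have q0 y : d <= `|y| -> 0 <= q y.
  move=> dy; rewrite subr_ge0 /c.
  have h : `|y^-1 - y0^-1| <= 2 * d^-1.
    rewrite (le_trans (ler_normB _ _))// (_ : 2 * d^-1 = d^-1 + d^-1); last by ring.
    by rewrite lerD// inv_le.
  have : (y^-1 - y0^-1) ^+ 2 <= (2 * d^-1) ^+ 2.
    by rewrite -real_normK ?num_real// lerXn2r// nnegrE (le_trans _ h).
  have dd : d ^+ 2 * (2 * d^-1) ^+ 2 = 4 by field; rewrite gt_eqF.
  move=> h4; rewrite mulrAC ler_pdivrMr// mul1r.
  by rewrite (le_trans (ler_wpM2l (sqr_ge0 d) h4))// dd ler_nat.
(* The induction on n carries all orders k at once: a factor q involves the moments of orders k, k +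
   1 and k + 2. *)
have qmom n k : \int[mu]_x (q x ^+ n * f x * x ^- k) = 0 /\ intble (fun x => q x ^+ n * f x).
  elim: n k => [|n IH] k.
    split; last by apply: eq_intble If => x; rewrite mul1r.
    by rewrite -[RHS](mom k); apply: eq_int => x; rewrite mul1r.
  have [_ In] := IH 0%N.
  have fdn x : `|x| < d -> q x ^+ n * f x = 0 by move=> /fd ->; rewrite mulr0.
  have Imom j : intble (fun x => q x ^+ n * f x * x ^- j) by exact: (intble_moment j d0 fdn In).
  have E x j : q x ^+ n.+1 * f x * x ^- j = (1 - c * y0^-1 ^+ 2) * (q x ^+ n * f x * x ^- j) +
     (2 * c * y0^-1 * (q x ^+ n * f x * x ^- j.+1) - c * (q x ^+ n * f x * x ^- j.+2)).
    rewrite exprS /q -!exprVn !exprS; ring.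
  split.
    under eq_Rintegral do rewrite E.
    rewrite intD; [|exact: intbleZ|by apply: intbleB; exact: intbleZ].
    rewrite intB ?intZ//; [|exact: intbleZ..].
    by rewrite (IH k).1 (IH k.+1).1 (IH k.+2).1 !mulr0 subr0 addr0.
  apply: (@eq_intble _ (fun x => (1 - c * y0^-1 ^+ 2) * (q x ^+ n * f x * x ^- 0) +
     (2 * c * y0^-1 * (q x ^+ n * f x * x ^- 1) - c * (q x ^+ n * f x * x ^- 2)))).
    by move=> x; rewrite -E expr0 invr1 mulr1.
  by apply: intbleD; [exact: intbleZ|apply: intbleB; exact: intbleZ].
have hy0 : 0 < f y0 / 2 by rewrite divr_gt0.
move/cvgrPdist_le: cf => /(_ _ hy0) /nbhs_ballP[eta /= eta0 near_f].
have {}near_f y : `|y0 - y| < eta -> f y0 / 2 <= f y.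
  move=> /near_f /= /ler_normlP[_]; lra.
(* As 1/y - 1/y0 = (y0 - y) / (y y0) and |y| <= |y0 - y| + |y0|, this is a lower bound for |1/y -
   1/y0| at distance at least eta from y0. *)
pose kap := eta / ((eta + `|y0|) * `|y0|).
have kap0 : 0 < kap by rewrite divr_gt0// mulr_gt0// addr_gt0.
have far y : d <= `|y| -> eta <= `|y0 - y| -> kap <= `|y^-1 - y0^-1|.
  move=> dy ey; have yn0 : 0 < `|y| by exact: lt_le_trans dy.
  have -> : y^-1 - y0^-1 = (y0 - y) / (y * y0).
    by field; rewrite y0_neq0 -normr_gt0.
  rewrite normrM normfV normrM /kap ler_pdivrMr ?mulr_gt0 ?addr_gt0//.
  rewrite mulrAC ler_pdivlMr ?mulr_gt0//.
  have : `|y| <= `|y0 - y| + `|y0|.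
    by rewrite distrC -{1}(subrK y0 y) ler_normD.
  move: (`|y0 - y|) (`|y|) (`|y0|) ey yn0 y0n0 => a b p ey b0 p0 bap.
  have : eta * b <= a * (eta + p) by nra.
  by nra.
(* Within eta' of y0 and for |y| >= d, the same quotient is at most eta' / (d |y0|) <= kap / 2.
   Hence q is at least [sig] there and at most [rho] < [sig] beyond eta. *)
pose eta' := Num.min eta (kap * (d * `|y0|) / 2).
have eta'0 : 0 < eta' by rewrite lt_min eta0 divr_gt0// mulr_gt0// mulr_gt0.
have near y : d <= `|y| -> `|y0 - y| < eta' -> `|y^-1 - y0^-1| <= kap / 2.
  move=> dy; rewrite lt_min => /andP[_ ey].
  have yn0 : 0 < `|y| by exact: lt_le_trans dy.
  have -> : y^-1 - y0^-1 = (y0 - y) / (y * y0).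
    by field; rewrite y0_neq0 -normr_gt0.
  rewrite normrM normfV normrM ler_pdivrMr ?mulr_gt0//.
  apply: (le_trans (ltW ey)).
  rewrite mulrAC; apply: ler_wpM2l; first by rewrite divr_ge0 ?(ltW kap0).
  exact: ler_wpM2r.
pose rho := 1 - c * kap ^+ 2; pose sig := 1 - c * (kap / 2) ^+ 2.
have rs : rho < sig.
  rewrite ltrD2l ltrN2 ltr_pM2l// exprMn -[ltRHS]mulr1 ltr_pM2l ?exprn_gt0//.
  by rewrite expr2; lra.
have qfar y : d <= `|y| -> eta <= `|y0 - y| -> q y <= rho.
  move=> dy ey; rewrite lerD2l lerN2 ler_wpM2l ?(ltW c0)//.
  by rewrite -[leRHS]real_normK ?num_real// lerXn2r ?nnegrE ?(ltW kap0)// far.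
have qnear y : d <= `|y| -> `|y0 - y| < eta' -> sig <= q y.
  move=> dy ey; rewrite lerD2l lerN2 ler_wpM2l ?(ltW c0)//.
  have h := near y dy ey.
  by rewrite -[leLHS]real_normK ?num_real// lerXn2r ?nnegrE// (le_trans _ h).
have rho0 : 0 < rho.
  have kapd : kap <= d^-1.
    rewrite /kap invfM mulrA -[leRHS]mul1r ler_pM ?invr_ge0 ?divr_ge0 ?(ltW eta0) ?addr_ge0//.
    - exact: ltW.
    - by rewrite ler_pdivrMr ?addr_gt0// mul1r lerDl.
    - by rewrite lef_pV2 ?posrE.
  have k2 : kap ^+ 2 <= d^-1 ^+ 2 by rewrite lerXn2r// nnegrE ?invr_ge0 ltW.
  rewrite subr_gt0 /c mulrAC ltr_pdivrMr// mul1r.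
  rewrite (le_lt_trans (ler_wpM2l (sqr_ge0 d) k2))//.
  by rewrite -exprMn divff ?gt_eqF// expr1n ltr1n.
have sig0 : 0 < sig by exact: lt_trans rs.
pose B := \int[mu]_x `|f x|.
have I1 : intble (\1_(`](y0 - eta'), (y0 + eta')[%classic) : R -> R).
  exact: integrable_indic_itv.
(* Pointwise, sig^n f(y0) / 2 on the interval around y0 is at most rho^n |f| + q^n f: near y0 the
   function f is positive, and far from it q^n |f| <= rho^n |f|. The integral of q^n f vanishes, and
   n -> oo contradicts rho < sig. *)
have main n : sig ^+ n * (f y0 / 2 * (2 * eta')) <= rho ^+ n * B.
  have [i0 In] := qmom n 0%N.
  have {}i0 : \int[mu]_x (q x ^+ n * f x) = 0.
    by rewrite -[RHS]i0; apply: eq_int => x; rewrite expr0 invr1 mulr1.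
  rewrite -[leRHS]addr0 -i0 -intZ; last exact: intble_norm.
  rewrite -intD//; last exact/intbleZ/intble_norm.
  have -> : 2 * eta' = \int[mu]_x \1_(`](y0 - eta'), (y0 + eta')[%classic) x.
    rewrite /Rintegral integral_indic//= setIT lebesgue_measure_itv /= lte_fin.
    by rewrite ifT ?ltrD2l ?gtrN//=; ring.
  rewrite mulrA -intZ//; apply: int_le; first exact: intbleZ.
    by apply: intbleD => //; exact/intbleZ/intble_norm.
  move=> x; rewrite indicE mem_setE in_itv /=.
  have [xe|ex] := ltP `|y0 - x| eta.
    have fx := near_f x xe; have fx0 : 0 < f x by exact: lt_le_trans fx.
    have dx : d <= `|x|.
      by rewrite leNgt; apply/negP => /fd x0; rewrite x0 ltxx in fx0.
    apply: (@le_trans _ _ (q x ^+ n * f x)); last first.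
      by rewrite lerDr mulr_ge0// exprn_ge0// ltW.
    have [xe'|_] := boolP (_ < x < _).
      rewrite mulr1 ler_pM ?exprn_ge0 ?(ltW sig0) ?(ltW hy0)// lerXn2r ?nnegrE ?(ltW sig0) ?q0//.
      by apply: qnear => //; move: xe'; rewrite distrC ltr_distl.
    by rewrite mulr0 mulr_ge0 ?exprn_ge0 ?q0// ltW.
  have /negbTE -> : ~~ (y0 - eta' < x < y0 + eta').
    apply/negP; rewrite -ltr_distl distrC lt_min => /andP[+ _].
    by rewrite ltNge ex.
  rewrite mulr0; have [xd|dx] := ltP `|x| d.
    by rewrite (fd _ xd) normr0 !mulr0 addr0.
  rewrite -lerBlDl sub0r.
  have : `|q x ^+ n * f x| <= rho ^+ n * `|f x|.
    rewrite normrM ler_wpM2r// normrX lerXn2r ?nnegrE ?(ltW rho0)//.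
    by rewrite ger0_norm ?q0// qfar.
  by rewrite ler_norml => /andP[].
have A0 : 0 < f y0 / 2 * (2 * eta') by rewrite mulr_gt0// mulr_gt0.
have lim0 : ((rho / sig) ^+ n * B) @[n --> \oo] --> 0.
  apply: (@cvg_to_eq _ _ _ _ (0 * B)); first by rewrite mul0r.
  apply: cvgM; last exact: cvg_cst.
  apply: cvg_expr; rewrite ger0_norm ?divr_ge0 ?(ltW rho0) ?(ltW sig0)//.
  by rewrite ltr_pdivrMr// mul1r.
move: A0; rewrite ltNge => /negP; apply.
rewrite -(cvg_lim _ lim0)//; apply: limr_ge; first by apply/cvg_ex; eexists; exact: lim0.
apply: nearW => n /=; rewrite expr_div_n [leRHS]mulrAC ler_pdivlMr ?exprn_gt0//.
by rewrite [leLHS]mulrC main.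
Qed.

Lemma moments_eq0 f (d : R) : 0 < d -> (forall x, `|x| < d -> f x = 0) ->
  intble f -> (forall k, \int[mu]_x (f x * x ^- k) = 0) ->
  (forall x, x != 0 -> {for x, continuous f}) -> forall x, f x = 0.
Proof.
move=> d0 fd If mom cf x; have [xd|dx] := ltP `|x| d; first exact: fd.
have x0 : x != 0 by rewrite -normr_gt0 (lt_le_trans d0).
apply/eqP; rewrite eq_le (moments_eq0_at d0 dx)//=; last exact: cf.
rewrite -oppr_le0; apply: (@moments_eq0_at (fun x => - f x) d x) => //.
- by move=> y /fd ->; rewrite oppr0.
- exact: intbleN.
- move=> k; under eq_Rintegral do rewrite mulNr.
  by rewrite intN ?mom ?oppr0//; exact: (intble_moment k d0 fd If).
- by apply: cvgN; exact: cf.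
Qed.

End moments.

(** * From vanishing to infinite order to vanishing moments *)

Section unique_continuation.
Set Implicit Arguments.
Unset Strict Implicit.
Context {R : realType}.
Local Notation mu := (@lebesgue_measure R).
Local Notation meas f := (measurable_fun setT (f : R -> R)).
Implicit Types (f g h F G K : R -> R) (A : set R).

(** On the support of f one has |x - y| >= e. There |f| / |x - y| <= f^2 + (x - y)^-2, and the last
    term is at most (1 + e^-2) times the Poisson kernel with parameter 1. *)
Lemma intble_div f (x d e : R) : sqint f -> 0 < e -> (forall y, `|y| < d -> f y = 0) ->
  `|x| + e <= d -> intble (fun y => f y / (x - y)).
Proof.
move=> Lf e0 fd xd; have [mf If2] := Lf.
have [IP _] := int_poisson x (ltr01 : 0 < 1 :> R).
have mx : meas (fun y => x - y) by exact: measurable_funB.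
apply: (@intble_le _ _ (fun y => f y ^+ 2 + (1 + e ^- 2) * poisson 1 (x - y))).
- by apply: measurable_funM => //; apply: (measurableT_comp (f := fun x : R => x^-1)) => //; exact: meas_inv.
- move=> y; have P0 := poisson_ge0 (x - y) (ltr01 : 0 < 1 :> R).
  have E0 : 0 <= 1 + e ^- 2 by rewrite addr_ge0// invr_ge0 sqr_ge0.
  have [yd|dy] := ltP `|y| d.
    by rewrite fd// mul0r normr0 addr_ge0 ?sqr_ge0// mulr_ge0.
  have exy : e <= `|x - y|.
    rewrite distrC; have := lerB_dist y x; move: (`|y - x|) (`|x|) (`|y|) xd dy => a b c; lra.
  have xy0 : 0 < `|x - y| by exact: lt_le_trans exy.
  apply: (@le_trans _ _ (f y ^+ 2 + `|x - y| ^- 2)).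
    rewrite normrM normfV -[f y ^+ 2]real_normK ?num_real// -exprVn.
    have := sqr_ge0 (`|f y| - `|x - y|^-1); have := sqr_ge0 (`|f y| + `|x - y|^-1).
    by nra.
  rewrite lerD2l real_normK ?num_real// /poisson expr1n mul1r.
  have s0 : 0 < (x - y) ^+ 2 by rewrite exprn_even_gt0//= -normr_gt0.
  rewrite ler_pdivlMr ?addr_gt0// mulrC ler_pdivrMr//.
  have : 1 <= e ^- 2 * (x - y) ^+ 2.
    rewrite mulrC ler_pdivlMr ?exprn_gt0// mul1r -[leRHS]real_normK ?num_real//.
    by rewrite lerXn2r// nnegrE ltW.
  by move: (e ^- 2) ((x - y) ^+ 2) => a b h; rewrite mulrDl mul1r; lra.
- by apply: intbleD => //; exact: intbleZ.
Qed.

(* The Hilbert transform of the function whose Hartley transform is F. *)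
Definition hilb F (x : R) := (2 * pi)^-1 * cint (fun y => Num.sg y * F (- y)) x.

Lemma intble_sgr F : intble F -> intble (fun y => Num.sg y * F (- y)).
Proof.
move=> IF; apply: (intbleMb meas_sgr sgr_max (f := fun y => F (- y))).
exact: (intble_opp IF).
Qed.

Lemma continuous_hilb F : intble F -> continuous (hilb F).
Proof.
move=> IF x; apply: cvgM; first exact: cvg_cst.
exact: continuous_cint (intble_sgr IF) x.
Qed.

(** For |x| < d the singularity y = x lies where f vanishes, so no principal value arises. With
    e^(-e|y|) inserted, [hart_mul] and [cint_exp_sgn] give f against the conjugate Poisson kernel,
    which is dominated by |f(y) / (x - y)|, and e -> 0 on both sides. *)
Lemma hilb_kernel f F (d x : R) : is_hart f F -> intble F ->
  (forall y, `|y| < d -> f y = 0) -> `|x| < d ->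
  pi * hilb F x = \int[mu]_y (f y / (x - y)).
Proof.
move=> hf IF fd xd; have [Lf LF _] := hf.
pose e := d - `|x|; have e0 : 0 < e by rewrite subr_gt0.
have Ig := intble_div Lf e0 fd (ltac:(by rewrite /e addrC subrK) : `|x| + e <= d).
have mF := intble_meas IF.
have mS : meas (fun y => Num.sg y * F (- y)).
  by apply: measurable_funM; [exact: meas_sgr|exact: meas_opp].
have IS : intble (fun y => Num.sg y * F (- y)).
  by apply: (@intbleMb _ 1 (fun y => F (- y)) Num.sg meas_sgr sgr_max); exact: (intble_opp IF).
have E1 n (y : R) : expR (- (n.+1%:R^-1 * `|y|)) <= 1 :> R.
  have e0' : 0 < n.+1%:R^-1 :> R by [].
  by have := expNnorm_le1 y e0'; rewrite ger0_norm ?expR_ge0.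
have [||||_ h1] := @dominated_cvg_int _ (fun n y => cas (x * y) *
    (expR (- (n.+1%:R^-1 * `|y|)) * (Num.sg y * F (- y))))
  (fun y => cas (x * y) * (Num.sg y * F (- y))) (fun y => 2 * `|Num.sg y * F (- y)|).
- move=> n; apply: measurable_funM; first exact: meas_cas.
  by apply: measurable_funM => //; exact: meas_expNnorm.
- move=> y; apply: cvgM; first exact: cvg_cst.
  rewrite -[X in _ --> X]mul1r; apply: cvgM; last exact: cvg_cst.
  rewrite -[X in _ --> X](_ : expR (- (0 * `|y|)) = 1); last first.
    by rewrite mul0r oppr0 expR0.
  apply: continuous_cvg; first exact: continuous_expR.
  by apply: cvgN; apply: cvgM; [exact: cvg_harmonic|exact: cvg_cst].
- move=> n y; rewrite normrM ler_pM// ?cas_max//.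
  by rewrite normrM ler_piMl// ger0_norm ?expR_ge0.
- exact/intbleZ/intble_norm.
have [||||_ h2] := @dominated_cvg_int _ (fun n y => f y *
    ((x - y) / (n.+1%:R^-1 ^+ 2 + (x - y) ^+ 2)))
  (fun y => f y / (x - y)) (fun y => `|f y / (x - y)|).
- move=> n; apply: measurable_funM; first by case: Lf.
  have cq : continuous (fun z : R => z / (n.+1%:R^-1 ^+ 2 + z ^+ 2)).
    move=> z; apply: cvgM; first exact: cvg_id.
    apply: cvgV; first by rewrite gt_eqF// poisson_den.
    by apply: cvgD; [exact: cvg_cst|exact: exprn_continuous].
  by apply: (measurableT_comp (continuous_meas cq)); exact: measurable_funB.
- move=> y; have [xy|xy] := eqVneq x y.
    by rewrite -xy fd// mul0r; under eq_fun do rewrite mul0r; exact: cvg_cst.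
  have xy0 : x - y != 0 by rewrite subr_eq0.
  apply: cvgM; first exact: cvg_cst.
  apply: (@cvg_to_eq _ _ _ _ ((x - y) / (0 * 0 + (x - y) ^+ 2))).
    by rewrite mul0r add0r; field.
  apply: cvgM; first exact: cvg_cst.
  apply: cvgV; first by rewrite mul0r add0r sqrf_eq0.
  by apply: cvgD; [apply: cvgM; exact: cvg_harmonic|exact: cvg_cst].
- move=> n y; rewrite !normrM ler_wpM2l//.
  have [->|xy0] := eqVneq (x - y) 0; first by rewrite normr0 mul0r.
  rewrite [leRHS]normfV -(ler_pM2l (_ : 0 < `|x - y|)) ?normr_gt0// [leRHS]divff ?normr_eq0//.
  rewrite mulrA -expr2 real_normK ?num_real// normfV gtr0_norm ?poisson_den//.
  by rewrite ler_pdivrMr ?poisson_den// mul1r lerDr sqr_ge0.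
- exact: intble_norm.
have e1 n : \int[mu]_y (cas (x * y) * (expR (- (n.+1%:R^-1 * `|y|)) * (Num.sg y * F (- y)))) =
   2 * \int[mu]_y (f y * ((x - y) / (n.+1%:R^-1 ^+ 2 + (x - y) ^+ 2))).
  have e0' : 0 < n.+1%:R^-1 :> R by [].
  pose K0 y := expR (- (n.+1%:R^-1 * `|y|)) * (Num.sg y * cas (- (x * y))).
  have IK0 : intble K0.
    apply: (@intble_exp _ _ 2) => // [|y].
      apply: measurable_funM; first exact: meas_sgr.
      by under eq_fun do rewrite -mulNr; exact: meas_cas.
    by rewrite normrM -[leRHS]mul1r ler_pM// ?sgr_max ?cas_max.
  have LK0 : sqint K0.
    apply: (@bounded_sqint _ 2) => // y.
    rewrite normrM -[leRHS]mul1r ler_pM// ?expNnorm_le1//.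
    by rewrite normrM -[leRHS]mul1r ler_pM// ?sgr_max ?cas_max.
  have mI : meas (fun y => cas (x * y) * (expR (- (n.+1%:R^-1 * `|y|)) * (Num.sg y * F (- y)))).
    apply: measurable_funM; first exact: meas_cas.
    by apply: measurable_funM => //; exact: meas_expNnorm.
  rewrite -(int_opp mI).
  transitivity (- \int[mu]_y (F y * K0 y)).
    rewrite -intN; last by apply: sqint_mul.
    by apply: eq_int => y; rewrite /K0 normrN opprK sgrN mulrN; ring.
  rewrite (hart_mul hf IK0 LK0) -intN; last by apply: sqint_mul => //; exact: sqint_cint.
  rewrite -intZ.
    apply: eq_int => y; rewrite cint_exp_sgn// -[y - x]opprB sqrrN; ring.
  apply: (@eq_intble _ (fun y => - (2^-1) * (f y * cint K0 y))).
    move=> y; rewrite cint_exp_sgn// -[y - x]opprB sqrrN.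
    by move: (_ + (x - y) ^+ 2)^-1 => D; field.
  by apply: intbleZ; apply: sqint_mul => //; exact: sqint_cint.
have E : cint (fun y => Num.sg y * F (- y)) x = 2 * \int[mu]_y (f y / (x - y)).
  apply: (lim_unique h1); under eq_fun do rewrite e1.
  by apply: cvgM; [exact: cvg_cst|exact: h2].
rewrite /hilb E; move: (@pi_neq0 R) (\int[mu]_y _); move: (@pi R) => p p0 J.
by field.
Qed.

(* If the moment m of order k is the first one that does not vanish, then
   pi H f(x) = - m x^k + O(x^(k+1)), which contradicts vanishing to infinite order. *)
Lemma hilb_moments f F (d : R) : is_hart f F -> intble F -> 0 < d ->
  (forall y, `|y| < d -> f y = 0) ->
  (forall N : nat, (0 < N)%N -> exists c : R, \forall r \near (0 : R)^'+,
    (\int[mu]_(x in [set x | (`|x| <= r)%R]) (hilb F x ^+ 2)%:E <= (c * r ^+ N)%:E)%E) ->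
  forall k, \int[mu]_y (f y / y * y ^- k) = 0.
Proof.
move=> hf IF d0 fd hN; have [Lf LF _] := hf.
have fdm y : `|y| < d -> f y / y = 0 by move=> /fd ->; rewrite mul0r.
have Ig : intble (fun y => f y / y).
  apply: (@eq_intble _ (fun y => - (f y / (0 - y)))).
    by move=> y; rewrite sub0r invrN mulrN opprK.
  by apply/intbleN/(intble_div Lf d0 fd); rewrite normr0 add0r.
have Im k : intble (fun y => f y / y * y ^- k) by exact: (intble_moment k d0 fdm Ig).
pose m k := \int[mu]_y (f y / y * y ^- k).
pose rk k x y := f y / (x - y) * y ^- k.
have d2 : 0 < d / 2 by rewrite divr_gt0.
have xin (x : R) : `|x| <= d / 2 -> `|x| + d / 2 <= d by move=> h; rewrite [leRHS]splitr lerD2r.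
have rfd x y : `|y| < d -> f y / (x - y) = 0 by move=> /fd ->; rewrite mul0r.
have Irk k x : `|x| <= d / 2 -> intble (rk k x).
  move=> /xin xd; apply: (intble_moment k d0 (rfd x)).
  exact: intble_div Lf d2 fd xd.
(* One term of the geometric expansion: 1 / (x - y) = - 1/y + x / (y (x - y)). *)
have step k x : `|x| <= d / 2 -> \int[mu]_y rk k x y = - m k + x * \int[mu]_y rk k.+1 x y.
  move=> xd; rewrite -intZ ?Irk// -intN ?Im// -intD; [|exact/intbleN/Im|exact/intbleZ/Irk].
  apply: eq_int => y; rewrite /rk.
  have [yd|dy] := ltP `|y| d; first by rewrite fd// !mul0r mulr0 oppr0 add0r.
  have y0 : y != 0 by rewrite -normr_gt0 (lt_le_trans d0).
  have xy0 : x - y != 0.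
    apply: contraTneq dy => /eqP; rewrite subr_eq0 => /eqP <-.
    by rewrite -ltNge (le_lt_trans xd)// ltr_pdivrMr// ltr_pMr// ltr1n.
  rewrite exprS; field; rewrite y0 xy0 expf_neq0//.
(* The factor 2 reflects |x - y| >= |y| / 2, valid on the support of f because |x| <= d / 2 <= |y| /
   2. *)
have bnd k : exists B : R, forall x : R, `|x| <= d / 2 -> `|\int[mu]_y rk k x y| <= B.
  exists (\int[mu]_y (2 * `|f y / y * y ^- k|)) => x xd.
  apply: int_norm_le.
  - exact: intble_meas (Irk k x xd).
  - exact/intbleZ/intble_norm/Im.
  - move=> y; rewrite /rk; have [yd|dy] := ltP `|y| d.
      by rewrite fd// !mul0r normr0 mulr0.
    have y0 : 0 < `|y| by exact: lt_le_trans dy.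
    have hxy : `|y| / 2 <= `|x - y|.
      rewrite distrC; have := lerB_dist y x.
      by move: (`|y - x|) (`|x|) (`|y|) xd dy => a b c; lra.
    have xy0 : 0 < `|x - y| by apply: lt_le_trans hxy; rewrite divr_gt0.
    rewrite !normrM mulrA ler_wpM2r// mulrCA ler_wpM2l// !normfV.
    rewrite -[leLHS]mul1r ler_pdivrMr// mulrAC ler_pdivlMr// mul1r.
    by move: hxy; rewrite ler_pdivrMr// mulrC.
elim/ltn_ind => k IH.
have pik x : `|x| <= d / 2 -> pi * hilb F x = x ^+ k * \int[mu]_y rk k x y.
  move=> xd.
  have h0 : pi * hilb F x = \int[mu]_y rk 0%N x y.
    rewrite (hilb_kernel hf IF fd).
      by apply: eq_int => y; rewrite /rk expr0 invr1 mulr1.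
    by rewrite (le_lt_trans xd)// ltr_pdivrMr// ltr_pMr// ltr1n.
  suff H j : (j <= k)%N -> pi * hilb F x = x ^+ j * \int[mu]_y rk j x y by exact: H.
  elim: j => [|j IHj] jk; first by rewrite expr0 mul1r.
  by rewrite (IHj (ltnW jk)) step// /m (IH j jk) oppr0 add0r mulrA exprSr.
apply/eqP/negPn/negP => mk0.
have [B hB] := bnd k.+1.
have B0 : 0 <= B.
  by apply: (le_trans _ (hB 0 _)) => //; rewrite normr0 ltW.
(* For |x| <= r0 the remainder is at most |x| B <= |m k| / 2, so half of the leading term
   survives. *)
pose r0 := Num.min (d / 2) (`|m k| / (2 * (B + 1))).
have mk1 : 0 < `|m k| by rewrite normr_gt0.
have B1 : 0 < 2 * (B + 1) by rewrite mulr_gt0// ltr_wpDl.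
have r00 : 0 < r0 by rewrite lt_min d2 divr_gt0.
pose c0 := `|m k| / 2 / pi; have c00 : 0 < c0 by rewrite !divr_gt0// pi_gt0.
have low x : `|x| <= r0 -> c0 * `|x| ^+ k <= `|hilb F x|.
  rewrite le_min => /andP[xd xB].
  have xB' : `|x * \int[mu]_y rk k.+1 x y| <= `|m k| / 2.
    rewrite normrM; move: xB; rewrite ler_pdivlMr// => xB.
    have h1 := hB x xd; have x0 := normr_ge0 x.
    apply: (le_trans (ler_wpM2l x0 h1)).
    by move: (`|x|) (`|m k|) x0 xB => a b; nra.
  have hR : `|m k| / 2 <= `|\int[mu]_y rk k x y|.
    rewrite step//; have := ler_normB (- m k + x * \int[mu]_y rk k.+1 x y) (x * \int[mu]_y rk k.+1 x y).
    rewrite addrK normrN => h.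
    by rewrite -(lerD2r (`|m k| / 2)) -splitr (le_trans h)// lerD2l.
  rewrite -(ler_pM2l (pi_gt0 R)).
  have -> : pi * `|hilb F x| = `|x| ^+ k * `|\int[mu]_y rk k x y|.
    by rewrite -normrX -normrM -pik// [RHS]normrM (gtr0_norm (pi_gt0 R)).
  rewrite mulrA [leLHS]mulrC ler_wpM2l ?exprn_ge0//.
  by rewrite /c0 mulrC divfK// pi_neq0.
(* On [r/2, r], an interval of length r/2, the square of [hilb F] is at least (c0 (r/2)^k)^2, which
   integrates to c1 r^(2k+1). Order 2k + 2 in the hypothesis leaves c1 <= c r, impossible as r ->
   0. *)
have [c hc] := hN (k * 2).+2 isT.
pose c1 := (c0 * (2^-1) ^+ k) ^+ 2 / 2.
have c10 : 0 < c1 by rewrite divr_gt0// exprn_gt0// mulr_gt0// exprn_gt0.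
have hr : \forall r \near (0 : R)^'+, c1 <= c * r.
  near=> r.
  have rp : 0 < r by near: r; exact: nbhs_right_gt.
  have rr0 : r <= r0 by near: r; exact: nbhs_right_le.
  have hcr : (\int[mu]_(x in [set x | (`|x| <= r)%R]) (hilb F x ^+ 2)%:E <= (c * r ^+ (k * 2).+2)%:E)%E.
    by near: r; exact: hc.
  have : ((c1 * r ^+ (k * 2).+1)%:E <= (c * r ^+ (k * 2).+2)%:E)%E.
    apply: le_trans hcr.
    have mh : meas (hilb F) by exact: continuous_meas (continuous_hilb IF).
    have mset : measurable [set x : R | (`|x| <= r)%R].
      rewrite (_ : [set x : R | (`|x| <= r)%R] = `[- r, r]%classic)//.
      by apply/seteqP; split => x /=; rewrite in_itv /= ler_norml.
    apply: (@le_trans _ _ (\int[mu]_(x in `[(r / 2)%R, r]) (hilb F x ^+ 2)%:E)%E); last first.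
      apply: ge0_subset_integral => //.
      - by apply/measurable_EFinP; apply: measurable_funX; exact: measurable_funS mh.
      - by move=> x _; rewrite lee_fin sqr_ge0.
      - by move=> x /=; rewrite in_itv /= ler_norml => /andP[rx ->]; lra.
    apply: (@le_trans _ _ (\int[mu]_(x in `[(r / 2)%R, r]) ((c0 * (r / 2) ^+ k) ^+ 2)%:E)%E).
      rewrite integral_cst//= lebesgue_measure_itv /= lte_fin.
      have -> : r / 2 < r by rewrite ltr_pdivrMr// ltr_pMr// ltr1n.
      rewrite -EFinB -EFinM lee_fin; apply: le_of_eq.
      rewrite /c1 [r ^+ _]exprS exprM [(r / 2) ^+ k]exprMn.
      by move: (c0 : R) (2^-1 ^+ k) (r ^+ k) => a b p; field.
    apply: ge0_le_integral => //.
    - by move=> x _; rewrite lee_fin sqr_ge0.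
    - by apply/measurable_EFinP; apply: measurable_funX; exact: measurable_funS mh.
    - move=> x; rewrite /= in_itv /= => /andP[rx xr].
      have x0 : 0 < x by apply: lt_le_trans rx; rewrite divr_gt0.
      rewrite lee_fin -[leRHS]real_normK ?num_real// lerXn2r ?nnegrE//.
        by rewrite mulr_ge0 ?(ltW c00)// exprn_ge0// divr_ge0 ?ltW.
      apply: (le_trans _ (low x _)); last by rewrite gtr0_norm// (le_trans xr).
      by rewrite ler_wpM2l ?(ltW c00)// gtr0_norm// lerXn2r// nnegrE ?divr_ge0 ?ltW.
  rewrite lee_fin [r ^+ _.+2]exprS mulrA -ler_pdivlMr ?exprn_gt0//.
  by rewrite mulfK// gt_eqF// exprn_gt0.
have lim0 : c * r @[r --> (0 : R)^'+] --> 0.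
  apply: cvg0Z; apply: cvg_at_right_filter; exact: cvg_id.
move: c10; rewrite ltNge => /negP; apply.
rewrite -(cvg_lim _ lim0)//; apply: limr_ge => //.
by apply/cvg_ex; eexists; exact: lim0.
Unshelve. all: by end_near. Qed.

(** [moments_eq0] is applied to f(y) / y, which is integrable although f is only known to be square
    integrable; the point 0 is covered by the local vanishing of f. *)
Lemma unique_continuation f F (d : R) : is_hart f F -> intble F -> 0 < d ->
  continuous f -> (forall y, `|y| < d -> f y = 0) ->
  (forall N : nat, (0 < N)%N -> exists c : R, \forall r \near (0 : R)^'+,
    (\int[mu]_(x in [set x | (`|x| <= r)%R]) (hilb F x ^+ 2)%:E <= (c * r ^+ N)%:E)%E) ->
  forall x, f x = 0.
Proof.
move=> hf IF d0 cf fd hN x; have [Lf _ _] := hf.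
have mom := hilb_moments hf IF d0 fd hN.
have Ig : intble (fun y => f y / y).
  apply: (@eq_intble _ (fun y => - (f y / (0 - y)))).
    by move=> y; rewrite sub0r invrN mulrN opprK.
  by apply/intbleN/(intble_div Lf d0 fd); rewrite normr0 add0r.
have [->|x0] := eqVneq x 0; first by rewrite fd// normr0.
have gd y : `|y| < d -> f y / y = 0 by move=> /fd ->; rewrite mul0r.
have cg y : y != 0 -> {for y, continuous (fun y => f y / y)}.
  by move=> y0; apply: cvgM; [exact: cf|exact: cvgV].
have /eqP := moments_eq0 d0 gd Ig mom cg x.
by rewrite mulf_eq0 invr_eq0 (negbTE x0) orbF => /eqP.
Qed.

End unique_continuation.

(** * Fourier and Hartley transforms *)

Section complex_transforms.
Set Implicit Arguments.
Unset Strict Implicit.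
Context {R : realType}.
Local Open Scope complex_scope.
Local Notation mu := (@lebesgue_measure R).
Local Notation meas f := (measurable_fun setT (f : R -> R)).
Local Notation Re := complex.Re.
Local Notation Im := complex.Im.
Implicit Types (f g h F K : R -> R) (G : R -> R[i]) (A : set R).

Lemma sqintP f : (f \in Lfun mu 2%:E) <-> sqint f.
Proof.
split=> [fL|[mf If]].
  have mf : meas f by move: fL; rewrite inE => /andP[]; rewrite inE.
  have h := Lfun2_integrable_sqr fL; split; first exact: mf.
  exact: h.
rewrite inE; apply/andP; split; first by rewrite inE.
rewrite inE /finite_norm unlock /=; apply: poweR_lty.
under eq_integral do rewrite powR_mulrn//= real_normK ?num_real//.
by rewrite integral_int// ltry.
Qed.

Lemma L2P G : L2 G <-> sqint (fun x => Re (G x)) /\ sqint (fun x => Im (G x)).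
Proof. by rewrite /L2 !sqintP. Qed.

Lemma L2normE G : sqint (fun x => Re (G x)) -> sqint (fun x => Im (G x)) ->
  L2norm G = (Num.sqrt (\int[mu]_x Re (G x) ^+ 2 + \int[mu]_x Im (G x) ^+ 2))%:E.
Proof.
move=> [_ I1] [_ I2]; rewrite /L2norm unlock /=.
have -> : (\int[mu]_x (`|Normc.normc (G x)|%:E `^ 2) =
    (\int[mu]_x Re (G x) ^+ 2 + \int[mu]_x Im (G x) ^+ 2)%:E)%E.
  rewrite -intD// -integral_int; last exact: intbleD.
  apply: eq_integral => x _; rewrite poweR_EFin powR_mulrn//; congr EFin.
  rewrite real_normK ?num_real//; case: (G x) => a b /=.
  by rewrite sqr_sqrtr// addr_ge0 ?sqr_ge0.
by rewrite poweR_EFin powR12_sqrt// addr_ge0 ?int_sqr_ge0.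
Qed.

Lemma L2norm_fin G : meas (fun x => Re (G x)) -> meas (fun x => Im (G x)) ->
  (L2norm G < +oo)%E -> sqint (fun x => Re (G x)) /\ sqint (fun x => Im (G x)).
Proof.
move=> m1 m2 fin.
have := @poweR_Lnorm _ _ _ mu (fun x => (Normc.normc (G x))%:E) 2 (ltac:(by [])).
have : (L2norm G `^ 2 < +oo)%E by exact: poweR_lty.
rewrite /L2norm => + e; rewrite e.
have -> : (\int[mu]_x (`|(Normc.normc (G x))%:E| `^ 2) =
    \int[mu]_x (Re (G x) ^+ 2 + Im (G x) ^+ 2)%:E)%E.
  apply: eq_integral => x _; rewrite poweR_EFin powR_mulrn//; congr EFin.
  rewrite real_normK ?num_real//; case: (G x) => a b /=.
  by rewrite sqr_sqrtr// addr_ge0 ?sqr_ge0.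
move=> fi.
have IS : intble (fun x => Re (G x) ^+ 2 + Im (G x) ^+ 2).
  apply/integrableP; split.
    by apply/measurable_EFinP; apply: measurable_funD; exact: measurable_funX.
  by under eq_integral do rewrite /= ger0_norm ?addr_ge0 ?sqr_ge0//.
split; split => //; apply: intble_le IS; try exact: measurable_funX.
- by move=> x; rewrite ger0_norm ?sqr_ge0// lerDl sqr_ge0.
- by move=> x; rewrite ger0_norm ?sqr_ge0// lerDr sqr_ge0.
Qed.

Lemma L2norm_cvg0 (T : Type) (D : set_system T) {FD : Filter D} (u : T -> R -> R[i]) :
  (forall t, sqint (fun x => Re (u t x)) /\ sqint (fun x => Im (u t x))) ->
  (L2norm (u t) @[t --> D] --> 0%E) <->
  ((\int[mu]_x Re (u t x) ^+ 2 + \int[mu]_x Im (u t x) ^+ 2) @[t --> D] --> 0).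
Proof.
move=> Lu; have E t := L2normE (Lu t).1 (Lu t).2.
under eq_fun do rewrite E.
split=> [/fine_cvgP[_ h]|h].
- apply: (@cvg_to_eq _ _ _ _ (0 * 0)); first by rewrite mulr0.
  rewrite (_ : (fun t => _) = (fun t =>
    Num.sqrt (\int[mu]_x Re (u t x) ^+ 2 + \int[mu]_x Im (u t x) ^+ 2) *
    Num.sqrt (\int[mu]_x Re (u t x) ^+ 2 + \int[mu]_x Im (u t x) ^+ 2))).
    exact: (cvgM h h).
  by apply/funext => t; rewrite -expr2 sqr_sqrtr// addr_ge0 ?int_sqr_ge0.
- apply: cvg_EFin; first exact: nearW.
  by have := cvg_comp _ _ h (@sqrt_continuous R 0); rewrite sqrtr0.
Qed.

Definition evn F (x : R) := (F x + F (- x)) / 2.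
Definition odf F (x : R) := (F x - F (- x)) / 2.

Lemma sqint_evn F : sqint F -> sqint (evn F).
Proof.
move=> LF; have := sqintZ (2^-1) (sqintD LF (sqint_opp LF)); congr sqint.
by apply/funext => x; rewrite /evn mulrC.
Qed.

Lemma sqint_odf F : sqint F -> sqint (odf F).
Proof.
move=> LF; have := sqintZ (2^-1) (sqintB LF (sqint_opp LF)); congr sqint.
by apply/funext => x; rewrite /odf mulrC.
Qed.

Lemma evn_odf_sqr F : sqint F ->
  \int[mu]_x evn F x ^+ 2 + \int[mu]_x odf F x ^+ 2 = \int[mu]_x F x ^+ 2.
Proof.
move=> LF; have [mF I2] := LF; have [mN IN] := sqint_opp LF.
rewrite -intD; [|by case: (sqint_evn LF)|by case: (sqint_odf LF)].
transitivity (\int[mu]_x (2^-1 * F x ^+ 2 + 2^-1 * F (- x) ^+ 2)).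
  by apply: eq_int => x; rewrite /evn /odf; field.
rewrite intD; [|exact: intbleZ|exact: intbleZ].
rewrite !intZ// (int_opp (f := fun x => F x ^+ 2)); last exact: measurable_funX.
by field.
Qed.

Lemma Re_scale (a : R) (z : R[i]) : Re (a%:C * z) = a * Re z.
Proof. by case: z => x y /=; rewrite mul0r subr0. Qed.

Lemma Im_scale (a : R) (z : R[i]) : Im (a%:C * z) = a * Im z.
Proof. by case: z => x y /=; rewrite mul0r addr0. Qed.

Lemma fourier_trunc n f (xi : R) : sqint f ->
  cintegral `[- n%:R, n%:R] (fun x => expi (- (xi * x)) * (f x)%:C) =
  evn (cint (trunc n f)) xi -i* odf (cint (trunc n f)) xi.
Proof.
move=> Lf; have It := intble_trunc n Lf.
have Ic := intble_cas xi It; have Ic' := intble_cas (- xi) It.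
have -> : evn (cint (trunc n f)) xi = \int[mu]_y (2^-1 *
    (cas (xi * y) * trunc n f y + cas (- xi * y) * trunc n f y)).
  by rewrite intZ ?intD//; [rewrite mulrC|exact: intbleD].
have -> : odf (cint (trunc n f)) xi = \int[mu]_y (2^-1 *
    (cas (xi * y) * trunc n f y - cas (- xi * y) * trunc n f y)).
  by rewrite intZ ?intB//; [rewrite mulrC|exact: intbleB].
rewrite -intN; last by apply: intbleZ; exact: intbleB.
rewrite /cintegral; congr Complex; rewrite Rintegral_mkcond; apply: eq_int => x.
- rewrite !truncE patchE mem_setE in_itv /= -ler_norml.
  case: ifP => _; last by rewrite !mulr0 addr0 mulr0.
  by rewrite mulr0 subr0 /cas mulNr cosN sinN; field.
- rewrite !truncE patchE mem_setE in_itv /= -ler_norml.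
  case: ifP => _; last by rewrite !mulr0 subr0 mulr0 oppr0.
  by rewrite mulr0 add0r /cas mulNr cosN sinN; field.
Qed.

Lemma fourier_is_hart f G : is_fourier (fun x => (f x)%:C) G ->
  is_hart f (fun x => Re (G x) - Im (G x)).
Proof.
move=> [/L2P[/= Lf _] /L2P[LR LI] h].
have Lt n := sqint_cint_trunc n Lf.
split => //; first exact: sqintB.
have E n x : G x - cintegral `[- n%:R, n%:R] (fun y => expi (- (x * y)) * (f y)%:C) =
    (Re (G x) - evn (cint (trunc n f)) x) +i* (Im (G x) + odf (cint (trunc n f)) x).
  by rewrite fourier_trunc//; apply/eqP; case: (G x) => a b; rewrite eq_complex /= opprK !eqxx.
move: h; under eq_fun => n do (under eq_fun => x do rewrite E).
move/(L2norm_cvg0 (u := fun n x => (Re (G x) - evn (cint (trunc n f)) x) +i* (Im (G x) + odf (cint (trunc n f)) x))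
  (fun n => conj (sqintB LR (sqint_evn (Lt n))) (sqintD LI (sqint_odf (Lt n))))).1 => /= h.
apply: (squeeze_cvg0 _ (cvg0Z 2 h)); near=> n; rewrite int_sqr_ge0 /=.
have := int_sqrD_le (sqintB LR (sqint_evn (Lt n))) (sqintN (sqintD LI (sqint_odf (Lt n)))).
rewrite mulrDr => le1; apply: (le_trans (le_of_eq _) (le_trans le1 (le_of_eq _))).
  by apply: eq_int => x; rewrite /evn /odf; congr (_ ^+ 2); field.
by congr (_ + _ * _); apply: eq_int => x; rewrite sqrrN.
Unshelve. all: by end_near. Qed.

Lemma hart_is_fourier f F : is_hart f F ->
  is_fourier (fun x => (f x)%:C) (fun x => evn F x -i* odf F x).
Proof.
move=> [Lf LF h]; have Lt n := sqint_cint_trunc n Lf.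
split.
- apply/L2P; split => //=; apply: (@bounded_sqint _ 0); first exact: intble0.
  by move=> x; rewrite normr0.
- by apply/L2P; split => /=; [exact: sqint_evn|exact/sqintN/sqint_odf].
have LD n := sqintB LF (Lt n).
have E n x : (evn F x -i* odf F x) - cintegral `[- n%:R, n%:R] (fun y => expi (- (x * y)) * (f y)%:C) =
    evn (fun x => F x - cint (trunc n f) x) x -i* odf (fun x => F x - cint (trunc n f) x) x.
  rewrite fourier_trunc//; apply/eqP; rewrite eq_complex /=.
  by apply/andP; split; apply/eqP; rewrite /evn /odf; field.
under eq_fun => n do (under eq_fun => x do rewrite E).
apply/L2norm_cvg0 => [n|] /=.
  by split; [exact: sqint_evn|exact/sqintN/sqint_odf].
apply: cvg_trans h; apply: near_eq_cvg; near=> n.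
rewrite -(evn_odf_sqr (LD n)); congr (_ + _).
by apply: eq_int => x; rewrite sqrrN.
Unshelve. all: by end_near. Qed.

(** The existence of some transform keeps [xget] from returning its default value. *)
Lemma is_fourier_fourier f F : is_hart f F ->
  is_fourier (fun x => (f x)%:C) (fourier (fun x => (f x)%:C)).
Proof. by move=> /hart_is_fourier h; apply: xgetPex; eexists; exact: h. Qed.

Lemma L2norm_lim_unique (u : nat -> R -> R[i]) G H :
  (forall n, sqint (fun x => Re (u n x)) /\ sqint (fun x => Im (u n x))) ->
  L2 G -> L2 H ->
  L2norm (fun x => G x - u n x) @[n --> \oo] --> 0%E ->
  L2norm (fun x => H x - u n x) @[n --> \oo] --> 0%E ->
  {ae mu, forall x, Re (G x) = Re (H x)} /\ {ae mu, forall x, Im (G x) = Im (H x)}.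
Proof.
move=> Lu LG LH hG hH.
have ReB (z w : R[i]) : Re (z - w) = Re z - Re w by case: z w => ? ? [].
have ImB (z w : R[i]) : Im (z - w) = Im z - Im w by case: z w => ? ? [].
have key J : L2 J -> L2norm (fun x => J x - u n x) @[n --> \oo] --> 0%E ->
    (\int[mu]_x (Re (J x) - Re (u n x)) ^+ 2) @[n --> \oo] --> 0 /\
    (\int[mu]_x (Im (J x) - Im (u n x)) ^+ 2) @[n --> \oo] --> 0.
  move=> /L2P[JR JI] h.
  have Lw n : sqint (fun x => Re (J x - u n x)) /\ sqint (fun x => Im (J x - u n x)).
    split.
    - by rewrite (_ : (fun x => _) = (fun x => Re (J x) - Re (u n x)));
        [exact: (sqintB JR (Lu n).1)|apply/funext => x; exact: ReB].
    - by rewrite (_ : (fun x => _) = (fun x => Im (J x) - Im (u n x)));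
        [exact: (sqintB JI (Lu n).2)|apply/funext => x; exact: ImB].
  have {}h : (\int[mu]_x Re (J x - u n x) ^+ 2 + \int[mu]_x Im (J x - u n x) ^+ 2) @[n --> \oo] --> 0.
    by apply/(L2norm_cvg0 Lw).
  split.
  - apply: (squeeze_cvg0 _ h); near=> n; rewrite int_sqr_ge0 /=.
    rewrite (eq_int (g := fun x => Re (J x - u n x) ^+ 2)); first by rewrite lerDl int_sqr_ge0.
    by move=> x; rewrite ReB.
  - apply: (squeeze_cvg0 _ h); near=> n; rewrite int_sqr_ge0 /=.
    rewrite (eq_int (g := fun x => Im (J x - u n x) ^+ 2)); first by rewrite lerDr int_sqr_ge0.
    by move=> x; rewrite ImB.
have [G1 G2] := key _ LG hG; have [H1 H2] := key _ LH hH.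
have [[RG IG] [RH IH]] := ((L2P _).1 LG, (L2P _).1 LH).
by split; [exact: (sqr_lim_unique (fun n => (Lu n).1) RG RH G1 H1)
          |exact: (sqr_lim_unique (fun n => (Lu n).2) IG IH G2 H2)].
Unshelve. all: by end_near. Qed.

Lemma hart_fourierE f F G : is_hart f F -> is_fourier (fun x => (f x)%:C) G ->
  {ae mu, forall x, Re (G x) = evn F x} /\ {ae mu, forall x, Im (G x) = - odf F x}.
Proof.
move=> hF [_ LG hG]; have [_ LH hH] := hart_is_fourier hF; have [Lf _ _] := hF.
apply: (L2norm_lim_unique _ LG LH hG hH) => n.
have Lt := sqint_cint_trunc n Lf; split.
- rewrite (_ : (fun x => _) = evn (cint (trunc n f))); first exact: sqint_evn.
  by apply/funext => x; rewrite fourier_trunc.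
- rewrite (_ : (fun x => _) = (fun x => - odf (cint (trunc n f)) x)).
    exact/sqintN/sqint_odf.
  by apply/funext => x; rewrite fourier_trunc.
Qed.

(** Parity turns the complex multiplier into the real kernel cas. The transform G is a
    representative chosen by [xget], so it is replaced by the even and odd parts of F under the
    integral, almost everywhere. *)
Lemma hilbert_trunc n F G (x : R) : sqint F ->
  sqint (fun y => Re (G y)) -> sqint (fun y => Im (G y)) ->
  {ae mu, forall y, Re (G y) = evn F y} -> {ae mu, forall y, Im (G y) = - odf F y} ->
  cintegral `[- n%:R, n%:R] (fun y => ((2 * pi)^-1)%:C * expi (y * x) *
    ((0 -i* Num.sg y) * G y)) =
  ((2 * pi)^-1 * cint (trunc n (fun y => Num.sg y * F (- y))) x)%:C.
Proof.
move=> LF LR LI aR aI.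
have Lsg f : sqint f -> sqint (fun y => Num.sg y * f y).
  by move=> Lf; apply: (sqintMb (M := 1)); [exact: meas_sgr|exact: sgr_max|].
have It f : sqint f -> intble (trunc n (fun y => Num.sg y * f y)).
  by move=> Lf; apply: intble_trunc; exact: Lsg.
have Ic f : sqint f -> intble (fun y => cos (x * y) * trunc n (fun y => Num.sg y * f y) y).
  move=> Lf; apply: (intbleMb (M := 1)); [exact: meas_cos| |exact: It].
  by move=> y; rewrite ler_norml cos_geN1 cos_le1.
have Is f : sqint f -> intble (fun y => sin (x * y) * trunc n (fun y => Num.sg y * f y) y).
  move=> Lf; apply: (intbleMb (M := 1)); [exact: meas_sin| |exact: It].
  by move=> y; rewrite ler_norml sin_geN1 sin_le1.
have LE := sqint_evn LF; have LO := sqintN (sqint_odf LF).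
have I1 := intbleD (Ic _ LO) (Is _ LE).
have I2 := intbleD (Is _ LO) (intbleN (Ic _ LE)).
have tr_ae f g : {ae mu, forall y, f y = g y} ->
    {ae mu, forall y, trunc n (fun y => Num.sg y * f y) y = trunc n (fun y => Num.sg y * g y) y}.
  by move=> h; apply: (ae_imp h) => y e; rewrite !truncE e.
have IB : intble (fun y => cas (x * y) * trunc n (fun y => Num.sg y * F (- y)) y).
  by apply: intble_cas; apply: It; exact: sqint_opp.
rewrite /cintegral; congr Complex; rewrite Rintegral_mkcond.
- transitivity (\int[mu]_y ((2 * pi)^-1 * (cos (x * y) * trunc n (fun y => Num.sg y * Im (G y)) y
      + sin (x * y) * trunc n (fun y => Num.sg y * Re (G y)) y))).
    apply: eq_int => y; rewrite !truncE patchE mem_setE in_itv /= -ler_norml.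
    case: ifP => _; last by rewrite !mulr0 addr0 mulr0.
    by case: (G y) => a b /=; rewrite (mulrC y x); ring.
  rewrite intZ; last exact: intbleD (Ic _ LI) (Is _ LR).
  congr (_ * _).
  transitivity (\int[mu]_y (cos (x * y) * trunc n (fun y => Num.sg y * - odf F y) y
      + sin (x * y) * trunc n (fun y => Num.sg y * evn F y) y)).
    apply: ae_int; [exact: (intble_meas (intbleD (Ic _ LI) (Is _ LR)))|exact: (intble_meas I1)|].
    by apply: (ae_imp2 (tr_ae _ _ aR) (tr_ae _ _ aI)) => y -> ->.
  (* The two integrands differ by sg(y) (sin(x y) [odf F y] - cos(x y) [evn F y]) on the truncation
     interval, which is odd in y. *)
  apply/eqP; rewrite -subr_eq0 /cint -intB//; apply/eqP; apply: int_odd.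
    exact: (intble_meas (intbleB I1 IB)).
  move=> y; rewrite !truncE normrN; case: ifP => _; last by rewrite !mulr0 subr0 addr0 oppr0.
  by rewrite /cas /evn /odf sgrN !mulrN cosN sinN opprK; field.
- transitivity (\int[mu]_y ((2 * pi)^-1 * (sin (x * y) * trunc n (fun y => Num.sg y * Im (G y)) y
      - cos (x * y) * trunc n (fun y => Num.sg y * Re (G y)) y))).
    apply: eq_int => y; rewrite !truncE patchE mem_setE in_itv /= -ler_norml.
    case: ifP => _; last by rewrite !mulr0 subr0 mulr0.
    by case: (G y) => a b /=; rewrite (mulrC y x); ring.
  rewrite intZ; last exact: intbleB (Is _ LI) (Ic _ LR).
  rewrite -[RHS](mulr0 (2 * pi)^-1); congr (_ * _).
  transitivity (\int[mu]_y (sin (x * y) * trunc n (fun y => Num.sg y * - odf F y) y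
      - cos (x * y) * trunc n (fun y => Num.sg y * evn F y) y)).
    apply: ae_int; [exact: (intble_meas (intbleB (Is _ LI) (Ic _ LR)))|exact: (intble_meas I2)|].
    by apply: (ae_imp2 (tr_ae _ _ aR) (tr_ae _ _ aI)) => y -> ->.
  apply: int_odd; first exact: (intble_meas I2).
  move=> y; rewrite !truncE normrN; case: ifP => _; last by rewrite !mulr0 subr0 oppr0.
  by rewrite /evn /odf sgrN !mulrN cosN sinN opprK; field.
Qed.

(** By [cvg_cint_trunc], [hilb F] is an admissible inverse transform. Hence the [xget] in [hilbert]
    does not return its default, and uniqueness of L^2 limits identifies the chosen representative
    up to a null set. *)
Lemma hilbert_hilb f F : is_hart f F -> intble F ->
  {ae mu, forall x, hilbert f x = hilb F x}.
Proof.
move=> hF IF; have [Lf LF _] := hF.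
have hG := is_fourier_fourier hF; have [GR GI] := hart_fourierE hF hG.
have [_ /L2P[LR LI] _] := hG.
set G := fourier _ in hG GR GI LR LI *.
set W := fun xi => (0 -i* Num.sg xi) * G xi.
have IK : intble (fun y => Num.sg y * F (- y)) by exact: intble_sgr.
have LK : sqint (fun y => Num.sg y * F (- y)).
  by apply: (sqintMb (M := 1)); [exact: meas_sgr|exact: sgr_max|exact: sqint_opp].
have LW : L2 W.
  apply/L2P; split.
  - rewrite (_ : (fun x => _) = (fun x => Num.sg x * Im (G x))).
      by apply: (sqintMb (M := 1)); [exact: meas_sgr|exact: sgr_max|].
    by apply/funext => x; rewrite /W; case: (G x) => a b /=; ring.
  - rewrite (_ : (fun x => _) = (fun x => - (Num.sg x * Re (G x)))).
      by apply: sqintN; apply: (sqintMb (M := 1)); [exact: meas_sgr|exact: sgr_max|].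
    by apply/funext => x; rewrite /W; case: (G x) => a b /=; ring.
have L0 : sqint (fun=> 0 : R).
  by apply: (@bounded_sqint _ 0); [exact: intble0|move=> x; rewrite normr0].
have Lh : L2 (fun x => (hilb F x)%:C).
  by apply/L2P; split; [apply: sqintZ; exact: sqint_cint|exact: L0].
pose c := ((2 * pi)^-1 : R).
pose u n x : R[i] := (c * cint (trunc n (fun y => Num.sg y * F (- y))) x)%:C.
have Tn n x : cintegral `[- n%:R, n%:R] (fun y => ((2 * pi)^-1)%:C * expi (y * x) * W y) = u n x.
  exact: hilbert_trunc.
have Lu n : sqint (fun x => Re (u n x)) /\ sqint (fun x => Im (u n x)).
  by split; [apply: sqintZ; exact: sqint_cint_trunc|exact: L0].
have hc : L2norm (fun x => (hilb F x)%:C - u n x) @[n --> \oo] --> 0%E.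
  have Lw n : sqint (fun x => Re ((hilb F x)%:C - u n x)) /\ sqint (fun x => Im ((hilb F x)%:C - u n x)).
    split=> /=; last by rewrite subrr.
    by apply: sqintB; [apply: sqintZ; exact: sqint_cint|exact: (Lu n).1].
  apply/(L2norm_cvg0 Lw); apply: (cvg_trans _ (cvg0Z (c ^+ 2) (cvg_cint_trunc IK LK))).
  apply: near_eq_cvg; near=> n => /=.
  rewrite -intZ; last by case: (sqintB (sqint_cint IK LK) (sqint_cint_trunc n LK)).
  rewrite (_ : \int[mu]_x ((0 - 0) ^+ 2) = 0) ?addr0; last first.
    by apply: int_odd => [|x]; [exact: measurable_cst|rewrite subrr expr0n oppr0].
  by apply: eq_int => x; rewrite /hilb -/c -mulrBr exprMn.
have ex : exists g : R -> R[i], is_inv_fourier W g.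
  exists (fun x => (hilb F x)%:C); split => //.
  by under eq_fun => n do under eq_fun => x do rewrite Tn.
have [_ LV hV] := xgetPex (fun=> 0) ex.
move: hV; under eq_fun => n do under eq_fun => x do rewrite Tn.
by move=> hV; have [+ _] := L2norm_lim_unique Lu LV Lh hV hc.
Unshelve. all: by end_near. Qed.

End complex_transforms.

(** * Sobolev functions *)

Section sobolev_profiles.
Set Implicit Arguments.
Unset Strict Implicit.
Context {R : realType}.
Local Open Scope complex_scope.
Local Notation mu := (@lebesgue_measure R).
Local Notation meas f := (measurable_fun setT (f : R -> R)).
Local Notation Re := complex.Re.
Local Notation Im := complex.Im.
Implicit Types (f g h F G K : R -> R) (b s : R).

Lemma cvgy_powRN (c : R) : 0 < c -> (1 + x) `^ (- c) @[x --> +oo%R] --> (0 : R).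
Proof.
move=> c0; apply/cvgr0Pnorm_le => e e0; near=> x.
have x0 : 0 < x by near: x; exact: nbhs_pinfty_gt.
have x1 : 0 < 1 + x by rewrite addr_gt0.
rewrite ger0_norm ?powR_ge0// powRN -[leRHS]invrK lef_pV2 ?posrE ?invr_gt0 ?powR_gt0//.
have -> : e^-1 = ((e^-1) `^ c^-1) `^ c.
  by rewrite -powRrM mulVf ?lt0r_neq0// powRr1// invr_ge0 ltW.
apply: ge0_ler_powR; rewrite ?nnegrE ?powR_ge0 ?(ltW c0) ?(ltW x1)//.
apply: (@le_trans _ _ x); last by rewrite lerDr.
by near: x; apply: nbhs_pinfty_ge; rewrite num_real.
Unshelve. all: by end_near. Qed.

Lemma meas_bracket b : meas (fun x : R => (1 + x ^+ 2) `^ b).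
Proof.
apply: (measurableT_comp (measurable_powR b)); apply: measurable_funD => //.
Qed.

Lemma bracket_gt0 (x : R) : 0 < 1 + x ^+ 2.
Proof. by rewrite ltr_pwDl// sqr_ge0. Qed.

Lemma bracket_ge1 b (x : R) : 0 <= b -> 1 <= (1 + x ^+ 2) `^ b.
Proof.
move=> b0; have : 1 <= 1 + x ^+ 2 by rewrite lerDl sqr_ge0.
by move=> /ler_powR/(_ _ _ b0); rewrite powRr0.
Qed.

(** Comparison with (1 + |x|)^(-2b), by (1 + |x|)^2 <= 2 (1 + x^2); on the half-line that function
    has the explicit primitive - (1 + x)^(-c) / c with c = 2 b - 1 > 0. *)
Lemma intble_bracket b : 1 / 2 < b -> intble (fun x : R => (1 + x ^+ 2) `^ (- b)).
Proof.
move=> b12; pose c := 2 * b - 1; have c0 : 0 < c by rewrite /c; lra.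
have b0 : 0 <= b by lra.
pose phi (x : R) := (1 + `|x|) `^ (- (2 * b)).
have p0 (x : R) : 0 < 1 + `|x| by rewrite ltr_pwDl.
have dpow (r x : R) : 0 < 1 + x -> is_derive x 1 (fun x => (1 + x) `^ r) (r * (1 + x) `^ (r - 1)).
  move=> x0.
  have h1 : is_derive x 1 (fun x : R => 1 + x) 1.
    have := @is_deriveD _ _ _ (cst 1 : R -> R) id x 1 0 1 (is_derive_cst _ _ _) (is_derive_id _ _).
    by rewrite add0r.
  have h2 : is_derive ((fun x : R => 1 + x) x) 1 (fun y : R => y `^ r) (r * (1 + x) `^ (r - 1)).
    exact: is_derive1_powR.
  have h3 := @is_derive1_comp _ (fun y : R => y `^ r) (fun x : R => 1 + x) x _ _ h2 h1.
  by move: h3; rewrite mulr1.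
have cphi : continuous phi.
  move=> x; apply: (@cvg_comp _ _ _ (fun x : R => `|x|) (fun x => (1 + x) `^ (- (2 * b)))).
    exact: (@norm_continuous _ R^o).
  exact: (is_derive_continuous (dpow _ _ (p0 x))).
have [||||||Iphi _] := @int_even_ge0 _ phi (fun x => - c^-1 * (1 + x) `^ (- c)) (- c^-1 * 0).
- exact: cphi.
- by move=> x; exact: powR_ge0.
- by move=> x; rewrite /phi normrN.
- move=> x x0; have h := dpow (- c) x (addr_gt0 ltr01 x0).
  have := is_deriveZ (- c^-1) h.
  congr is_derive; rewrite /GRing.scale /= mulrA mulrNN mulVf ?gt_eqF// mul1r /phi.
  by rewrite ger0_norm ?ltW//; congr (_ `^ _); rewrite /c; ring.
- have h : is_derive (0 : R) 1 (fun x => (1 + x) `^ (- c)) (- c * (1 + 0) `^ (- c - 1)).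
    by apply: dpow; rewrite addr0.
  by apply: cvgM; [exact: cvg_cst|exact: (is_derive_continuous h)].
- by apply: cvgM; [exact: cvg_cst|exact: cvgy_powRN].
apply: (@intble_le _ _ (fun x => 2 `^ b * phi x)); last exact: intbleZ.
  exact: meas_bracket.
move=> x; rewrite ger0_norm ?powR_ge0// /phi !powRN.
rewrite ler_pdivlMr ?powR_gt0// mulrC ler_pdivrMr ?powR_gt0 ?bracket_gt0//.
have -> : (1 + `|x|) `^ (2 * b) = ((1 + `|x|) ^+ 2) `^ b.
  by rewrite powRrM powR_mulrn// ltW.
rewrite -powRM//; last exact: ltW (bracket_gt0 x).
apply: ge0_ler_powR; rewrite ?nnegrE ?sqr_ge0//.
  by rewrite mulr_ge0// (ltW (bracket_gt0 x)).
rewrite -[in leRHS](real_normK (num_real x)); have := sqr_ge0 (1 - `|x|); nra.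
Unshelve. all: by end_near. Qed.

Lemma bracket_exp k s (x : R) : (x ^+ k) ^+ 2 <= (1 + x ^+ 2) `^ s * (1 + x ^+ 2) `^ (- (s - k%:R)).
Proof.
have p0 := bracket_gt0 x.
rewrite -powRD; last by apply/implyP => _; exact: lt0r_neq0.
rewrite (_ : s - (s - k%:R) = k%:R); last by ring.
rewrite powR_mulrn ?(ltW p0)// -exprM mulnC exprM; apply: lerXn2r; rewrite ?nnegrE ?sqr_ge0 ?(ltW p0)//.
by rewrite lerDr.
Qed.

(** Young's inequality bounds 2 |x^k F| by the weighted square of F plus (1 + x^2)^(-(s - k)), which
    is integrable for s - k > 1/2. With k = 3 this is the threshold 7/2. *)
Lemma bracket_moment k s F : k%:R + 1 / 2 < s -> sqint F ->
  intble (fun x => (1 + x ^+ 2) `^ s * F x ^+ 2) ->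
  [/\ intble (fun x => x ^+ k * F x), sqint (fun x => x ^+ k * F x) &
    2 * \int[mu]_x `|x ^+ k * F x| <= \int[mu]_x ((1 + x ^+ 2) `^ s * F x ^+ 2) +
      \int[mu]_x (1 + x ^+ 2) `^ (- (s - k%:R))].
Proof.
move=> ks LF IF; have [mF _] := LF.
have Iq : intble (fun x : R => (1 + x ^+ 2) `^ (- (s - k%:R))) by apply: intble_bracket; lra.
have mk : meas (fun x => x ^+ k * F x) by apply: measurable_funM => //; exact: measurable_funX.
have young x : 2 * `|x ^+ k * F x| <=
    (1 + x ^+ 2) `^ s * F x ^+ 2 + (1 + x ^+ 2) `^ (- (s - k%:R)).
  have := bracket_exp k s x.
  set p := _ `^ s; set q := _ `^ _ => pq.
  have p0 : 0 <= p by exact: powR_ge0.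
  have q0 : 0 <= q by exact: powR_ge0.
  have A0 : 0 <= p * F x ^+ 2 + q by rewrite addr_ge0// mulr_ge0// sqr_ge0.
  rewrite -(@ler_sqr _ (2 * _)) ?nnegrE ?mulr_ge0// exprMn real_normK ?num_real// exprMn.
  have : (x ^+ k) ^+ 2 * F x ^+ 2 <= p * q * F x ^+ 2 by rewrite ler_wpM2r// sqr_ge0.
  have := sqr_ge0 (p * F x ^+ 2 - q); nra.
have I1 : intble (fun x => x ^+ k * F x).
  apply: (intble_le mk _ (intbleD IF Iq)) => x.
  by apply: le_trans (young x); rewrite ler_peMl// ler1n.
split => //.
- split => //; apply: (intble_le _ _ IF); first exact: measurable_funX.
  move=> x; rewrite ger0_norm ?sqr_ge0// exprMn ler_wpM2r ?sqr_ge0//.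
  apply: (le_trans (bracket_exp k s x)); rewrite ler_piMr ?powR_ge0// powRN.
  by rewrite invf_le1 ?powR_gt0 ?bracket_gt0// bracket_ge1//; lra.
- rewrite -intZ; last exact: intble_norm.
  by rewrite -intD//; apply: int_le => //; [exact/intbleZ/intble_norm|exact: intbleD].
Qed.

(** The factor 2 comes from (Re - Im)^2 <= 2 (Re^2 + Im^2), the Hartley transform being Re - Im of
    the Fourier transform. *)
Lemma sobolev_hart s f : sobolev s f -> exists F, [/\ is_hart f F,
  intble (fun x => (1 + x ^+ 2) `^ s * F x ^+ 2) &
  \int[mu]_x ((1 + x ^+ 2) `^ s * F x ^+ 2) <= 2 * fine (sobolev_norm s f) ^+ 2].
Proof.
move=> [hf fin]; set G := fourier _ in hf *.
have hF := fourier_is_hart hf; exists (fun x => Re (G x) - Im (G x)).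
have [_ /L2P[LR LI] _] := hf.
pose w (x : R) := (1 + x ^+ 2) `^ (s / 2).
have mw : meas w by exact: meas_bracket.
have wR : (fun x => Re ((w x)%:C * G x)) = fun x => w x * Re (G x).
  by apply/funext => x; exact: Re_scale.
have wI : (fun x => Im ((w x)%:C * G x)) = fun x => w x * Im (G x).
  by apply/funext => x; exact: Im_scale.
have [] := L2norm_fin _ _ fin.
- by rewrite -/w wR; apply: measurable_funM => //; case: LR.
- by rewrite -/w wI; apply: measurable_funM => //; case: LI.
rewrite -/w => LwR LwI.
have NE : fine (sobolev_norm s f) ^+ 2 =
    \int[mu]_x (w x * Re (G x)) ^+ 2 + \int[mu]_x (w x * Im (G x)) ^+ 2.
  rewrite /sobolev_norm (L2normE LwR LwI) /= sqr_sqrtr ?addr_ge0 ?int_sqr_ge0//.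
  by congr (_ + _); apply: eq_int => x; rewrite ?Re_scale ?Im_scale.
rewrite wR in LwR; rewrite wI in LwI.
have E x : (1 + x ^+ 2) `^ s * (Re (G x) - Im (G x)) ^+ 2 =
    (w x * Re (G x) - w x * Im (G x)) ^+ 2.
  rewrite -mulrBr exprMn; congr (_ * _).
  by rewrite /w -[RHS]powR_mulrn ?powR_ge0// -powRrM; congr (_ `^ _); field.
split => //.
- by apply: eq_intble (proj2 (sqintB LwR LwI)) => x; rewrite E.
- rewrite (eq_int E) NE mulrDr; apply: (le_trans (int_sqrD_le LwR (sqintN LwI))).
  by apply: le_of_eq; congr (_ + _ * _); apply: eq_int => x; rewrite sqrrN.
Qed.

(** A substitute for Plancherel: g is (2 pi)^-1 [cint F] by inversion, so Bessel's inequality for F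
    gives \int g^2 <= (2 pi)^-1 \int F^2. The remaining factor 2 / (2 pi) is below 1. *)
Lemma sobolev_sqr_le s f g : 1 / 2 < s -> sobolev s f -> continuous g ->
  {ae mu, forall x, f x = g x} ->
  \int[mu]_x f x ^+ 2 <= fine (sobolev_norm s f) ^+ 2.
Proof.
move=> s12 /sobolev_hart[F [hf IF le2]] cg fg.
have [Lf LF _] := hf; have mg := continuous_meas cg; have mF := proj1 LF.
have [I0 _ _] := @bracket_moment 0 s F (ltac:(lra)) LF IF.
have {}I0 : intble F by apply: eq_intble I0 => x; rewrite expr0 mul1r.
have hg : is_hart g F by apply: is_hart_ae hf => //; exact: nearW.
have gE := hart_inversion hg I0 cg.
have [Lc bc] := cint_bessel I0 LF.
have -> : \int[mu]_x f x ^+ 2 = \int[mu]_x g x ^+ 2.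
  apply: ae_int; [exact: (measurable_funX 2 (proj1 Lf))|exact: measurable_funX|].
  by apply: (ae_imp fg) => x ->.
have -> : \int[mu]_x g x ^+ 2 = ((2 * pi)^-1) ^+ 2 * \int[mu]_x cint F x ^+ 2.
  by rewrite -intZ; [apply: eq_int => x; rewrite gE exprMn|case: Lc].
have tp0 : 0 < 2 * pi :> R by rewrite mulr_gt0// pi_gt0.
have pi2 : 2 <= pi :> R by exact: pi_ge2.
have iv0 : 0 <= (2 * pi)^-1 :> R by rewrite invr_ge0 ltW.
apply: (@le_trans _ _ ((2 * pi)^-1 * \int[mu]_x F x ^+ 2)).
  by rewrite expr2 -mulrA ler_wpM2l// ler_pdivrMl.
have : \int[mu]_x F x ^+ 2 <= \int[mu]_x ((1 + x ^+ 2) `^ s * F x ^+ 2).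
  apply: int_le => //; first by case: LF.
  by move=> x; rewrite ler_peMl ?sqr_ge0// bracket_ge1//; lra.
move/le_trans => /(_ _ le2) h; rewrite ler_pdivrMl//; apply: (le_trans h).
by rewrite ler_wpM2r ?sqr_ge0//; lra.
Qed.

(** What the equation uses of one time slice: three derivatives and their transforms, obtained by
    iterating F |-> - y F(- y). The derivatives are fields rather than [derive1], so that a
    difference of two slices is again a profile. [hpI0] serves inversion for f, and [hpI2] makes
    [hilb] of the second derivative an absolutely convergent integral. *)
Record hprofile f f1 f2 f3 F : Prop := HProfile {
  hp0 : is_hart f F;
  hp1 : is_hart f1 (fun x => - (x * F (- x)));
  hp2 : is_hart f2 (fun x => - (x ^+ 2 * F x));
  hp3 : is_hart f3 (fun x => x ^+ 3 * F (- x));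
  hpI0 : intble F;
  hpI2 : intble (fun x => - (x ^+ 2 * F x));
  hpd0 : forall x : R, is_derive x 1 f (f1 x);
  hpd1 : forall x : R, is_derive x 1 f1 (f2 x);
  hpd2 : forall x : R, is_derive x 1 f2 (f3 x);
  hpc3 : continuous f3 }.

Lemma hprofileB f f1 f2 f3 F g g1 g2 g3 G :
  hprofile f f1 f2 f3 F -> hprofile g g1 g2 g3 G ->
  hprofile (fun x => f x - g x) (fun x => f1 x - g1 x) (fun x => f2 x - g2 x)
    (fun x => f3 x - g3 x) (fun x => F x - G x).
Proof.
move=> hf hg.
have lin h k H K1 L : is_hart h H -> is_hart k K1 -> (forall x, L x = H x - K1 x) ->
    is_hart (fun x => h x - k x) L.
  move=> hh hk e; have := is_hart_lin 1 (-1) hh hk.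
  rewrite (_ : (fun x => 1 * h x + _) = fun x => h x - k x); last first.
    by apply/funext => x; ring.
  by rewrite (_ : (fun x => 1 * H x + _) = L)//; apply/funext => x; rewrite e; ring.
split.
- exact: lin (hp0 hf) (hp0 hg) _.
- by apply: lin (hp1 hf) (hp1 hg) _ => x; ring.
- by apply: lin (hp2 hf) (hp2 hg) _ => x; ring.
- by apply: lin (hp3 hf) (hp3 hg) _ => x; ring.
- exact: intbleB (hpI0 hf) (hpI0 hg).
- by apply: eq_intble (intbleB (hpI2 hf) (hpI2 hg)) => x; ring.
- by move=> x; have := hpd0 hf x; have := hpd0 hg x => ? ?; exact: is_deriveB.
- by move=> x; have := hpd1 hf x; have := hpd1 hg x => ? ?; exact: is_deriveB.
- by move=> x; have := hpd2 hf x; have := hpd2 hg x => ? ?; exact: is_deriveB.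
- by move=> x; apply: cvgB; [exact: (hpc3 hf)|exact: (hpc3 hg)].
Qed.

(** Three applications of [is_hart_derive]; the last one needs y^3 F integrable and square
    integrable, hence s > 7/2. *)
Lemma sobolev_profile s f : 7 / 2 < s -> continuous f -> sobolev s f ->
  exists F, [/\ hprofile f f^`()%classic f^`(2)%classic f^`(3)%classic F,
    intble (fun x => (1 + x ^+ 2) `^ s * F x ^+ 2) &
    \int[mu]_x ((1 + x ^+ 2) `^ s * F x ^+ 2) <= 2 * fine (sobolev_norm s f) ^+ 2].
Proof.
move=> s72 cf /sobolev_hart[F [hf IF le2]]; exists F; split; [|exact: IF|exact: le2].
have [Lf LF _] := hf.
have [I0 _ _] := @bracket_moment 0 s F (ltac:(lra)) LF IF.
have [I1 L1 _] := @bracket_moment 1 s F (ltac:(lra)) LF IF.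
have [I2 L2 _] := @bracket_moment 2 s F (ltac:(lra)) LF IF.
have [I3 L3 _] := @bracket_moment 3 s F (ltac:(lra)) LF IF.
have {}I0 : intble F by apply: eq_intble I0 => x; rewrite expr0 mul1r.
pose F1 (y : R) := - (y * F (- y)).
pose F2 (y : R) := - (y ^+ 2 * F y).
pose F3 (y : R) := y ^+ 3 * F (- y).
have IF1 : intble F1.
  by apply: eq_intble (intble_opp I1) => x; rewrite /F1 expr1; ring.
have IF2 : intble F2 by exact: intbleN.
have IyF1 : intble (fun y => y * F1 y).
  by apply: eq_intble (intbleN (intble_opp I2)) => x; rewrite /F1; ring.
have LyF1 : sqint (fun y => y * F1 y).
  have := sqintN (sqint_opp L2); congr sqint.
  by apply/funext => x; rewrite /F1; ring.
have IyF2 : intble (fun y => y * F2 y).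
  by apply: eq_intble (intbleN I3) => x; rewrite /F2; ring.
have LyF2 : sqint (fun y => y * F2 y).
  by have := sqintN L3; congr sqint; apply/funext => x; rewrite /F2; ring.
have IF3 : intble F3.
  by apply: eq_intble (intbleN (intble_opp I3)) => x; rewrite /F3; ring.
pose T K (x : R) := (2 * pi)^-1 * cint K x.
have cT K : intble K -> continuous (T K).
  by move=> IK x; apply: cvgM; [exact: cvg_cst|exact: continuous_cint].
have [d0 h1] := is_hart_derive hf cf I0 I1 L1.
have [d1 +] := is_hart_derive h1 (cT _ IF1) IF1 IyF1 LyF1.
have -> : (fun y => - (y * F1 (- y))) = F2 by apply/funext => y; rewrite /F1 /F2 opprK; ring.
move=> h2; have [d2 +] := is_hart_derive h2 (cT _ IF2) IF2 IyF2 LyF2.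
have -> : (fun y => - (y * F2 (- y))) = F3 by apply/funext => y; rewrite /F2 /F3; ring.
move=> h3.
have e1 : f^`()%classic = T F1 by apply/funext => x; rewrite derive1E; case: (d0 x).
have e2 : f^`(2)%classic = T F2.
  rewrite derive1nS derive1n1 e1; apply/funext => x; rewrite derive1E; case: (d1 x) => _ ->.
  by congr (_ * cint _ _); apply/funext => y; rewrite /F1 /F2 opprK; ring.
have e3 : f^`(3)%classic = T F3.
  rewrite derive1nS e2; apply/funext => x; rewrite derive1E; case: (d2 x) => _ ->.
  by congr (_ * cint _ _); apply/funext => y; rewrite /F2 /F3; ring.
rewrite e1 e2 e3; split; [exact: hf|exact: h1|exact: h2|exact: h3|exact: I0|exact: IF2|exact: d0| | |exact: cT].
- move=> x; have := d1 x; congr is_derive; congr (_ * cint _ _).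
  by apply/funext => y; rewrite /F1 /F2 opprK; ring.
- move=> x; have := d2 x; congr is_derive; congr (_ * cint _ _).
  by apply/funext => y; rewrite /F2 /F3; ring.
Qed.

(** The embedding of H^s in functions with bounded derivative. The bound is quadratic in the norm
    because it comes from Young's inequality in [bracket_moment]; boundedness is all that is used
    later. *)
Lemma sobolev_derive_bound s : 7 / 2 < s -> exists Q : R, forall f, continuous f ->
  sobolev s f -> forall x, `|f^`()%classic x| <= Q + fine (sobolev_norm s f) ^+ 2.
Proof.
move=> s72; exists (\int[mu]_x (1 + x ^+ 2) `^ (- (s - 1))) => f cf hs x.
have [F [hp IF le2]] := sobolev_profile s72 cf hs.
have [_ LF _] := hp0 hp.
have [I1 L1 le1] := @bracket_moment 1 s F (ltac:(lra)) LF IF.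
pose F1 (y : R) := - (y * F (- y)).
have IF1 : intble F1.
  by apply: eq_intble (intble_opp I1) => y; rewrite /F1 expr1; ring.
have cf1 : continuous f^`()%classic by move=> y; exact: is_derive_continuous (hpd1 hp y).
rewrite (hart_inversion (hp1 hp) IF1 cf1) normrM.
have tp0 : 0 < 2 * pi :> R by rewrite mulr_gt0// pi_gt0.
have pi2 : 2 <= pi :> R by exact: pi_ge2.
have iv0 : 0 <= (2 * pi)^-1 :> R by rewrite invr_ge0 ltW.
rewrite (ger0_norm iv0) ler_pdivrMl//.
apply: (le_trans (cint_max x IF1)).
have -> : \int[mu]_y `|F1 y| = \int[mu]_y `|y ^+ 1 * F y|.
  rewrite -(int_opp (f := fun y => `|y ^+ 1 * F y|)); last first.
    exact: intble_meas (intble_norm I1).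
  by apply: eq_int => y; rewrite /F1 expr1 mulNr.
move: le1 le2; set A := \int[mu]_y _; set B := \int[mu]_y _; set C := \int[mu]_y _.
set N := fine _ ^+ 2 => le1 le2.
have N0 : 0 <= N by exact: sqr_ge0.
have C0 : 0 <= C by apply: int_ge0 => y; exact: powR_ge0.
nra.
Qed.

End sobolev_profiles.

(** * Solutions of the Benjamin equation *)

Section energy.
Set Implicit Arguments.
Unset Strict Implicit.
Context {R : realType}.
Local Notation mu := (@lebesgue_measure R).
Local Notation meas f := (measurable_fun setT (f : R -> R)).
Implicit Types (f g h w F G K z : R -> R) (J : set R).

Lemma cvg_quotient_continuous J (t l : R) (E : R -> R) :
  (E r - E t) / (r - t) @[r --> within J t^'] --> l -> E r @[r --> within J (nbhs t)] --> E t.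
Proof.
move=> h.
have idt : (r - t) @[r --> within J t^'] --> 0.
  rewrite -(subrr t); apply: cvgB; last exact: cvg_cst.
  by apply: cvg_trans (cvg_within _) _; exact: cvg_within.
have hE : (E r - E t) / (r - t) * (r - t) @[r --> within J t^'] --> 0.
  by rewrite -(mulr0 l); exact: (cvgM h idt).
apply/cvgrPdist_lt => e e0; move/cvgrPdist_lt: hE => /(_ _ e0).
have near_ex (P : R -> Prop) : (\forall r \near within J t^', P r) ->
    \forall r \near t, r != t -> J r -> P r by [].
move=> /near_ex h1.
have : \forall r \near t, J r -> `|E t - E r| < e; last by [].
near=> r => Jr; have [->|rt] := eqVneq r t; first by rewrite subrr normr0.
have : r != t -> J r -> `|0 - (E r - E t) / (r - t) * (r - t)| < e by near: r.
move=> /(_ rt Jr); rewrite sub0r normrN divfK ?subr_eq0// distrC; exact.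
Unshelve. all: by end_near. Qed.

Lemma cvg_quotient_is_derive (T t l : R) (E : R -> R) : t \in `]0, T[ ->
  (E r - E t) / (r - t) @[r --> within `[0, T] t^'] --> l -> is_derive t 1 E l.
Proof.
move=> tT h.
have shift : (k + t) @[k --> (0 : R)^'] --> within `[0, T] t^'.
  move=> A hA; have {}hA : \forall r \near t, r != t -> `[0, T]%classic r -> A r by exact: hA.
  have h0 : (k + t) @[k --> (0 : R)] --> t.
    by rewrite -[X in _ --> X]add0r; apply: cvgD; [exact: cvg_id|exact: cvg_cst].
  have IT : \forall r \near t, `[0, T]%classic r.
    have := near_in_itvoo tT; apply: filterS => r; exact: subset_itv_oo_cc.
  have h1 := h0 _ hA; have h2 := h0 _ IT.
  have : \forall k \near (0 : R), k != 0 -> A (k + t); last by [].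
  near=> k => k0; have kt : k + t != t by rewrite -subr_eq0 addrK.
  have : k + t != t -> `[0, T]%classic (k + t) -> A (k + t) by near: k.
  by apply=> //; near: k.
have hq : (fun k => k^-1 *: (E (k *: 1 + t) - E t)) @ (0 : R)^' --> l.
  have h2 : (E (k + t) - E t) / (k + t - t) @[k --> (0 : R)^'] --> l by exact: (cvg_comp _ _ shift h).
  apply: cvg_trans h2; apply: near_eq_cvg; near=> k => /=.
  by rewrite addrK mulrC /GRing.scale /= mulr1.
by apply: DeriveDef; [apply/cvg_ex; exists l|apply: cvg_lim].
Unshelve. all: by end_near. Qed.

(** The product e^(-M t) E(t) has nonpositive derivative inside the interval, is continuous up to
    the endpoints and starts at 0. *)
Lemma gronwall_eq0 (T M : R) (E E1 : R -> R) : (forall t, 0 <= E t) -> E 0 = 0 ->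
  (forall t, t \in `[0, T] ->
    (E r - E t) / (r - t) @[r --> within `[0, T] t^'] --> E1 t) ->
  (forall t, t \in `[0, T] -> E1 t <= M * E t) ->
  forall t, t \in `[0, T] -> E t = 0.
Proof.
move=> E0 E00 dE ME t tT.
pose f (t : R) := expR (- M * t) * E t.
have df (x : R) : x \in `]0, T[ -> is_derive x 1 f (expR (- M * x) * (E1 x - M * E x)).
  move=> xT; have h := cvg_quotient_is_derive xT (dE _ (subset_itv_oo_cc xT)).
  have he : is_derive x 1 (fun x => expR (- M * x)) (- M * expR (- M * x)).
    have hl : is_derive x (1 : R) (fun x => - M * x) (- M).
      by have := is_deriveZ (- M) (is_derive_id x (1 : R)); rewrite /GRing.scale /= mulr1.
    have := @is_derive1_comp _ expR (fun x => - M * x) x _ _ (is_derive_expR _) hl.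
    by rewrite mulrC.
  have := is_deriveM he h; congr is_derive.
  by rewrite /GRing.scale /=; ring.
have cf : {within `[0, T], continuous f}.
  apply/subspace_continuousP => x xT; apply: cvgM.
    apply: cvg_within_filter; apply: (@cvg_comp _ _ _ (fun x => - M * x) expR); last exact: continuous_expR.
    by apply: cvgM; [exact: cvg_cst|exact: cvg_id].
  exact: cvg_quotient_continuous (dE _ xT).
have T0 : 0 <= T by move: tT; rewrite in_itv /= => /andP[]; exact: le_trans.
have t0 : 0 <= t by move: tT; rewrite in_itv /= => /andP[].
have : f t <= f 0.
  apply: (ler0_derive1_le_cc _ _ cf) => //.
  - by move=> x /df h; exact: ex_derive.
  - move=> x xT; rewrite derive1E; case: (df _ xT) => _ ->.
    rewrite mulr_ge0_le0 ?expR_ge0// subr_le0 ME//; exact: subset_itv_oo_cc xT.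
  - by rewrite in_itv /= lexx.
rewrite /f E00 mulr0 pmulr_rle0 ?expR_gt0// => Et.
by apply/eqP; rewrite eq_le Et E0.
Qed.

(** With q the difference quotient of w, the quotient of the squares is 2 q w(t) + (r - t) q^2. As q
    converges in L^2 it stays bounded there, so the last term disappears in the limit. *)
Lemma energy_quotient J (t : R) (w : R -> R -> R) z :
  (forall r, J r -> sqint (w r)) -> J t -> sqint z ->
  (\int[mu]_x ((w r x - w t x) / (r - t) - z x) ^+ 2) @[r --> within J t^'] --> 0 ->
  ((\int[mu]_x w r x ^+ 2) - (\int[mu]_x w t x ^+ 2)) / (r - t) @[r --> within J t^'] -->
    2 * \int[mu]_x (z x * w t x).
Proof.
move=> Lw Jt Lz h.
pose q r x := (w r x - w t x) / (r - t).
have nJ : \forall r \near within J t^', J r by exact: withinT.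
have nt : \forall r \near within J t^', r != t.
  have : \forall r \near t^', J r -> r != t; last by [].
  by near=> r => _; near: r; exact: nbhs_dnbhs_neq.
have Lq r : J r -> sqint (q r).
  move=> Jr; have := sqintZ (r - t)^-1 (sqintB (Lw _ Jr) (Lw _ Jt)); congr sqint.
  by apply/funext => x; rewrite /q mulrC.
have hq : (\int[mu]_x (q r x * w t x)) @[r --> within J t^'] --> \int[mu]_x (z x * w t x).
  apply: cvg_int_mul => //; last exact: Lw.
  by apply: filterS nJ => r; exact: Lq.
have idt : (r - t) @[r --> within J t^'] --> 0.
  rewrite -(subrr t); apply: cvgB; last exact: cvg_cst.
  by apply: cvg_trans (cvg_within _) _; exact: cvg_within.
have hb : ((r - t) * \int[mu]_x q r x ^+ 2) @[r --> within J t^'] --> 0.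
  apply: norm_cvg0.
  have hv : (`|r - t| * (2 * (\int[mu]_x ((w r x - w t x) / (r - t) - z x) ^+ 2) +
      2 * \int[mu]_x z x ^+ 2)) @[r --> within J t^'] --> 0.
    apply: (@cvg_to_eq _ _ _ _ (`|0| * (2 * 0 + 2 * \int[mu]_x z x ^+ 2))).
      by rewrite normr0 mul0r.
    apply: cvgM; first exact: cvg_norm.
    by apply: cvgD; [apply: cvgM; [exact: cvg_cst|exact: h]|exact: cvg_cst].
  apply: (squeeze_cvg0 _ hv); near=> r.
  have Jr : J r by near: r.
  rewrite normr_ge0 normrM ler_wpM2l// ger0_norm ?int_sqr_ge0//.
  apply: le_trans (int_sqrD_le (sqintB (Lq _ Jr) Lz) Lz).
  by apply: le_of_eq; apply: eq_int => x; rewrite subrK.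
apply: (@cvg_to_eq _ _ _ _ (2 * (\int[mu]_x (z x * w t x)) + 0)); first by rewrite addr0.
have hs : (2 * (\int[mu]_x (q r x * w t x)) + (r - t) * \int[mu]_x q r x ^+ 2)
    @[r --> within J t^'] --> 2 * (\int[mu]_x (z x * w t x)) + 0.
  by apply: cvgD; [apply: cvgM; [exact: cvg_cst|exact: hq]|exact: hb].
apply: cvg_trans hs; apply: near_eq_cvg; near=> r.
have Jr : J r by near: r.
have rt : r - t != 0 by rewrite subr_eq0; near: r.
have Lwr := Lw _ Jr; have Lwt := Lw _ Jt; have Lqr := Lq _ Jr.
have I1 : intble (fun x => q r x * w t x) by exact: sqint_mul.
rewrite -intB; [|by case: Lwr|by case: Lwt].
rewrite -(intZ 2 I1) -(intZ (r - t) (proj2 Lqr)) -intD; [|exact: intbleZ|by apply: intbleZ; case: Lqr].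
apply: (mulIf rt); rewrite divfK// mulrC.
rewrite -(intZ (r - t) (intbleD (intbleZ 2 I1) (intbleZ (r - t) (proj2 Lqr)))).
by apply: eq_int => x; rewrite /q; field.
Unshelve. all: by end_near. Qed.

(** * Energy identities and unique continuation for profiles *)

Lemma hilbB F G (x : R) : intble F -> intble G ->
  hilb (fun y => F y - G y) x = hilb F x - hilb G x.
Proof.
move=> IF IG; rewrite /hilb -mulrBr -cintB; [|exact: intble_sgr|exact: intble_sgr].
by congr (_ * cint _ _); apply/funext => y; rewrite mulrBr.
Qed.

Lemma hprofile_cont f f1 f2 f3 F : hprofile f f1 f2 f3 F ->
  [/\ continuous f, continuous f1 & continuous f2].
Proof.
move=> hp; split=> x; first exact: is_derive_continuous (hpd0 hp x).
- exact: is_derive_continuous (hpd1 hp x).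
- exact: is_derive_continuous (hpd2 hp x).
Qed.

(** By [hart_mul] the pairing becomes the integral of - sg(y) y^2 F(y) F(- y), an odd function. *)
Lemma hprofile_hilb f f1 f2 f3 F : hprofile f f1 f2 f3 F ->
  \int[mu]_x (f x * hilb (fun y => - (y ^+ 2 * F y)) x) = 0.
Proof.
move=> hp; have [_ L2 _] := hp2 hp; have I2 := hpI2 hp; have [_ LF _] := hp0 hp.
set F2 := fun y => _ in L2 I2 *.
pose K y := Num.sg y * F2 (- y).
have IK : intble K by exact: intble_sgr.
have LK : sqint K.
  by apply: (sqintMb (M := 1)); [exact: meas_sgr|exact: sgr_max|exact: sqint_opp].
have -> : \int[mu]_x (f x * hilb F2 x) = (2 * pi)^-1 * \int[mu]_x (f x * cint K x).
  rewrite -intZ; first by apply: eq_int => x; rewrite /hilb; ring.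
  by apply: sqint_mul; [case: (hp0 hp)|exact: sqint_cint].
rewrite -(hart_mul (hp0 hp) IK LK) (_ : \int[mu]_x (F x * K x) = 0) ?mulr0//.
apply: int_odd; first by apply: measurable_funM; [case: LF|case: LK].
by move=> x; rewrite /K /F2 sgrN opprK; ring.
Qed.

(** One integration by parts leaves - \int f1 f2, and a second one shows that \int f1 f2 is its own
    opposite. *)
Lemma hprofile_third f f1 f2 f3 F : hprofile f f1 f2 f3 F ->
  \int[mu]_x (f x * f3 x) = 0.
Proof.
move=> hp; have [c0 c1 c2] := hprofile_cont hp.
have [L0 _ _] := hp0 hp; have [L1 _ _] := hp1 hp.
have [L2 _ _] := hp2 hp; have [L3 _ _] := hp3 hp.
rewrite (integration_by_parts_line (hpd0 hp) (hpd2 hp) c1 (hpc3 hp) L0 L1 L2 L3).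
have := integration_by_parts_line (hpd1 hp) (hpd1 hp) c2 c2 L1 L2 L1 L2.
rewrite (eq_int (g := fun x => f2 x * f1 x)); last by move=> x; rewrite mulrC.
by move=> h; lra.
Qed.

Lemma hprofile_bounded f f1 f2 f3 F : hprofile f f1 f2 f3 F ->
  exists M : R, forall x, `|f x| <= M.
Proof.
move=> hp; have [c0 _ _] := hprofile_cont hp.
exists (`|(2 * pi)^-1| * (2 * \int[mu]_y `|F y|)) => x.
rewrite (hart_inversion (hp0 hp) (hpI0 hp) c0) normrM ler_wpM2l//.
exact: cint_max (hpI0 hp).
Qed.

(* For w = f - g one has f f' - g g' = w f' + g w', and g w w' integrates to
   - g' w^2 / 2; the linear terms are skew-adjoint and do not contribute. *)
Lemma energy_le f f1 f2 f3 F g g1 g2 g3 G z (M : R) :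
  hprofile f f1 f2 f3 F -> hprofile g g1 g2 g3 G -> sqint z ->
  {ae mu, forall x, z x = - (hilb (fun y => - (y ^+ 2 * (F y - G y))) x +
    (f3 x - g3 x) + (f x * f1 x - g x * g1 x))} ->
  (forall x, `|f1 x| <= M) -> (forall x, `|g1 x| <= M) ->
  2 * \int[mu]_x (z x * (f x - g x)) <= 3 * M * \int[mu]_x (f x - g x) ^+ 2.
Proof.
move=> hf hg Lz zE fM gM; have hw := hprofileB hf hg.
set w := fun x => f x - g x in hw; set w1 := fun x => f1 x - g1 x in hw.
set w3 := fun x => f3 x - g3 x in hw.
set W2 := fun y => - (y ^+ 2 * (F y - G y)) in zE.
have [cw cw1 _] := hprofile_cont hw; have [cg cg1 _] := hprofile_cont hg.
have [cf cf1 _] := hprofile_cont hf.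
have [Lw _ _] := hp0 hw; have [Lw1 _ _] := hp1 hw; have [Lw3 _ _] := hp3 hw.
have [B gB] := hprofile_bounded hg.
have mg := continuous_meas cg; have mg1 := continuous_meas cg1.
have mf1 := continuous_meas cf1.
have Lh : sqint (hilb W2).
  apply: sqintZ; apply: sqint_cint; first exact: (intble_sgr (hpI2 hw)).
  apply: (sqintMb (M := 1)); [exact: meas_sgr|exact: sgr_max|].
  by apply: (@sqint_opp _ W2); case: (hp2 hw).
have Iww1 : intble (fun x => g x * (w x * w1 x)).
  by apply: (intbleMb (M := B)) => //; exact: sqint_mul.
have Igww : intble (fun x => g1 x * w x ^+ 2).
  by apply: (intbleMb (M := M)) => //; case: Lw.
have Ifww : intble (fun x => f1 x * w x ^+ 2).
  by apply: (intbleMb (M := M)) => //; case: Lw.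
have Ihw : intble (fun x => w x * hilb W2 x) by exact: sqint_mul.
have Iw3 : intble (fun x => w x * w3 x) by exact: sqint_mul.
have IBP : \int[mu]_x (g1 x * w x ^+ 2) + 2 * \int[mu]_x (g x * (w x * w1 x)) = 0.
  rewrite -intZ// -intD//; last exact: intbleZ.
  apply: (@int_derive_eq0 _ (fun x => g x * w x ^+ 2)).
  - move=> x; have hgx := hpd0 hg x; have hwx := hpd0 hw x.
    have := is_deriveM hgx (is_deriveX 2 hwx); congr is_derive.
    by rewrite -[LHS]/(g x * (2 * w x * w1 x) + w x * w x * g1 x); ring.
  - move=> x; apply: cvgD; apply: cvgM; [exact: cg1| |exact: cvg_cst|].
      by apply: cvgM; exact: cw.
    by apply: cvgM; [exact: cg|apply: cvgM; [exact: cw|exact: cw1]].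
  - by apply: (intbleMb (M := B)) => //; case: Lw.
  - by apply: intbleD => //; exact: intbleZ.
have zw : \int[mu]_x (z x * (f x - g x)) =
    - (\int[mu]_x (f1 x * w x ^+ 2)) - \int[mu]_x (g x * (w x * w1 x)).
  transitivity (\int[mu]_x (- (w x * hilb W2 x) - w x * w3 x - f1 x * w x ^+ 2 - g x * (w x * w1 x))).
    apply: ae_int.
    - by apply: intble_meas; exact: (sqint_mul Lz Lw).
    - by apply: intble_meas; repeat (apply: intbleB || apply: intbleN); exact.
    - by apply: (ae_imp zE) => x ->; rewrite /w /w1 /w3; ring.
  rewrite intB//; last by repeat (apply: intbleB || apply: intbleN); exact.
  rewrite intB//; last by repeat (apply: intbleB || apply: intbleN); exact.
  rewrite intB//; last exact: intbleN.
  by rewrite (intN Ihw) (hprofile_hilb hw) (hprofile_third hw) !(oppr0, add0r).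
rewrite zw.
have bd h : meas h -> (forall x, `|h x| <= M) ->
    `|\int[mu]_x (h x * w x ^+ 2)| <= M * \int[mu]_x w x ^+ 2.
  move=> mh hM; rewrite -intZ; last by case: Lw.
  apply: int_norm_le; [by apply: measurable_funM => //; apply: measurable_funX; case: Lw| |].
    by apply: intbleZ; case: Lw.
  by move=> x; rewrite normrM (ger0_norm (sqr_ge0 _)) ler_wpM2r ?sqr_ge0.
(* By [zw] and [IBP] the left side is - 2 \int f1 w^2 + \int g1 w^2; the two terms contribute 2 M
   and M. *)
have := bd _ mf1 fM; have := bd _ mg1 gM; rewrite !ler_norml -/w => /andP[h1 h2] /andP[h3 h4].
lra.
Qed.

(** A zero L^2 norm gives vanishing almost everywhere only. But then F is also a transform of the
    zero function, and inversion for both continuous functions gives equality at every point. *)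
Lemma hprofile_eq0 f f1 f2 f3 F : hprofile f f1 f2 f3 F ->
  \int[mu]_x f x ^+ 2 = 0 -> forall x, f x = 0.
Proof.
move=> hp f0 x; have [cf _ _] := hprofile_cont hp; have [Lf LF _] := hp0 hp.
have h0 : is_hart (fun=> 0) F.
  apply: is_hart_ae (hp0 hp); [exact: measurable_cst|by case: LF| |exact: nearW].
  exact: int_sqr_eq0.
rewrite (hart_inversion (hp0 hp) (hpI0 hp) cf).
by rewrite -(hart_inversion h0 (hpI0 hp))//; move=> ?; exact: cvg_cst.
Qed.

Lemma derive_locally0 f (d a x : R) : (forall y, `|y| < d -> f y = 0) -> `|x| < d ->
  is_derive x 1 f a -> a = 0.
Proof.
move=> f0 xd [_ <-].
rewrite (@near_eq_derive _ _ _ f (cst 0)) ?derive_cst//.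
near=> y; apply: f0; near: y.
by apply: (@cvgr_lt R _ (nbhs x) _ (fun y => `|y|) `|x|); [exact: norm_continuous|].
Unshelve. all: by end_near. Qed.

(** [unique_continuation] is applied to f2, whose Hilbert transform is - z near 0. Then f1 and f are
    successively constant, with value 0 at the origin. *)
Lemma hprofile_unique_continuation f f1 f2 f3 F z (d : R) : hprofile f f1 f2 f3 F ->
  0 < d -> (forall x, `|x| < d -> f x = 0) -> meas z ->
  {ae mu, forall x, `|x| < d -> z x = - hilb (fun y => - (y ^+ 2 * F y)) x} ->
  (forall N : nat, (0 < N)%N -> exists c : R, \forall r \near (0 : R)^'+,
    (\int[mu]_(x in [set x | (`|x| <= r)%R]) (`|z x| ^+ 2)%:E <= (c * r ^+ N)%:E)%E) ->
  forall x, f x = 0.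
Proof.
move=> hp d0 f0 mz zE zN.
have f10 x : `|x| < d -> f1 x = 0 by move=> xd; exact: derive_locally0 f0 xd (hpd0 hp x).
have f20 x : `|x| < d -> f2 x = 0 by move=> xd; exact: derive_locally0 f10 xd (hpd1 hp x).
have [_ _ c2] := hprofile_cont hp.
have d00 : `|0 : R| < d by rewrite normr0.
have f2z x : f2 x = 0.
  apply: (unique_continuation (hp2 hp) (hpI2 hp) d0 c2 f20) => N N0.
  have [c hc] := zN N N0; exists c; near=> r.
  have rd : r < d by near: r; exact: nbhs_right_lt.
  have mA : measurable [set x : R | (`|x| <= r)%R].
    rewrite (_ : [set x | _] = `[- r, r]%classic)//.
    by apply/seteqP; split => y /=; rewrite in_itv /= ler_norml.
  apply: (@le_trans _ _ (\int[mu]_(x in [set x | (`|x| <= r)%R]) (`|z x| ^+ 2)%:E)%E); last first.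
    by near: r.
  rewrite le_eqVlt; apply/orP; left; apply/eqP.
  apply: ge0_ae_eq_integral => //.
  - apply/measurable_EFinP; apply: measurable_funX; apply: measurable_funTS.
    apply: continuous_meas; exact: (continuous_hilb (hpI2 hp)).
  - apply/measurable_EFinP; apply: measurable_funX; apply: measurable_funTS.
    exact: measurableT_comp.
  - by move=> y _; rewrite lee_fin sqr_ge0.
  - apply: (ae_imp zE) => y h /= yr.
    by rewrite h ?normrN ?real_normK ?num_real// (le_lt_trans yr).
have f1z x : f1 x = 0.
  rewrite -(f10 0 d00); apply: is_derive_0_is_cst => y; rewrite -(f2z y); exact: (hpd1 hp).
move=> x; rewrite -(f0 0 d00); apply: is_derive_0_is_cst => y; rewrite -(f1z y).
exact: (hpd0 hp).
Unshelve. all: by end_near. Qed.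

(** * Estimates for solutions and the two halves of the theorem *)

Lemma sobolev_is_hart s f : sobolev s f -> exists F, is_hart f F.
Proof. by move=> /sobolev_hart[F [hf _ _]]; exists F. Qed.

Lemma benjamin_time_derivative s T (u ut : R -> R -> R) (t : R) : 7 / 2 < s ->
  benjamin_solution s T u ut -> t \in `[0, T] ->
  exists F, [/\ hprofile (u t) (u t)^`()%classic (u t)^`(2)%classic (u t)^`(3)%classic F,
    sqint (ut t) &
    {ae mu, forall x, ut t x = - (hilb (fun y => - (y ^+ 2 * F y)) x +
      (u t)^`(3)%classic x + u t x * (u t)^`()%classic x)}].
Proof.
move=> s72 [cu [su _] du _ eqn] tT.
have [F [hp _ _]] := sobolev_profile s72 (cu _ tT) (su _ tT).
have [sut _] := du _ tT; have [V [Lut _ _]] := sobolev_is_hart sut.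
exists F; split => //.
apply: (ae_imp2 (eqn _ tT) (hilbert_hilb (hp2 hp) (hpI2 hp))) => x + <-.
by move=> h; apply/eqP; rewrite -subr_eq0 opprK; apply/eqP; rewrite -[RHS]h; ring.
Qed.

(** Convergence in H^(s-3) yields convergence in L^2 through [sobolev_sqr_le], which asks for a
    continuous representative. The equation supplies it: [ut t] equals almost everywhere an
    expression in [hilb] and the space derivatives, all continuous. *)
Lemma benjamin_quotient s T (u ut : R -> R -> R) (t : R) : 7 / 2 < s ->
  benjamin_solution s T u ut -> t \in `[0, T] ->
  (\int[mu]_x ((u r x - u t x) / (r - t) - ut t x) ^+ 2) @[r --> within `[0, T] t^'] --> 0.
Proof.
move=> s72 sol tT; have [F [hp Lut utE]] := benjamin_time_derivative s72 sol tT.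
have [cu [su _] du _ _] := sol; have [sut hd] := du _ tT.
have [V hV] := sobolev_is_hart sut; have [U hU] := sobolev_is_hart (su _ tT).
have [c0 c1 _] := hprofile_cont hp.
have [fin hd0] := (fine_cvgP _ _).1 hd.
pose N r := fine (sobolev_norm (s - 3) (fun x => (u r x - u t x) / (r - t) - ut t x)).
have hv : (N r * N r) @[r --> within `[0, T] t^'] --> 0.
  by apply: (@cvg_to_eq _ _ _ _ (0 * 0)); [rewrite mulr0|exact: (cvgM hd0 hd0)].
apply: (squeeze_cvg0 _ hv); near=> r; rewrite int_sqr_ge0 /= -expr2.
have rT : r \in `[0, T] by near: r; exact: withinT.
have [Ur hUr] := sobolev_is_hart (su _ rT).
have hq := is_hart_lin 1 (-1) (is_hart_lin (r - t)^-1 (- (r - t)^-1) hUr hU) hV.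
have e : (fun x => 1 * ((r - t)^-1 * u r x + - (r - t)^-1 * u t x) + -1 * ut t x) =
    fun x => (u r x - u t x) / (r - t) - ut t x by apply/funext => x; ring.
rewrite e in hq.
apply: (sobolev_sqr_le (s := s - 3)
  (g := fun x => (u r x - u t x) / (r - t) + (hilb (fun y => - (y ^+ 2 * F y)) x +
      (u t)^`(3)%classic x + u t x * (u t)^`()%classic x))).
- by lra.
- split; first exact: is_fourier_fourier hq.
  have : sobolev_norm (s - 3) (fun x => (u r x - u t x) / (r - t) - ut t x) \is a fin_num.
    by near: r.
  by rewrite fin_numE => /andP[_]; rewrite ltey.
- move=> x; apply: cvgD.
    by apply: cvgM; [apply: cvgB; [exact: (cu _ rT)|exact: (cu _ tT)]|exact: cvg_cst].
  apply: cvgD; last by apply: cvgM; [exact: c0|exact: c1].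
  by apply: cvgD; [exact: (continuous_hilb (hpI2 hp))|exact: (hpc3 hp)].
- by apply: (ae_imp utE) => x ->; rewrite opprK.
Unshelve. all: by end_near. Qed.

(** Continuity in H^s bounds the derivative near each time, since u_x(r) is u_x(t) plus the
    derivative of a difference of norm below 1; compactness of [0, T] makes the bound uniform. The
    triangle inequality is used for derivatives, not for the Sobolev norm. *)
Lemma benjamin_lipschitz s T (u ut : R -> R -> R) : 7 / 2 < s ->
  benjamin_solution s T u ut ->
  exists M : R, forall t, t \in `[0, T] -> forall x, `|(u t)^`()%classic x| <= M.
Proof.
move=> s72 [cu [su cvu] _ _ _]; have [Q hQ] := sobolev_derive_bound s72.
have /near_covering_withinP cov := (compact_near_coveringP _).1 (@segment_compact R 0 T).
(* Compactness in near-covering form, with the bound M as parameter tending to +oo: it is enough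
   that M works for all times near t once M is large. *)
have [] := cov R (+oo)%R (fun M t => forall x, `|(u t)^`()%classic x| <= M) _ _; last first.
  move=> M [_ hM]; exists (M + 1) => t tT x; apply: (hM (M + 1)) => //.
  by rewrite ltrDl.
move=> t tT.
have [fin h0] := (fine_cvgP _ _).1 (cvu t tT).
have near_ex (P : R -> Prop) : (\forall r \near within `[0, T] (nbhs t), P r) ->
    \forall r \near t, r \in `[0, T] -> P r by [].
have n1 := near_ex _ fin.
move/cvgr0Pnorm_lt: h0 => /(_ _ ltr01)/near_ex n2.
have [U [hU _ _]] := sobolev_profile s72 (cu _ tT) (su _ tT).
have [V hV] := sobolev_is_hart (su _ tT).
near=> r M => /= rT x.
have [Ur [hUr _ _]] := sobolev_profile s72 (cu _ rT) (su _ rT).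
have hd := hprofileB hUr hU.
have frt : sobolev_norm s (fun x => u r x - u t x) \is a fin_num by move: rT; near: r.
have nrt : `|fine (sobolev_norm s (fun x => u r x - u t x))| < 1 by move: rT; near: r.
have sd : sobolev s (fun x => u r x - u t x).
  split; first exact: is_fourier_fourier (hp0 hd).
  by move: frt; rewrite fin_numE => /andP[_]; rewrite ltey.
have [cd _ _] := hprofile_cont hd.
have := hQ _ cd sd x; have := hQ _ (cu _ tT) (su _ tT) x.
have -> : (fun x => u r x - u t x)^`()%classic x = (u r)^`()%classic x - (u t)^`()%classic x.
  by rewrite [LHS]derive1E; case: (hpd0 hd x).
move=> h1 h2.
have h3 : fine (sobolev_norm s (fun x => u r x - u t x)) ^+ 2 <= 1.
  by rewrite -real_normK ?num_real// expr_le1// ltW.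
rewrite -(subrK ((u t)^`()%classic x) ((u r)^`()%classic x)).
apply: (le_trans (ler_normD _ _)).
have : Q + 1 + (Q + fine (sobolev_norm s (u t)) ^+ 2) <= M.
  by near: M; apply: nbhs_pinfty_ge; rewrite num_real.
move=> hM; apply: le_trans hM; apply: (lerD _ h1); apply: (le_trans h2).
by rewrite lerD2l; exact: h3.
Unshelve. all: by end_near. Qed.

Lemma benjamin_initial_eq s T (u ut v vt : R -> R -> R) J : 0 < T -> 7 / 2 < s ->
  benjamin_solution s T u ut -> benjamin_solution s T v vt ->
  open J -> J 0 -> (forall x, J x -> u 0 x = v 0 x) ->
  (forall N : nat, (0 < N)%N -> exists c : R, \forall r \near (0 : R)^'+,
    (\int[mu]_(x in [set x | (`|x| <= r)%R])
        (`|ut 0%R x - vt 0%R x| ^+ 2)%:E <= (c * r ^+ N)%:E)%E) ->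
  forall x, u 0 x = v 0 x.
Proof.
move=> T0 s72 solu solv oJ J0 uv hN x.
have T00 : (0 : R) \in `[0, T] by rewrite in_itv /= lexx ltW.
have [F [hF Lut utE]] := benjamin_time_derivative s72 solu T00.
have [G [hG Lvt vtE]] := benjamin_time_derivative s72 solv T00.
have [d d0 dJ] : exists2 d : R, 0 < d & forall x, `|x| < d -> J x.
  have /nbhs_ballP[d d0 dJ] : nbhs 0 J by exact: open_nbhs_nbhs.
  by exists d => // y yd; apply: dJ; rewrite /ball /= sub0r normrN.
have hw := hprofileB hF hG.
have w0 y : `|y| < d -> u 0 y - v 0 y = 0 by move=> /dJ/uv ->; rewrite subrr.
have w10 y : `|y| < d -> (u 0)^`()%classic y - (v 0)^`()%classic y = 0.
  by move=> yd; exact: derive_locally0 w0 yd (hpd0 hw y).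
have w20 y : `|y| < d -> (u 0)^`(2)%classic y - (v 0)^`(2)%classic y = 0.
  by move=> yd; exact: derive_locally0 w10 yd (hpd1 hw y).
have w30 y : `|y| < d -> (u 0)^`(3)%classic y - (v 0)^`(3)%classic y = 0.
  by move=> yd; exact: derive_locally0 w20 yd (hpd2 hw y).
apply/eqP; rewrite -subr_eq0; apply/eqP.
apply: (hprofile_unique_continuation hw d0 w0 _ _ hN).
  by have [] := sqintB Lut Lvt.
apply: (ae_imp2 utE vtE) => y -> -> yd.
have e : (fun y => - (y ^+ 2 * (F y - G y))) = fun y => - (y ^+ 2 * F y) - - (y ^+ 2 * G y).
  by apply/funext => z; ring.
rewrite e hilbB; [|exact: hpI2 hF|exact: hpI2 hG].
have /eqP := w0 _ yd; rewrite subr_eq0 => /eqP ->.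
have /eqP := w10 _ yd; rewrite subr_eq0 => /eqP ->.
have /eqP := w30 _ yd; rewrite subr_eq0 => /eqP ->.
by ring.
Qed.

Lemma benjamin_unique s T (u ut v vt : R -> R -> R) : 0 < T -> 7 / 2 < s ->
  benjamin_solution s T u ut -> benjamin_solution s T v vt ->
  (forall x, u 0 x = v 0 x) -> forall x t, t \in `[0, T] -> u t x = v t x.
Proof.
move=> T0 s72 solu solv uv0 x t tT.
have [Mu hMu] := benjamin_lipschitz s72 solu.
have [Mv hMv] := benjamin_lipschitz s72 solv.
pose M := Num.max Mu Mv; pose w r x := u r x - v r x.
have prof r : r \in `[0, T] -> exists F G,
    [/\ hprofile (u r) (u r)^`()%classic (u r)^`(2)%classic (u r)^`(3)%classic F,
      hprofile (v r) (v r)^`()%classic (v r)^`(2)%classic (v r)^`(3)%classic G,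
      sqint (ut r), sqint (vt r) &
      {ae mu, forall x, ut r x - vt r x = - (hilb (fun y => - (y ^+ 2 * (F y - G y))) x +
       ((u r)^`(3)%classic x - (v r)^`(3)%classic x) +
       (u r x * (u r)^`()%classic x - v r x * (v r)^`()%classic x))}].
  move=> rT; have [F [hF Lut utE]] := benjamin_time_derivative s72 solu rT.
  have [G [hG Lvt vtE]] := benjamin_time_derivative s72 solv rT.
  exists F, G; split; [exact: hF|exact: hG|exact: Lut|exact: Lvt|].
  apply: (ae_imp2 utE vtE) => y -> ->.
  have e : (fun y => - (y ^+ 2 * (F y - G y))) = fun y => - (y ^+ 2 * F y) - - (y ^+ 2 * G y).
    by apply/funext => z; ring.
  rewrite e hilbB; [|exact: hpI2 hF|exact: hpI2 hG].
  have alg (a b c a' b' c' : R) :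
      - (a + b + c) - - (a' + b' + c') = - (a - a' + (b - b') + (c - c')) by ring.
  exact: alg.
have Lw r : r \in `[0, T] -> sqint (w r).
  by move=> /prof[F [G [hF hG _ _ _]]]; have [] := hp0 (hprofileB hF hG).
have E0 : forall r, r \in `[0, T] -> \int[mu]_x w r x ^+ 2 = 0.
  apply: (@gronwall_eq0 T (3 * M) (fun r => \int[mu]_x w r x ^+ 2)
    (fun r => 2 * \int[mu]_x ((ut r x - vt r x) * w r x))).
  - by move=> r; exact: int_sqr_ge0.
  (* The integrand is identically 0 at time 0, hence odd. *)
  - by apply: int_odd => [|y]; rewrite /w;
      [under eq_fun do rewrite uv0 subrr expr0n; exact: measurable_cst
      |rewrite !uv0 !subrr expr0n oppr0].
  - move=> r rT; have [F [G [hF hG Lut Lvt _]]] := prof _ rT.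
    apply: energy_quotient => //; first exact: sqintB.
    have qu := benjamin_quotient s72 solu rT; have qv := benjamin_quotient s72 solv rT.
    apply: (squeeze_cvg0 _ (cvg0D (cvg0Z 2 qu) (cvg0Z 2 qv))); near=> q.
    rewrite int_sqr_ge0 /=.
    have qT : q \in `[0, T] by near: q; exact: withinT.
    have [F' [G' [hF' hG' _ _ _]]] := prof _ qT.
    have Lq (a b z : R -> R) : sqint a -> sqint b -> sqint z ->
        sqint (fun x => (a x - b x) / (q - r) - z x).
      move=> La Lb Lz; have := sqintB (sqintZ (q - r)^-1 (sqintB La Lb)) Lz; congr sqint.
      by apply/funext => y; rewrite mulrC.
    have [L1 _ _] := hp0 hF; have [L2 _ _] := hp0 hG.
    have [L3 _ _] := hp0 hF'; have [L4 _ _] := hp0 hG'.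
    apply: (le_trans _ (le_trans (int_sqrD_le (Lq _ _ _ L3 L1 Lut) (sqintN (Lq _ _ _ L4 L2 Lvt))) _)).
      by apply: le_of_eq; apply: eq_int => y; congr (_ ^+ 2); rewrite /w; ring.
    by rewrite lerD2l ler_wpM2l//; apply: le_of_eq; apply: eq_int => y; rewrite sqrrN.
  - move=> r rT; have [F [G [hF hG Lut Lvt E]]] := prof _ rT.
    apply: (energy_le hF hG (sqintB Lut Lvt) E) => y.
    + by apply: le_trans (hMu _ rT y) _; rewrite le_max lexx.
    + by apply: le_trans (hMv _ rT y) _; rewrite le_max lexx orbT.
have [F [G [hF hG _ _ _]]] := prof _ tT.
apply/eqP; rewrite -subr_eq0; apply/eqP.
exact: (hprofile_eq0 (hprofileB hF hG) (E0 _ tT)).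
Unshelve. all: by end_near. Qed.

End energy.

Theorem theorem1p7 (R : realType) (T s : R) (u ut v vt : R -> R -> R)
    (I : set R) :
  0 < T -> 7 / 2 < s ->
  benjamin_solution s T u ut ->
  benjamin_solution s T v vt ->
  open I -> I 0 ->
  (forall x, I x -> u 0 x = v 0 x) ->
  (forall N : nat, (0 < N)%N -> exists c : R, \forall r \near (0 : R)^'+,
    (\int[@lebesgue_measure R]_(x in [set x | (`|x| <= r)%R])
        (`|ut 0%R x - vt 0%R x| ^+ 2)%:E <= (c * r ^+ N)%:E)%E) ->
  forall x t : R, t \in `[0, T] -> u t x = v t x.
Proof.
move=> T0 s72 solu solv oI I0 uv hN.
apply: (benjamin_unique T0 s72 solu solv).
exact: (benjamin_initial_eq T0 s72 solu solv oI I0 uv hN).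
Qed.
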